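(* Let $(X,d)$ be a closed Alexandrov space of curvature bounded from above by some $K$, let $\hat\sigma$ be a sweepout in $X$ with width $W=W(\hat\sigma)\ge 0$, and let $\gamma^j=\Psi(\sigma^j)$ be the sequence of sweepouts described in the context, obtained from a sequence $\hat\sigma^j\in\Omega_{\hat\sigma}$ with $\max_{s\in[-1,1]}\mathrm{Energy}(\hat\sigma^j(\cdot,s))<W+\frac1j$. Given $\epsilon>0$, there exists $\delta>0$ such that if $j>1/\delta$ and for some $s_0\in[-1,1]$ $$2\pi\,\mathrm{Energy}(\gamma^j(\cdot,s_0))=\mathrm{Length}^2(\gamma^j(\cdot,s_0))>2\pi\,(W-\delta),$$ then for this $j$ we have $\mathrm{dist}\big(\gamma^j(\cdot,s_0),G\big)<\epsilon$.
   Context: Alexandrov spaces. A shortest arc joining $A,B$ in a metric space is a curve joining them with length $d(A,B)$; a metric space is geodesically connected if any two points are joined by a shortest arc. The $K$-plane is $\mathbf{R}^2$ if $K=0$, the standard Euclidean $2$-hemisphere of radius $1/\sqrt K$ if $K>0$, the hyperbolic plane of curvature $K$ if $K<0$. An $\mathfrak{R}_K$ domain is a metric space such that: (i) it is geodesically connected; (ii) if $K>0$, the perimeter of each triangle is less than $2\pi/\sqrt K$; (iii) for each triangle $\triangle ABC$ and its comparison triangle $\triangle\overline A\,\overline B\,\overline C$ in the $K$-plane (same corresponding side lengths), if $D$ is on the side $AC$ and $\overline D$ is the point on $\overline A\,\overline C$ with $d(A,D)=d_{K\text{-plane}}(\overline A,\overline D)$, then $d(B,D)\le d_{K\text{-plane}}(\overline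 B,\overline D)$. $(X,d)$ is an Alexandrov space of curvature bounded from above by $K$ if each point is contained in some neighborhood that is an $\mathfrak{R}_K$ domain. ''Closed'' means compact and without boundary. Energy of maps. For an interval or circle $I$ (here $\mathbf{S}^1$ has length $2\pi$), a map $\sigma:I\to X$ in $L^2$ is in $W^{1,2}(I,X)$ if $$\mathrm{Energy}(\sigma)=E^\sigma=\sup_{f\in C_c(I),\,0\le f\le1}\ \limsup_{\epsilon\to0^+}\int_I f(\eta)\,\frac{d^2(\sigma(\eta-\epsilon),\sigma(\eta))+d^2(\sigma(\eta),\sigma(\eta+\epsilon))}{2\epsilon^2}\,d\eta<\infty .$$ For an $n$-dimensional compact Riemannian domain $\Sigma$ the energy $E^u$ of $u:\Sigma\to X$ is defined likewise with integrand $\frac{1}{w_n}\int_{S_\epsilon(\eta)}\frac{d^2(u(\eta),u(\xi))}{\epsilon^2}\frac{d\sigma_{\eta,\epsilon}(\xi)}{\epsilon^{n-1}}$ ($S_\epsilon(\eta)$ the $\epsilon$-sphere about $\eta$, $\sigma_{\eta,\epsilon}$ its surface measure, $w_n$ the area of the unit sphere of $\mathbf{R}^n$; the integrand is set to $0$ within distance $\epsilon$ of $\partial\Sigma$), and $|\nabla\cdot|^2$ denotes the corresponding energy density. For closed curves $\alpha,\beta\in W^{1,2}(\mathbf{S}^1,X)$ the function $d(\alpha,\beta)$ is in $W^{1,2}(\mathbf{S}^1,\mathbf{R})$ and $\mathrm{dist}(\alpha,\beta)=|d(\alpha,\beta)|_{W^{1,2}}$; $\mathrm{dist}(\alpha,G)$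 is the infimum of $\mathrm{dist}(\alpha,\beta)$ over $\beta\in G$. The radius $\rho$. For each $x\in X$ let $\rho(x,K)>0$ be such that $B_{\rho(x,K)}(x)$ lies in an $\mathfrak{R}_K$ domain of $x$ and $\frac14\int_\Sigma|\nabla d(u,v)|^2\le E^u+E^v-2E^w$ for all compact Riemannian domains $\Sigma$ and all $u,v\in W^{1,2}(\Sigma,X)$ with images in $B_{\rho(x,K)}(x)$, $w$ being the pointwise mid-point map of $u$ and $v$. By compactness $\rho:=\inf_{x\in X}\rho(x,K)>0$. Sweepouts and width. A sweepout in $X$ is a continuous map $\sigma:\mathbf{S}^1\times[-1,1]\to X$ such that $\sigma(\cdot,s)\in W^{1,2}(\mathbf{S}^1,X)$ for each $s$, the map $s\mapsto\sigma(\cdot,s)$ is continuous into $W^{1,2}(\mathbf{S}^1,X)$ (with respect to $\mathrm{dist}$), and $\sigma$ maps $\mathbf{S}^1\times\{-1\}$ and $\mathbf{S}^1\times\{1\}$ to points. $\Omega$ is the set of sweepouts, $\Omega_{\hat\sigma}$ the set of $\sigma\in\Omega$ homotopic to $\hat\sigma$ through maps in $\Omega$, and the width is $W(\hat\sigma)=\inf_{\sigma\in\Omega_{\hat\sigma}}\max_{s\in[-1,1]}\mathrm{Energy}(\sigma(\cdot,s))$. The spaces $\Lambda$ and $G$. For a large positive integer $L$, $\Lambda$ is the space of piecewise linear maps $\mathbf{S}^1\to X$ (i.e. piecewise constant speed geodesics) with exactly $L^2$ breaks (possibly unnecessary breaks), such that each geodesic segment has length at most $\rho$, parametrized by a (constant)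 multiple of arclength and with Lipschitz bound $L$. $G\subset\Lambda$ is the set of (possibly self-intersecting) closed geodesics in $X$ of length at most $\rho L^2$ (constant maps are trivial closed geodesics). The curve shortening map $\Psi:\Lambda\to\Lambda$. Fix consecutive evenly spaced points $x_0,x_1,\dots,x_{2L^2}=x_0$ in $\mathbf{S}^1$, with $|x_j-x_{j+1}|=\frac{\pi}{L^2}\le\frac{\rho}{2L}$. Given $\gamma\in\Lambda$: Step 1, on each even interval $[x_{2j},x_{2j+2}]$ replace $\gamma$ by the unique shortest constant speed geodesic with the same endpoints, obtaining $\gamma_e$; Step 2, replace $\gamma_e$ on each odd interval $[x_{2j+1},x_{2j+3}]$ in the same way, obtaining $\gamma_o$; Step 3, reparametrize $\gamma_o$, fixing $\gamma_o(x_0)$, to constant speed; the result is $\Psi(\gamma)$. The sequence $\gamma^j$. Choose $\hat\sigma^j\in\Omega_{\hat\sigma}$ with $\max_s\mathrm{Energy}(\hat\sigma^j(\cdot,s))<W+\frac1j$. The resulting uniform $C^{1/2}$ bound on slices allows one to fix a partition $y_0,\dots,y_N=y_0$ of $\mathbf{S}^1$, independent of $j,s$, such that each $\hat\sigma^j(\cdot,s)$ maps each $[y_i,y_{i+1}]$ to a geodesic ball in $X$ of radius at most $\rho$. Replace each $\hat\sigma^j(\cdot,s)|_{[y_i,y_{i+1}]}$ by the linear map (geodesic) with the same endpoints and reparametrize to constant speed; call the result $\sigma^j(\cdot,s)$. The slices have a uniform Lipschitz bound; $L$ is chosen as such a bound with $N\le L^2$, so that $\sigma^j(\cdot,s)\in\Lambda$,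 and the $\sigma^j$ are sweepouts in $\Omega_{\hat\sigma}$ satisfying the same energy bound. Finally $\gamma^j(\cdot,s)=\Psi(\sigma^j(\cdot,s))$. *)

(* Defs.v *)
From HB Require Import structures.
From mathcomp Require Export all_boot all_order all_algebra.
From mathcomp Require Export all_classical all_reals all_analysis.
#[export] Set Implicit Arguments.
#[export] Unset Strict Implicit.
#[export] Unset Printing Implicit Defensive.
Export Order.TTheory GRing.Theory Num.Theory.
Export numFieldNormedType.Exports.
#[export] Set Warnings "-notation-overridden".

Local Open Scope classical_set_scope.
Local Open Scope ring_scope.

Section curves.
Context {R : realType} {X : metricType R}.
Implicit Types (c : R -> X) (a b v : R).

Definition curve_length c a b : \bar R :=
  ereal_sup [set (\sum_(p <- zip (a :: s) s) mdist (c p.1) (c p.2))%:E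
            | s in itv_partition a b].

Definition shortest_arc (U : set X) (A B : X) c a b : Prop :=
  [/\ a <= b, {within `[a, b], continuous c}, c @` `[a, b] `<=` U,
      c a = A /\ c b = B & curve_length c a b = (mdist A B)%:E].

(* Shortest geodesic parametrized with constant speed v: the linear maps. *)
Definition linear_on a b c v : Prop :=
  forall s t, s \in `[a, b] -> t \in `[a, b] ->
    mdist (c s) (c t) = v * `|s - t|.

(* Constant speed geodesic: locally shortest, not necessarily shortest. *)
Definition geodesic_on (D : set R) c v : Prop :=
  forall t, D t -> exists2 e, 0 < e & forall s s', D s -> D s' ->
    `|s - t| < e -> `|s' - t| < e -> mdist (c s) (c s') = v * `|s - s'|.

End curves.

Section kplane.
Context {R : realType}.
Implicit Types (K : R) (p q : R * R * R).

(* All the models live in R^3: a closed hemisphere of radius 1 / sqrt K, the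
   plane z = 0, or the upper sheet of a hyperboloid of "radius" 1 / sqrt (- K) *)
Definition kplane K p : Prop :=
  let: (x, y, z) := p in
  if 0 < K then x ^+ 2 + y ^+ 2 + z ^+ 2 = K^-1 /\ 0 <= z
  else if K < 0 then z ^+ 2 - x ^+ 2 - y ^+ 2 = (- K)^-1 /\ 0 < z
  else z = 0.

Definition arcosh (t : R) : R := ln (t + Num.sqrt (t ^+ 2 - 1)).

Definition kdist K p q : R :=
  let: (x, y, z) := p in
  let: (x', y', z') := q in
  if 0 < K then acos (K * (x * x' + y * y' + z * z')) / Num.sqrt K
  else if K < 0 then
    arcosh (- K * (z * z' - x * x' - y * y')) / Num.sqrt (- K)
  else Num.sqrt ((x - x') ^+ 2 + (y - y') ^+ 2).

(* Parametrized by arclength: the point of the side at distance t from p is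
   c t. *)
Definition kside K p q (c : R -> R * R * R) : Prop :=
  let l := kdist K p q in
  [/\ forall t, t \in `[0, l] -> kplane K (c t),
      c 0 = p, c l = q
    & forall s t, s \in `[0, l] -> t \in `[0, l] ->
        kdist K (c s) (c t) = `|s - t|].

Definition comparison_triangle {X : metricType R} K (A B C : X) p q r : Prop :=
  [/\ kplane K p, kplane K q & kplane K r] /\
  [/\ kdist K p q = mdist A B, kdist K q r = mdist B C
    & kdist K p r = mdist A C].

(* U with the restricted distance is the metric space under consideration; as
   any two of its points are joined by a shortest arc of U, any three of its
   points are the vertices of a triangle. *)
Definition RK_domain {X : metricType R} K (U : set X) : Prop :=
  [/\ forall A B, U A -> U B -> exists c, shortest_arc U A B c 0 1,
      0 < K -> forall A B C, U A -> U B -> U C ->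
        mdist A B + mdist B C + mdist C A < 2 * pi / Num.sqrt K
    & forall A B C, U A -> U B -> U C ->
      forall c, shortest_arc U A C c 0 1 ->
      forall p q r, comparison_triangle K A B C p q r ->
      forall pr, kside K p r pr ->
      forall t, t \in `[0, 1] ->
        mdist B (c t) <= kdist K q (pr (mdist A (c t)))].

Definition alexandrov (X : metricType R) K : Prop :=
  forall x : X, exists2 U, nbhs x U & RK_domain K U.

(* For spaces of curvature bounded above, absence of boundary is the geodesic
   extension property (for polyhedral complexes: no free faces; topological
   manifolds without boundary have it). *)
Definition without_boundary (X : metricType R) : Prop :=
  forall (c : R -> X) a b v, a < b -> 0 < v -> geodesic_on `[a, b] c v ->
    exists2 e, 0 < e & exists2 c', {in `[a, b], c' =1 c} &
      geodesic_on `[a, b + e] c' v.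

Definition closed_space (X : metricType R) : Prop :=
  compact [set: X] /\ without_boundary X.

End kplane.

Section smooth.
Context {R : realType} {V W : normedModType R}.

Fixpoint Ck (k : nat) (U : set V) (f : V -> W) : Prop :=
  {in U, continuous f} /\
  if k is k'.+1 then
    forall v, (forall x, U x -> derivable f x v) /\ Ck k' U ('D_v f)
  else True.

Definition smooth_on U f := forall k, Ck k U f.

End smooth.

HB.structure Definition PointedMetric (R : numDomainType) :=
  {T of Metric R T & Pointed T}.
HB.instance Definition _ (R : realType) := Metric.on R^o.

Section hausdorff_measure.
Context {R : realType}.

(* pi ^ (n / 2) / Gamma (n / 2 + 1) *)
Fixpoint unit_ball_volume (n : nat) : R :=
  match n with
  | 0 => 1
  | 1 => 2
  | n'.+2 => 2 * pi / n%:R * unit_ball_volume n'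
  end.

Definition unit_sphere_area (n : nat) : R := n%:R * unit_ball_volume n.

Context {M : metricType R}.
Local Open Scope ereal_scope.

Definition diam (A : set M) : \bar R :=
  ereal_sup [set (mdist p.1 p.2)%:E | p in A `*` A].

Definition hausdorff_gauge n (A : set M) : \bar R :=
  if `[< A = set0 >] then 0
  else (unit_ball_volume n)%:E * ((2^-1)%:E * diam A) ^+ n.

Definition hausdorff (n : nat) (A : set M) : \bar R :=
  ereal_sup [set ereal_inf [set \sum_(0 <= k <oo) hausdorff_gauge n (F k)
    | F in [set F : (set M)^nat | A `<=` \bigcup_k F k /\
                                  forall k, diam (F k) <= delta%:E]]
  | delta in [set delta : R | (0 < delta)%R]].

End hausdorff_measure.

(* A chart together with the metric tensor in the corresponding coordinates. *)
Record chart (R : realType) (n : nat) (M : Type) := Chart {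
  chart_dom : set M;
  chart_im : set 'rV[R]_n;
  chart_map : M -> 'rV[R]_n;
  chart_inv : 'rV[R]_n -> M;
  chart_metric : 'rV[R]_n -> 'M[R]_n
}.

Section charts.
Context {R : realType} {n : nat} {M : topologicalType}.
Implicit Types c : chart R n M.

Definition chart_homeo c : Prop :=
  [/\ open (chart_dom c) /\ open (chart_im c),
      forall p, chart_dom c p ->
        chart_im c (chart_map c p) /\ chart_inv c (chart_map c p) = p,
      forall x, chart_im c x ->
        chart_dom c (chart_inv c x) /\ chart_map c (chart_inv c x) = x,
      {in chart_dom c, continuous (chart_map c)}
    & {in chart_im c, continuous (chart_inv c)}].

Definition chart_sqnorm c (x v : 'rV[R]_n) : R :=
  (v *m chart_metric c x *m v^T) 0 0.

Definition chart_riemannian c : Prop :=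
  [/\ smooth_on (chart_im c) (chart_metric c),
      forall x, chart_im c x -> (chart_metric c x)^T = chart_metric c x
    & forall x v, chart_im c x -> v != 0 -> 0 < chart_sqnorm c x v].

Definition charts_compatible c c' : Prop :=
  let D := chart_im c `&` chart_inv c @^-1` chart_dom c' in
  let tau := chart_map c' \o chart_inv c in
  smooth_on D tau /\
  forall x v, D x -> chart_sqnorm c x v = chart_sqnorm c' (tau x) ('D_v tau x).

Definition C1_arc c (p q : M) (l : \bar R) : Prop :=
  exists y : R -> 'rV[R]_n,
  [/\ (forall t, derivable y t 1) /\ continuous (derive1 y),
      forall t, t \in `[0, 1] -> chart_im c (y t),
      chart_inv c (y 0) = p /\ chart_inv c (y 1) = q
    & l = (\int[lebesgue_measure]_(t in `[0%R, 1%R])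
             (Num.sqrt (chart_sqnorm c (y t) (derive1 y t)))%:E)%E].

Inductive piecewise_C1_arc (atlas : set (chart R n M)) (p : M) :
    M -> \bar R -> Prop :=
  | PiecewiseC1_nil : piecewise_C1_arc atlas p p 0%E
  | PiecewiseC1_rcons c q r l l' : atlas c ->
      piecewise_C1_arc atlas p q l -> C1_arc c q r l' ->
      piecewise_C1_arc atlas p r (l + l')%E.

End charts.

(* Connected smooth Riemannian manifold of dimension n >= 1, carrying the
   Riemannian distance (its finiteness entails connectedness), the volume
   measure and the (n - 1)-dimensional surface measure; the metric topology is
   the manifold topology. *)
Record riemannian_manifold (R : realType) (n : nat) := RiemannianManifold {
  rm_space :> PointedMetric.type R;
  rm_dim_gt0 : (0 < n)%N;
  rm_atlas : set (chart R n rm_space);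
  rm_atlas_cover : forall p, exists2 c, rm_atlas c & chart_dom c p;
  rm_chart_homeo : forall c, rm_atlas c -> chart_homeo c;
  rm_chart_riemannian : forall c, rm_atlas c -> chart_riemannian c;
  rm_compatible : forall c c', rm_atlas c -> rm_atlas c' ->
    charts_compatible c c';
  rm_distE : forall p q, (mdist p q)%:E =
    ereal_inf [set l | piecewise_C1_arc rm_atlas p q l];
  rm_vol : {measure set (g_sigma_algebraType (@open rm_space)) -> \bar R};
  rm_volE : forall A : set (g_sigma_algebraType (@open rm_space)),
    measurable A -> rm_vol A = @hausdorff R rm_space n A;
  rm_surf : {measure set (g_sigma_algebraType (@open rm_space)) -> \bar R};
  rm_surfE : forall A : set (g_sigma_algebraType (@open rm_space)),
    measurable A -> rm_surf A = @hausdorff R rm_space n.-1 A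
}.

Definition compact_domain {T : topologicalType} (S : set T) : Prop :=
  [/\ compact S, S = closure S°, S !=set0 & connected S°].

Section sobolev.
Context {R : realType}.

Definition L2_map d (T : measurableType d) (mu : {measure set T -> \bar R})
    (D : set T) (X : metricType R) (u : T -> X) : Prop :=
  (forall A : set X, open A -> measurable (D `&` u @^-1` A)) /\
  exists q : X, (\int[mu]_(x in D) (mdist (u x) q ^+ 2)%:E < +oo)%E.

Section domain_energy.
Context {n : nat} (M : riemannian_manifold R n) (S : set M)
  {X : metricType R} (u : M -> X).

Let bd : set M := S `\` S°.

Definition approx_density (e : R) (p : M) : \bar R :=
  if `[< exists2 z, bd z & mdist p z <= e >] then 0%E
  else ((unit_sphere_area n)^-1%:E *
    \int[rm_surf M]_(q in [set q : M | mdist p q = e])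
      (mdist (u p) (u q) ^+ 2 / e ^+ 2 / e ^+ n.-1)%:E)%E.

(* S is compact, so that any continuous function on S has compact support. *)
Definition domain_energy : \bar R :=
  ereal_sup [set limf_esup
    (fun e => \int[rm_vol M]_(p in S) ((f p)%:E * approx_density e p))%E 0^'+
  | f in [set f : M -> R | {within S, continuous f} /\
                           forall p, S p -> 0 <= f p <= 1]].

Definition W12_domain : Prop :=
  L2_map (rm_vol M) S u /\ (domain_energy < +oo)%E.

End domain_energy.

(* Maps of the circle of length 2 pi are 2 pi-periodic maps of the line. *)
Definition loop {X : Type} (g : R -> X) : Prop :=
  forall t, g (t + 2 * pi) = g t.

Section circle_energy.
Context {X : metricType R}.
Implicit Types a b g : R -> X.

Definition energy g : \bar R :=
  ereal_sup [set limf_esup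
    (fun e => \int[lebesgue_measure]_(t in `[0%R, (2 * pi)%R])
       (f t * ((mdist (g (t - e)) (g t) ^+ 2 + mdist (g t) (g (t + e)) ^+ 2)
               / (2 * e ^+ 2)))%:E)%E 0^'+
  | f in [set f : R -> R | [/\ loop f, continuous f
                             & forall t, 0 <= f t <= 1]]].

Definition W12_loop g : Prop :=
  [/\ loop g, L2_map (@lebesgue_measure R) `[0, 2 * pi] g
    & (energy g < +oo)%E].

End circle_energy.

(* |h|_{W^{1,2}} for h : S^1 -> R; R^o is R with its metric structure. *)
Definition W12_norm (h : R -> R^o) : \bar R :=
  ((\int[lebesgue_measure]_(t in `[0%R, (2 * pi)%R]) (h t ^+ 2)%:E
    + energy h) `^ 2^-1)%E.

Definition W12_dist {X : metricType R} (a b : R -> X) : \bar R :=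
  W12_norm (fun t => mdist (a t) (b t)).

Definition W12_dist_set {X : metricType R} (a : R -> X) (G : set (R -> X)) :
  \bar R := ereal_inf [set W12_dist a b | b in G].

End sobolev.

Section radius.
Context {R : realType} {X : metricType R}.

(* The admissible values r of rho(x, K). The mid-points are those of the R_K
   domain U containing the ball. The integral over S of |grad d(u, v)|^2 is the
   energy of the function d(u, v). *)
Definition convexity_radius (K : R) (x : X) (r : R) : Prop :=
  0 < r /\
  exists U : set X, [/\ nbhs x U, RK_domain K U, ball x r `<=` U &
    forall n (M : riemannian_manifold R n) (S : set M) (u v w : M -> X),
    compact_domain S ->
    W12_domain S u -> W12_domain S v ->
    (forall p, S p -> ball x r (u p) /\ ball x r (v p)) ->
    (forall p, S p -> [/\ U (w p), mdist (u p) (w p) = mdist (u p) (v p) / 2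
                                 & mdist (w p) (v p) = mdist (u p) (v p) / 2]) ->
    ((4^-1)%:E * domain_energy S (fun p => mdist (u p) (v p) : R^o)
       <= domain_energy S u + domain_energy S v - 2%:E * domain_energy S w)%E].

End radius.

Section sweepouts.
Context {R : realType} {X : metricType R}.
(* [sigma s] is the slice sigma(., s), a map of the circle. *)
Implicit Types sigma : R -> R -> X.

Definition sweepout sigma : Prop :=
  [/\ {within `[-1, 1] `*` [set: R], continuous (fun p => sigma p.1 p.2)},
      forall s, s \in `[-1, 1] -> W12_loop (sigma s),
      forall s0, s0 \in `[-1, 1] ->
        W12_dist (sigma s) (sigma s0) @[s --> within `[-1, 1] (nbhs s0)] --> 0%E,
      exists p, forall t, sigma (-1) t = p
    & exists p, forall t, sigma 1 t = p].

Definition homotopic_sweepout sigma0 sigma1 : Prop :=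
  exists H : R -> R -> R -> X,
  [/\ {within `[0, 1] `*` `[-1, 1] `*` [set: R],
        continuous (fun p : R * R * R => H p.1.1 p.1.2 p.2)},
      forall r, r \in `[0, 1] -> sweepout (H r),
      forall s, s \in `[-1, 1] -> H 0 s = sigma0 s
    & forall s, s \in `[-1, 1] -> H 1 s = sigma1 s].

Definition Omega sigma0 : set (R -> R -> X) :=
  [set sigma | sweepout sigma /\ homotopic_sweepout sigma0 sigma].

Definition max_energy sigma : \bar R :=
  ereal_sup [set energy (sigma s) | s in `[-1, 1]].

Definition width sigma0 : \bar R :=
  ereal_inf [set max_energy sigma | sigma in Omega sigma0].

End sweepouts.

Section shortening.
Context {R : realType} {X : metricType R}.
Implicit Types (g h : R -> X) (rho x : R) (L N : nat) (y : nat -> R).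

(* The points y_0, ..., y_N = y_0 of the circle, lifted to the line. *)
Definition circle_partition N y : Prop :=
  [/\ (0 < N)%N, forall i, (i < N)%N -> y i < y i.+1 & y N = y 0%N + 2 * pi].

Definition Lambda rho L : set (R -> X) :=
  [set g | [/\ loop g,
    forall s t, mdist (g s) (g t) <= L%:R * `|s - t| &
    exists v y, circle_partition (L ^ 2) y /\
      forall i, (i < L ^ 2)%N -> geodesic_on `[y i, y i.+1] g v /\
        (curve_length g (y i) (y i.+1) <= rho%:E)%E]].

Definition loop_length g : \bar R := curve_length g 0 (2 * pi).

Definition closed_geodesics rho L : set (R -> X) :=
  [set g | [/\ Lambda rho L g, exists v, geodesic_on setT g v
             & (loop_length g <= (rho * (L ^ 2)%:R)%:E)%E]].

Definition linear_replacement N y g h : Prop :=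
  loop h /\ forall i, (i < N)%N ->
    [/\ h (y i) = g (y i), h (y i.+1) = g (y i.+1)
      & exists v, linear_on (y i) (y i.+1) h v].

(* phi need not be injective, since g may be constant on some intervals. If g
   has length 0, then so does h, because phi is onto. *)
Definition constant_speed_reparam (a : R) g h : Prop :=
  [/\ loop h,
      exists phi : R -> R, [/\ {within `[a, a + 2 * pi], continuous phi},
        {in `[a, a + 2 * pi] &, {homo phi : s t / s <= t}},
        phi a = a /\ phi (a + 2 * pi) = a + 2 * pi
        & forall t, t \in `[a, a + 2 * pi] -> g t = h (phi t)]
    & exists v, forall s t, s <= t -> curve_length h s t = (v * (t - s))%:E].

Definition xpoint L x (k : nat) : R := x + k%:R * (pi / (L ^ 2)%:R).

(* The graph of the curve shortening map Psi: for g in Lambda the shortest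
   geodesics in both replacements have endpoints at distance at most rho, hence
   are unique. *)
Definition curve_shortening L x g h : Prop :=
  exists ge go,
  [/\ linear_replacement (L ^ 2) (fun j => xpoint L x j.*2) g ge,
      linear_replacement (L ^ 2) (fun j => xpoint L x j.*2.+1) ge go
    & constant_speed_reparam x go h].

End shortening.

(* Main.v *)
Require Import Defs.
From mathcomp Require Import ring lra.
From mathcomp Require unstable.
Local Open Scope classical_set_scope.
Local Open Scope ring_scope.

(* The slices sigma(., s) satisfy Length^2 <= 2 pi Energy(hsigma(., s)) by comparison
   of the energy with inscribed polygons, so that for a sequence of counterexamples
   with delta tending to 0 the difference Length(sigma) - Length(gamma) tends to 0:
   asymptotically, neither replacement step of Psi loses length. As X is compact and
   the loops are uniformly Lipschitz, they converge along an ultrafilter. A limit of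
   loops whose replacement by chords loses no length is shortest on every even and on
   every odd interval, hence is a closed geodesic c, and gamma converges to c uniformly.
   For the W^{1,2} distance put f = d(gamma, c). Comparison of midlines of triangles
   makes f semiconvex away from the breaks of gamma; as f is Lipschitz and tends to 0
   uniformly, summation by parts shows that Energy(f) is at most a constant times
   sup f. *)

(** * Lengths of curves *)

(** Uniform closeness alone says nothing about closeness in [W^{1,2}]: the derivatives of
    equi-Lipschitz functions tending to 0 may keep oscillating. Semiconvexity excludes this by
    bounding second differences from one side. On spheres the distance between two segments is not
    convex, even locally; the resulting error of order [e ^+ 2] is harmless because the energy
    divides by [e ^+ 2]. The breaks of the shortened curve move with its reparametrization, so that
    only their number, [2 * L ^ 2] per period, may enter the estimate. The threshold [delta] is not
    computed but comes from compactness; an ultrafilter provides limits at all times at once, in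
    place of a diagonal subsequence. No estimate divides by a speed: the proof works with
    [v * (phi t - t)] and with squares of speeds, so that [W = 0] is covered with the rest. *)

Section lengths.
Context {R : realType} {X : metricType R}.
Implicit Types (c g h : R -> X) (a b v : R).

(** Partitions are strictly increasing, so a break [t] equal to an endpoint has to be dropped from
    the polygon; hence the case distinction. *)
Lemma curve_length_ge c a t b : a <= t -> t <= b ->
  ((mdist (c a) (c t) + mdist (c t) (c b))%:E <= curve_length c a b)%E.
Proof.
rewrite le_eqVlt => /predU1P[<-|at_].
  rewrite mdistxx add0r le_eqVlt => /predU1P[->|ab].
    by rewrite mdistxx; apply: ereal_sup_ubound; exists [::];
      [split => /= | rewrite big_nil].
  by apply: ereal_sup_ubound; exists [:: b];
    [split => /=; rewrite ?ab | rewrite big_seq1].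
rewrite le_eqVlt => /predU1P[<-|tb].
  by rewrite mdistxx addr0; apply: ereal_sup_ubound; exists [:: t];
    [split => /=; rewrite ?at_ | rewrite big_seq1].
apply: ereal_sup_ubound; exists [:: t; b]; first by split => /=; rewrite ?at_ ?tb.
by rewrite /= big_cons big_seq1.
Qed.

Lemma mdist_le_curve_length c a b : a <= b ->
  ((mdist (c a) (c b))%:E <= curve_length c a b)%E.
Proof.
by move=> ab; have := curve_length_ge c ab (lexx b); rewrite mdistxx addr0.
Qed.

(** [f] acts as a primitive of a speed bound; its increments telescope along every partition. *)
Lemma curve_length_le c (f : R -> R) a b :
  (forall s t, a <= s -> s <= t -> t <= b -> mdist (c s) (c t) <= f t - f s) ->
  (curve_length c a b <= (f b - f a)%:E)%E.
Proof.
move=> cf; apply: ge_ereal_sup => _ [s [ps /eqP sb] <-]; rewrite lee_fin.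
elim: s a cf ps sb => [|x s IHs] a cf /= => [_ <-|/andP[ax xs] sb].
  by rewrite big_nil subrr.
have xb : x <= b by rewrite -sb unstable.path_lt_le_last.
rewrite big_cons /=; have := cf _ _ (lexx a) (ltW ax) xb.
have := IHs x (fun u t xu => cf u t (le_trans (ltW ax) xu)) xs sb.
by lra.
Qed.

(** [phi] may have plateaus, so a partition of [[phi a, phi b]] is pulled back by a right inverse
    [psi], which exists by the intermediate value theorem and is increasing because [phi] is
    monotone. *)
Lemma curve_length_reparam_le h (phi f : R -> R) a b : a <= b ->
  {within `[a, b], continuous phi} ->
  {in `[a, b] &, {homo phi : s t / s <= t}} ->
  (forall s t, a <= s -> s <= t -> t <= b ->
    mdist (h (phi s)) (h (phi t)) <= f t - f s) ->
  (curve_length h (phi a) (phi b) <= (f b - f a)%:E)%E.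
Proof.
move=> ab cphi mphi hf.
have aI : a \in `[a, b] by rewrite in_itv /= lexx ab.
have bI : b \in `[a, b] by rewrite in_itv /= lexx ab.
have pab : phi a <= phi b by exact: mphi.
have /choice[psi psiP] p : exists t, phi a <= p <= phi b ->
    [/\ a <= t, t <= b & phi t = p].
  case: (boolP (phi a <= p <= phi b)) => [pI|_]; last by exists 0.
  have [|t] := @IVT R phi a b p ab cphi; first by rewrite min_l // max_r.
  by rewrite in_itv /= => /andP[? ?] <-; exists t.
apply: (@le_trans _ _ (f (psi (phi b)) - f (psi (phi a)))%:E).
  apply: (@curve_length_le h (f \o psi)) => p q ap pq qb /=.
  have [|psi1 psi2 psi3] := psiP p; first by lra.
  have [|qsi1 qsi2 qsi3] := psiP q; first by lra.
  have [E|npq] := eqVneq p q; first by rewrite E mdistxx subrr.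
  have [le_psi|lt_psi] := leP (psi p) (psi q).
    by rewrite -{1}psi3 -{1}qsi3; exact: hf.
  have : phi (psi q) <= phi (psi p).
    by apply: mphi; rewrite ?in_itv /= ?psi1 ?psi2 ?qsi1 ?qsi2 // ltW.
  by rewrite psi3 qsi3 => qp; move: npq; rewrite eq_le pq qp.
rewrite lee_fin.
(* [psi] need not send [phi a] to [a] nor [phi b] to [b]. The increments of [f] left over at the two
   ends bound distances, so they are nonnegative. *)
have [|a1 a2 _] := psiP (phi a); first by rewrite lexx.
have [|b1 b2 _] := psiP (phi b); first by rewrite lexx pab.
have := hf _ _ (lexx a) a1 a2; have := hf _ _ b1 b2 (lexx b).
have := mdist_ge0 (h (phi a)) (h (phi (psi (phi a)))).
have := mdist_ge0 (h (phi (psi (phi b)))) (h (phi b)).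
by lra.
Qed.

(** Both sides are the length of [h] between [phi s] and [phi t]: the parametrization by [phi]
    bounds it from above, the chord from below. *)
Lemma reparam_linear_piece h (phi : R -> R) v w a b : a <= b ->
  {within `[a, b], continuous phi} ->
  {in `[a, b] &, {homo phi : s t / s <= t}} ->
  (forall s t, s <= t -> curve_length h s t = (v * (t - s))%:E) ->
  linear_on a b (h \o phi) w ->
  forall s t, a <= s -> s <= t -> t <= b -> v * (phi t - phi s) = w * (t - s).
Proof.
move=> ab cphi mphi hv lw s t as_ st tb.
have sI : s \in `[a, b] by rewrite in_itv /=; lra.
have tI : t \in `[a, b] by rewrite in_itv /=; lra.
have sub : `[s, t] `<=` `[a, b].
  by move=> x; rewrite /= !in_itv /= => /andP[? ?]; lra.
have pst : phi s <= phi t by exact: mphi.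
have dE s' t' : a <= s' -> s' <= t' -> t' <= b ->
    mdist (h (phi s')) (h (phi t')) = w * (t' - s').
  move=> ? ? ?; have /= -> := lw s' t'; rewrite ?in_itv /=; try lra.
  by rewrite ler0_norm ?opprB //; lra.
apply/eqP; rewrite eq_le -!lee_fin -hv //; apply/andP; split.
  have -> : w * (t - s) = w * t - w * s by ring.
  apply: (@curve_length_reparam_le h phi (fun t => w * t)) => //.
  - exact: continuous_subspaceW cphi.
  - by move=> x y xI yI; apply: mphi; apply: sub.
  - move=> s1 t1 s1s s1t t1t; rewrite dE; [|lra|lra|lra].
    by rewrite mulrBr.
by rewrite -dE //; exact: mdist_le_curve_length.
Qed.

(** By the preceding identity the chord from [phi s] to [phi t] has length [v * (phi t - phi s)],
    and [phi] is onto [[phi a, phi b]]. *)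
Lemma reparam_linear_on h (phi : R -> R) v w a b : a <= b -> 0 <= v ->
  {within `[a, b], continuous phi} ->
  {in `[a, b] &, {homo phi : s t / s <= t}} ->
  (forall s t, s <= t -> curve_length h s t = (v * (t - s))%:E) ->
  linear_on a b (h \o phi) w -> linear_on (phi a) (phi b) h v.
Proof.
move=> ab v0 cphi mphi hv lw.
have aI : a \in `[a, b] by rewrite in_itv /= lexx.
have bI : b \in `[a, b] by rewrite in_itv /= lexx andbT.
have surj p : p \in `[phi a, phi b] -> exists2 t, t \in `[a, b] & phi t = p.
  rewrite in_itv /= => pI; apply: IVT => //.
  by rewrite min_l ?max_r // mphi.
have dE s t : s \in `[a, b] -> t \in `[a, b] -> s <= t ->
    mdist (h (phi s)) (h (phi t)) = v * (phi t - phi s).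
  move=> sI tI st; have /= -> := lw s t sI tI.
  move: sI tI; rewrite !in_itv /= => /andP[as_ _] /andP[_ tb].
  rewrite (reparam_linear_piece ab cphi mphi hv lw as_ st tb).
  by rewrite distrC ger0_norm // subr_ge0.
move=> _ _ /surj[s sI <-] /surj[t tI <-]; have [st|/ltW ts] := leP s t.
  by rewrite dE // distrC ger0_norm // subr_ge0 mphi.
by rewrite metric_sym dE // ger0_norm // subr_ge0 mphi.
Qed.

Lemma additive_bound_glue g (f : R -> R) (y : nat -> R) n :
  (forall i, (i < n)%N -> y i <= y i.+1) ->
  (forall i s t, (i < n)%N -> y i <= s -> s <= t -> t <= y i.+1 ->
     mdist (g s) (g t) <= f t - f s) ->
  forall s t, y 0%N <= s -> s <= t -> t <= y n -> mdist (g s) (g t) <= f t - f s.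
Proof.
elim: n => [|n IHn] yS gf s t y0s st.
  move=> ty0; have -> : s = t by lra.
  by rewrite mdistxx subrr.
move=> tyS.
have {}IHn := IHn (fun i hi => yS i (ltnW hi)) (fun i s t hi => gf i s t (ltnW hi)).
have [tn|nt] := leP t (y n); first exact: IHn.
have [ns|sn] := leP (y n) s; first exact: (gf n).
have := IHn s (y n) y0s (ltW sn) (lexx _).
have := gf n (y n) t (ltnSn n) (lexx _) (ltW nt) tyS.
have := metric_triangle (g s) (g (y n)) (g t); lra.
Qed.

Lemma linear_on_speed_ge0 g a b v : a < b -> linear_on a b g v -> 0 <= v.
Proof.
move=> ab /(_ a b); rewrite !in_itv /= !lexx (ltW ab) => /(_ isT isT) E.
have := mdist_ge0 (g a) (g b); rewrite E pmulr_lge0 // normr_gt0 subr_eq0.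
by rewrite lt_eqF.
Qed.

End lengths.

(** * Continuity of the distance, Lipschitz curves, segments reversed or restricted *)

Section metric_continuity.
Context {R : realType} {X : metricType R}.

Lemma ler_dist_mdist (a b c d : X) :
  `|mdist a b - mdist c d| <= mdist a c + mdist b d.
Proof.
rewrite ler_norml.
have := metric_triangle a c b; have := metric_triangle c d b.
have := metric_triangle c a d; have := metric_triangle a b d.
rewrite (metric_sym d b) (metric_sym c a); lra.
Qed.

Lemma cvg_mdist {T : Type} (F : set_system T) {FF : Filter F} (f g : T -> X) (x y : X) :
  f @ F --> x -> g @ F --> y ->
  (fun t => mdist (f t) (g t)) @ F --> (mdist x y : R).
Proof.
move=> /metricType_numDomainType.cvgrPdist_lt fx.
move=> /metricType_numDomainType.cvgrPdist_lt gy.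
apply/cvgrPdist_lt => e e0; have e2 : 0 < e / 2 by rewrite divr_gt0.
near=> t; apply: le_lt_trans (ler_dist_mdist _ _ _ _) _.
have h1 : mdist x (f t) < e / 2 by near: t; exact: fx.
have h2 : mdist y (g t) < e / 2 by near: t; exact: gy.
lra.
Unshelve. all: end_near. Qed.

Lemma lipschitz_within_continuous (D : set R) (g : R -> X) (k : R) :
  (forall s t, D s -> D t -> mdist (g s) (g t) <= k * `|s - t|) ->
  {within D, continuous g}.
Proof.
move=> gk; apply/subspace_continuousP => x Dx.
apply/metricType_numDomainType.cvgrPdist_lt => e e0.
have k0 : 0 < `|k| + 1 by rewrite ltr_pwDr.
have ek : 0 < e / (`|k| + 1) by rewrite divr_gt0.
rewrite near_withinE; near=> t => Dt.
apply: le_lt_trans (gk _ _ Dx Dt) _.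
have : `|x - t| < e / (`|k| + 1).
  by near: t; exact: cvgr_dist_lt.
rewrite ltr_pdivlMr //; apply: le_lt_trans.
rewrite mulrC ler_wpM2l //; have := ler_norm k; lra.
Unshelve. all: end_near. Qed.

Lemma lipschitz_continuous (g : R -> X) (k : R) :
  (forall s t, mdist (g s) (g t) <= k * `|s - t|) -> continuous g.
Proof.
move=> gk; apply/continuous_subspace_setT.
by apply: (@lipschitz_within_continuous _ _ k) => s t _ _; exact: gk.
Qed.

Lemma linear_on_rev (g : R -> X) (a b v : R) :
  linear_on a b g v -> linear_on a b (fun t => g (a + b - t)) v.
Proof.
move=> lg s t; rewrite !in_itv /= => /andP[? ?] /andP[? ?].
rewrite lg ?in_itv /=; try lra.
by rewrite distrC (_ : _ - _ = s - t) //; ring.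
Qed.

Lemma linear_on_sub (g : R -> X) (a b a' b' v : R) : a <= a' -> b' <= b ->
  linear_on a b g v -> linear_on a' b' g v.
Proof.
move=> aa bb lg s t; rewrite !in_itv /= => /andP[? ?] /andP[? ?].
by apply: lg; rewrite in_itv /=; lra.
Qed.

End metric_continuity.

(** * Energy of loops *)

Section periodic_integrals.
Context {R : realType}.
Notation mu := (@lebesgue_measure R).
Implicit Types (f g : R -> R) (a b c : R).

Lemma continuous_itv_integrable f a b : continuous f ->
  mu.-integrable `[a, b] (EFin \o f).
Proof.
move=> cf; apply: continuous_compact_integrable; first exact: segment_compact.
exact: continuous_subspaceT.
Qed.

Lemma continuous_integralE f a b : continuous f ->
  (\int[mu]_(t in `[a, b]) (f t)%:E)%E = (\int[mu]_(t in `[a, b]) f t)%:E.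
Proof.
move=> cf; rewrite /Rintegral fineK //.
by apply: integrable_fin_num => //; exact: continuous_itv_integrable.
Qed.

Lemma ler_Rintegral_itv f g a b : continuous f -> continuous g ->
  (forall t, a <= t <= b -> f t <= g t) ->
  \int[mu]_(t in `[a, b]) f t <= \int[mu]_(t in `[a, b]) g t.
Proof.
move=> cf cg fg; apply: le_Rintegral; [by []|exact: continuous_itv_integrable|
  exact: continuous_itv_integrable|].
by move=> t /=; rewrite in_itv /=; exact: fg.
Qed.

Lemma Rintegral_itv_split f a b c : continuous f -> a <= b -> b <= c ->
  \int[mu]_(t in `[a, c]) f t =
  \int[mu]_(t in `[a, b]) f t + \int[mu]_(t in `[b, c]) f t.
Proof.
move=> cf ab bc.
have := @Rintegral_itvB R f (BLeft a) (BRight c) b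
  (continuous_itv_integrable a c cf).
rewrite !bnd_simp => /(_ ab bc).
rewrite Rintegral_itv_obnd_cbnd; first by move=> <-; rewrite addrC subrK.
apply: integrableS (continuous_itv_integrable b c cf) => //.
by apply: subset_itvr; rewrite bnd_simp.
Qed.

Lemma Rintegral_itv_shift f a b c : continuous f -> a <= b ->
  \int[mu]_(t in `[a, b]) f (t + c) = \int[mu]_(t in `[a + c, b + c]) f t.
Proof.
move=> cf ab; rewrite /Rintegral; congr fine; apply/esym.
have dF : derive1 (fun x : R => x + c) = cst 1.
  by apply/funext => x; rewrite derive1E deriveD // derive_id derive_cst addr0.
rewrite (@integration_by_substitution_increasing R (fun x => x + c) f a b ab).
- by apply: eq_integral => t _ /=; rewrite /= !fctE dF mulr1.
- by move=> x y _ _; rewrite ltrD2r.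
- by rewrite dF => x _; exact: cvg_cst.
- by rewrite dF; exact: is_cvg_cst.
- by rewrite dF; exact: is_cvg_cst.
- split => /=.
  + by move=> x _; exact: derivableD.
  + by apply: cvg_at_right_filter; apply: cvgD => //; exact: cvg_cst.
  + by apply: cvg_at_left_filter; apply: cvgD => //; exact: cvg_cst.
- exact: continuous_subspaceT.
Qed.

Lemma continuous_shift f c : continuous f -> continuous (fun t => f (t + c)).
Proof.
by move=> cf t; apply: continuous_comp; [apply: cvgD => //; exact: cvg_cst|exact: cf].
Qed.

(** The interval [[0, a + 2 * pi]] is split at [a] and at [2 * pi]; the pieces [[0, a]] and
    [[2 * pi, a + 2 * pi]] cancel by periodicity. *)
Lemma loop_Rintegral f a : continuous f -> loop f ->
  \int[mu]_(t in `[a, a + 2 * pi]) f t = \int[mu]_(t in `[0, 2 * pi]) f t.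
Proof.
have p0 : 0 < 2 * pi :> R by rewrite mulr_gt0 // pi_gt0.
have pos f' b : continuous f' -> loop f' -> 0 <= b ->
    \int[mu]_(t in `[b, b + 2 * pi]) f' t = \int[mu]_(t in `[0, 2 * pi]) f' t.
  move=> cf lf b0.
  have bb : b <= b + 2 * pi by rewrite lerDl ltW.
  have pb : 2 * pi <= b + 2 * pi by rewrite lerDr.
  have h3 : \int[mu]_(t in `[2 * pi, b + 2 * pi]) f' t = \int[mu]_(t in `[0, b]) f' t.
    have := @Rintegral_itv_shift f' 0 b (2 * pi) cf b0; rewrite add0r => <-.
    by apply: eq_Rintegral => t _; rewrite lf.
  have := Rintegral_itv_split cf (ltW p0) pb.
  by rewrite (Rintegral_itv_split cf b0 bb) h3 [RHS]addrC => /addrI.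
move=> cf lf; have [a0|a0] := leP 0 a; first exact: pos.
(* For negative [a], the nonnegative case is applied to this translate at the base point [- a]. *)
pose g t := f (t + a).
have cg : continuous g by exact: continuous_shift.
have lg : loop g by move=> t; rewrite /g addrAC lf.
have Na0 : 0 <= - a by rewrite oppr_ge0 ltW.
have ap : - a <= - a + 2 * pi by rewrite lerDl ltW.
have := pos g (- a) cg lg Na0.
rewrite /g (Rintegral_itv_shift _ cf ap) (Rintegral_itv_shift _ cf (ltW p0)).
by rewrite addNr add0r addrAC addNr add0r (addrC (2 * pi)) => ->.
Qed.

Lemma loop_Rintegral_shift f c : continuous f -> loop f ->
  \int[mu]_(t in `[0, 2 * pi]) f (t + c) = \int[mu]_(t in `[0, 2 * pi]) f t.
Proof.
move=> cf lf; rewrite Rintegral_itv_shift ?mulr_ge0 ?pi_ge0 //.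
by rewrite add0r (addrC (2 * pi)) loop_Rintegral.
Qed.

End periodic_integrals.

(** * Lower bound of the energy by inscribed polygons *)

Section energy_lower_bound.
Context {R : realType} {X : metricType R}.
Notation mu := (@lebesgue_measure R).
Implicit Types (u : R -> X) (p : nat -> X) (y : nat -> R).

Lemma continuous_mdist_comp {T : topologicalType} (f g : T -> X) :
  continuous f -> continuous g -> continuous (fun t => mdist (f t) (g t)).
Proof. by move=> cf cg t; apply: cvg_mdist; [exact: cf|exact: cg]. Qed.

Lemma continuous_shift_metric u c : continuous u -> continuous (fun t => u (t + c)).
Proof.
by move=> cu t; apply: continuous_comp; [apply: cvgD => //; exact: cvg_cst|exact: cu].
Qed.

Lemma continuous_sqr (f : R -> R) : continuous f -> continuous (fun t => f t ^+ 2).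
Proof. by move=> cf t; apply: cvgM; exact: cf. Qed.

Lemma polygon_ge_chord p (a b : nat) : (a <= b)%N ->
  mdist (p a) (p b) <= \sum_(a <= k < b) mdist (p k) (p k.+1).
Proof.
elim: b => [|b IHb]; first by rewrite leqn0 => /eqP ->; rewrite big_geq // mdistxx.
rewrite leq_eqVlt => /predU1P[->|ab]; first by rewrite big_geq // mdistxx.
rewrite big_nat_recr //=; have := metric_triangle (p a) (p b) (p b.+1).
by have := IHb ab; lra.
Qed.

Lemma polygon_ge_subpolygon p (m : nat -> nat) N :
  (forall i, (i < N)%N -> (m i <= m i.+1)%N) ->
  \sum_(i < N) mdist (p (m i)) (p (m i.+1)) <=
  \sum_(m 0%N <= k < m N) mdist (p k) (p k.+1).
Proof.
elim: N => [|N IHN] mS; first by rewrite big_ord0 big_geq.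
have m0N : (m 0%N <= m N)%N.
  elim: N mS {IHN} => // N IHN mS.
  by apply: leq_trans (IHN (fun i hi => mS i (leqW hi))) (mS N (leqnSn _)).
rewrite big_ord_recr /= (big_cat_nat (n := m N)) ?mS //=.
by apply: lerD; [apply: IHN => i hi; apply: mS; exact: leqW|
  apply: polygon_ge_chord; exact: mS].
Qed.

(** Cauchy-Schwarz, by summing the tangent inequality [2 * c * d k - c ^+ 2 <= d k ^+ 2] at
    [c = s / n]. *)
Lemma sum_sqr_ge (d : nat -> R) n (s : R) : (0 < n)%N -> 0 <= s ->
  s <= \sum_(k < n) d k -> s ^+ 2 / n%:R <= \sum_(k < n) d k ^+ 2.
Proof.
move=> n0 s0 sd; have n0' : 0 < n%:R :> R by rewrite ltr0n.
set c := s / n%:R; have c0 : 0 <= c by rewrite divr_ge0 // ltW.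
have : \sum_(k < n) (2 * c * d k - c ^+ 2) <= \sum_(k < n) d k ^+ 2.
  by apply: ler_sum => k _; have := sqr_ge0 (d k - c); rewrite sqrrB; lra.
move=> H; apply: le_trans H.
rewrite sumrB -mulr_sumr sumr_const card_ord -(mulr_natr (c ^+ 2)).
have cn : c * n%:R = s by rewrite divfK // gt_eqF.
have -> : s ^+ 2 / n%:R = c * s by rewrite /c; field; rewrite gt_eqF.
have -> : c ^+ 2 * n%:R = c * s by rewrite -cn; ring.
have : c * s <= c * \sum_(k < n) d k by rewrite ler_wpM2l.
lra.
Qed.

Lemma continuous_sum_shift (F : R -> R) (e : R) n : continuous F ->
  continuous (fun t => \sum_(k < n) F (t + k%:R * e)).
Proof.
move=> cF; elim: n => [|n IHn].
  by under eq_fun do rewrite big_ord0; move=> t; exact: cvg_cst.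
under eq_fun do rewrite big_ord_recr /=.
by move=> t; apply: cvgD; [exact: IHn|exact: continuous_shift].
Qed.

Lemma Rintegral_fold (F : R -> R) (a e : R) n : continuous F -> 0 <= e ->
  \int[mu]_(t in `[a, a + n%:R * e]) F t =
  \int[mu]_(t in `[a, a + e]) (\sum_(k < n) F (t + k%:R * e)).
Proof.
move=> cF e0; elim: n => [|n IHn].
  rewrite mul0r addr0 set_itv1 Rintegral_set1.
  under eq_Rintegral do rewrite big_ord0.
  by rewrite Rintegral_cst // mul0r.
have ne : 0 <= n%:R * e by rewrite mulr_ge0.
rewrite (@Rintegral_itv_split R F a (a + n%:R * e)) //; first last.
- by rewrite -natr1; lra.
- by lra.
rewrite IHn; under [in RHS]eq_Rintegral do rewrite big_ord_recr /=.
rewrite RintegralD //.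
- congr (_ + _); rewrite Rintegral_itv_shift //; last lra.
  by rewrite (_ : a + e + n%:R * e = a + n.+1%:R * e) // -natr1; ring.
- by apply: continuous_itv_integrable; exact: continuous_sum_shift.
- by apply: continuous_itv_integrable; exact: continuous_shift.
Qed.


Lemma natr_floor (x : R) : 0 <= x -> exists m : nat, m%:R <= x < m%:R + 1.
Proof.
by move=> x0; exists (Num.trunc x); rewrite natr1; exact: truncn_itv.
Qed.

(* Folding the integral modulo [2 * pi / n] turns it into an average of energies of
   inscribed [n]-gons, to which the Cauchy-Schwarz inequality applies. *)
Lemma loop_polygon_le_energy_integral u N y n (eta : R) :
  continuous u -> loop u -> circle_partition N y -> (0 < n)%N ->
  (forall i t, (i <= N)%N -> `|y i - t| <= 2 * (2 * pi / n%:R) ->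
     mdist (u (y i)) (u t) <= eta) ->
  2 * N%:R * eta <= \sum_(i < N) mdist (u (y i)) (u (y i.+1)) ->
  (\sum_(i < N) mdist (u (y i)) (u (y i.+1)) - 2 * N%:R * eta) ^+ 2 / (2 * pi) <=
  \int[mu]_(t in `[0, 2 * pi]) (mdist (u t) (u (t + 2 * pi / n%:R)) ^+ 2
                                / (2 * pi / n%:R) ^+ 2).
Proof.
move=> cu lu [N0 ymono yN] n0 ueta etaS.
have n0' : 0 < n%:R :> R by rewrite ltr0n.
have p0 : 0 < 2 * pi :> R by rewrite mulr_gt0 // pi_gt0.
set e := 2 * pi / n%:R in ueta *; have e0 : 0 < e by rewrite divr_gt0.
have ne : n%:R * e = 2 * pi by rewrite /e mulrC divfK // gt_eqF.
set S := \sum_(i < N) _ in etaS *; set s := S - 2 * N%:R * eta.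
set F := fun t => mdist (u t) (u (t + e)) ^+ 2 / e ^+ 2.
have cd : continuous (fun t => mdist (u t) (u (t + e))).
  by apply: continuous_mdist_comp => //; exact: continuous_shift_metric.
have cF : continuous F.
  by move=> t; apply: cvgM; [exact: continuous_sqr|exact: cvg_cst].
have lF : loop F by move=> t; rewrite /F lu addrAC lu.
have y_ge0 i : (i <= N)%N -> y 0%N <= y i.
  elim: i => // i IHi iN; apply: le_trans (IHi (ltnW iN)) _; exact/ltW/ymono.
(* [m i] is the index of the last point at or before [y i] in the grid of step [e] starting at
   [y 0]; it runs from 0 to [n], since [n * e] is the period. *)
have /choice[m mP] i : exists k : nat, (i <= N)%N ->
    k%:R * e <= y i - y 0%N < (k%:R + 1) * e.
  have [iN|_] := boolP (i <= N)%N; last by exists 0%N.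
  have [|k /andP[k1 k2]] := @natr_floor ((y i - y 0%N) / e).
    by apply: divr_ge0; [rewrite subr_ge0 y_ge0|exact: ltW].
  by exists k => _; rewrite -ler_pdivlMr // k1 -ltr_pdivrMr.
have m0 : m 0%N = 0%N.
  have /andP[+ _] := mP 0%N isT; rewrite subrr pmulr_lle0 // lern0.
  by move/eqP.
have mN : m N = n.
  have /andP[+ +] := mP N (leqnn N); rewrite yN addrAC subrr add0r -ne.
  rewrite ler_pM2r // ltr_pM2r // ler_nat natr1 ltr_nat ltnS => h1 h2.
  by apply/eqP; rewrite eqn_leq h1 h2.
have mS i : (i < N)%N -> (m i <= m i.+1)%N.
  move=> iN; have /andP[h1 _] := mP i (ltnW iN); have /andP[_ h2] := mP i.+1 iN.
  have := ymono i iN => h3; rewrite -ltnS -(ltr_nat R) -natr1.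
  by rewrite -(ltr_pM2r e0); lra.
(* For [t] in this window the grid point [t + m i * e] lies between [y i - 2 * e] and [y i]: hence
   the factor 2 in the closeness hypothesis. Each of the [N] chords then changes by at most
   [2 * eta]. *)
have key t : y 0%N - e <= t <= y 0%N - e + e ->
    s ^+ 2 / n%:R / e ^+ 2 <= \sum_(k < n) F (t + k%:R * e).
  move=> /andP[t1 t2]; rewrite /F -mulr_suml ler_pM2r ?invr_gt0 ?exprn_gt0 //.
  apply: (@sum_sqr_ge (fun k => mdist (u (t + k%:R * e)) (u (t + k%:R * e + e)))) => //.
    by rewrite /s subr_ge0.
  pose p k := u (t + k%:R * e).
  have := polygon_ge_subpolygon p mS; rewrite m0 mN big_mkord => h.
  have -> : \sum_(k < n) mdist (u (t + k%:R * e)) (u (t + k%:R * e + e)) =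
      \sum_(k < n) mdist (p k) (p k.+1).
    by apply: eq_bigr => k _; rewrite /p -natr1 mulrDl mul1r addrA.
  apply: le_trans h; rewrite /s lerBlDr.
  have pe i : (i <= N)%N -> mdist (u (y i)) (p (m i)) <= eta.
    move=> iN; apply: ueta => //; have /andP[h1 h2] := mP i iN.
    by rewrite ler_norml; lra.
  rewrite (_ : 2 * N%:R * eta = \sum_(i < N) (2 * eta)); last first.
    by rewrite sumr_const card_ord -mulr_natr; ring.
  rewrite -big_split /=; apply: ler_sum => i _.
  have h1 := pe i (ltnW (ltn_ord i)); have h2 := pe i.+1 (ltn_ord i).
  have := metric_triangle (u (y i)) (p (m i)) (u (y i.+1)).
  have := metric_triangle (p (m i)) (p (m i.+1)) (u (y i.+1)).
  by rewrite (metric_sym (p (m i.+1)) (u _)); lra.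
rewrite -(loop_Rintegral (y 0%N - e) cF lF) -ne (Rintegral_fold _ _ cF (ltW e0)).
have cc : continuous (fun _ : R => s ^+ 2 / n%:R / e ^+ 2) by move=> ?; exact: cvg_cst.
have H := ler_Rintegral_itv cc (@continuous_sum_shift F e n cF) key.
apply: le_trans H.
rewrite Rintegral_cst //= lebesgue_measure_itv /= lte_fin ltrDl e0 -EFinD /=.
rewrite (_ : y 0%N - e + e - (y 0%N - e) = e); last by ring.
by rewrite le_eqVlt; apply/orP; left; apply/eqP; field; rewrite !gt_eqF.
Qed.

End energy_lower_bound.

Section energy_polygon.
Context {R : realType} {X : metricType R}.
Notation mu := (@lebesgue_measure R).
Implicit Types (u : R -> X) (y : nat -> R).

Definition energy_integrand u (e t : R) : R :=
  (mdist (u (t - e)) (u t) ^+ 2 + mdist (u t) (u (t + e)) ^+ 2) / (2 * e ^+ 2).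

Lemma continuous_energy_integrand u e : continuous u ->
  continuous (energy_integrand u e).
Proof.
move=> cu.
have h1 : continuous (fun t => mdist (u (t - e)) (u t) ^+ 2).
  by apply: continuous_sqr; apply: continuous_mdist_comp => //;
    exact: continuous_shift_metric.
have h2 : continuous (fun t => mdist (u t) (u (t + e)) ^+ 2).
  by apply: continuous_sqr; apply: continuous_mdist_comp => //;
    exact: continuous_shift_metric.
by move=> t; apply: cvgM; [apply: cvgD; [exact: h1|exact: h2]|exact: cvg_cst].
Qed.

Lemma energy_integrand_ge0 u e t : 0 <= energy_integrand u e t.
Proof.
by apply: divr_ge0; [exact: addr_ge0 (sqr_ge0 _) (sqr_ge0 _)|
  rewrite mulr_ge0 ?sqr_ge0].
Qed.

(** The backward quotient is the forward one translated by [e], so both have the same integral over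
    a period. *)
Lemma Rintegral_energy_integrand u e : continuous u -> loop u ->
  \int[mu]_(t in `[0, 2 * pi]) energy_integrand u e t =
  \int[mu]_(t in `[0, 2 * pi]) (mdist (u t) (u (t + e)) ^+ 2 / e ^+ 2).
Proof.
move=> cu lu; pose D t : R := mdist (u t) (u (t + e)) ^+ 2 / e ^+ 2.
have cD0 : continuous (fun t => mdist (u t) (u (t + e)) ^+ 2).
  by apply: continuous_sqr; apply: continuous_mdist_comp => //;
    exact: continuous_shift_metric.
have cD : continuous D by move=> t; apply: cvgM; [exact: cD0|exact: cvg_cst].
have lD : loop D by move=> t; rewrite /D lu addrAC lu.
transitivity (\int[mu]_(t in `[0, 2 * pi]) (2^-1 * D (t - e) + 2^-1 * D t)).
  by apply: eq_Rintegral => t _; rewrite /energy_integrand /D subrK invfM; ring.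
have cDe : continuous (fun t => D (t - e)) by exact: continuous_shift.
have iD (f : R -> R) : continuous f -> mu.-integrable `[0, 2 * pi] (EFin \o f).
  exact: continuous_itv_integrable.
rewrite RintegralD //; first last.
- by apply: iD => t; apply: cvgM; [exact: cvg_cst|exact: cD].
- by apply: iD => t; apply: cvgM; [exact: cvg_cst|exact: cDe].
rewrite !RintegralZl //; [|exact: iD..].
by rewrite (loop_Rintegral_shift (- e) cD lD); rewrite -mulrDl; lra.
Qed.

Lemma energy_ge0 u : continuous u -> (0 <= energy u)%E.
Proof.
move=> cu; apply: le_trans (ereal_sup_ubound _) => /=; last first.
  exists (cst 1); first by split => // [t|t]; [exact: cvg_cst|rewrite ler01 lexx].
  reflexivity.
apply: limf_esup_ge0; first exact: filter_not_empty.
move=> e; apply: integral_ge0 => t _; rewrite lee_fin mul1r.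
exact: energy_integrand_ge0.
Qed.

Lemma near_uniform_finite u y N (eta : R) : continuous u -> 0 < eta ->
  exists2 d : R, 0 < d & forall i t, (i <= N)%N -> `|y i - t| <= d ->
    mdist (u (y i)) (u t) <= eta.
Proof.
move=> cu eta0; elim: N => [|N [d d0 dP]].
  have /metricType_numDomainType.cvgrPdist_le/(_ _ eta0) := cu (y 0%N).
  move=> /nbhs_normP[d /= d0 dP]; exists (d / 2); first by rewrite divr_gt0.
  move=> i t; rewrite leqn0 => /eqP -> yt; apply: dP => /=.
  by apply: le_lt_trans yt _; lra.
have /metricType_numDomainType.cvgrPdist_le/(_ _ eta0) := cu (y N.+1).
move=> /nbhs_normP[d' /= d0' dP']; exists (Num.min d (d' / 2)).
  by rewrite lt_min d0 divr_gt0.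
move=> i t; rewrite leq_eqVlt => /predU1P[->|iN]; rewrite le_min => /andP[h1 h2].
  by apply: dP' => /=; apply: le_lt_trans h2 _; lra.
exact: dP.
Qed.

(** Steps of the form [2 * pi / n] accumulate at 0, so every neighbourhood over which the upper
    limit takes a supremum contains one to which the polygon estimate applies. The test function is
    the constant 1. *)
Lemma energy_ge_polygon u N y : continuous u -> loop u -> circle_partition N y ->
  (((\sum_(i < N) mdist (u (y i)) (u (y i.+1))) ^+ 2 / (2 * pi))%:E <= energy u)%E.
Proof.
move=> cu lu yP; have N0 : 0 < N%:R :> R by rewrite ltr0n; case: yP.
have p0 : 0 < 2 * pi :> R by rewrite mulr_gt0 // pi_gt0.
set l := \sum_(i < N) _; have l0 : 0 <= l by apply: sumr_ge0 => i _; exact: mdist_ge0.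
have [->|lpos] := eqVneq l 0.
  by rewrite expr0n mul0r; exact: energy_ge0.
have {lpos} lgt0 : 0 < l by rewrite lt_neqAle eq_sym lpos.
apply: le_trans (ereal_sup_ubound _) => /=; last first.
  exists (cst 1); first by split => // [t|t]; [exact: cvg_cst|rewrite ler01 lexx].
  reflexivity.
apply: le_ereal_inf_tmp => _ [V V0 <-]; set Sg := ereal_sup _.
have low x : 0 < x -> x <= l -> (((l - x) ^+ 2 / (2 * pi))%:E <= Sg)%E.
  move=> x0 xl.
  have eta0 : 0 < x / (2 * N%:R) by rewrite divr_gt0 // mulr_gt0.
  have [d d0 dP] := @near_uniform_finite u y N _ cu eta0.
  have [d' d'0 dV] : exists2 d', 0 < d' & forall e, 0 < e -> e < d' -> V e.
    case: V0 => d' /= d'0 dV; exists d' => // e e0 ed; apply: dV => //=.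
    by rewrite sub0r normrN gtr0_norm.
  have dd0 : 0 < Num.min (d / 2) d' by rewrite lt_min d'0 divr_gt0.
  set n := (Num.bound (2 * pi / Num.min (d / 2) d')).+1.
  have n0' : 0 < n%:R :> R by rewrite ltr0n.
  pose e : R := 2 * pi / n%:R; have e0 : 0 < e by rewrite divr_gt0.
  have : e < Num.min (d / 2) d'.
    rewrite /e ltr_pdivrMr // (mulrC (Num.min _ _)) -ltr_pdivrMr //.
    have q0 : 0 <= 2 * pi / Num.min (d / 2) d' by apply: divr_ge0; apply: ltW.
    by apply: lt_trans (archi_boundP q0) _; rewrite ltr_nat.
  rewrite lt_min => /andP[ed ed'].
  apply: le_trans (ereal_sup_ubound _); last by exists e; [exact: dV|].
  under eq_integral do rewrite mul1r.
  rewrite (continuous_integralE _ _ (@continuous_energy_integrand u e cu)) lee_fin.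
  rewrite Rintegral_energy_integrand //.
  have xE : 2 * N%:R * (x / (2 * N%:R)) = x.
    by rewrite mulrC divfK // mulf_neq0 // gt_eqF.
  have := @loop_polygon_le_energy_integral R X u N y n (x / (2 * N%:R)) cu lu yP.
  rewrite xE; apply => // i t iN it; apply: dP => //.
  by apply: le_trans it _; rewrite -/e; lra.
have [r Sr] : exists r, Sg = r%:E \/ Sg = +oo%E.
  have := low l lgt0 (lexx l); case: (Sg) => [r _|_|//]; first by exists r; left.
  by exists 0; right.
case: Sr => [Sr|->]; last by rewrite leey.
rewrite Sr lee_fin ler_pdivrMr //; apply/ler_addgt0Pr => d d0.
(* With this choice the loss in [(l - x) ^+ 2 >= l ^+ 2 - 2 * l * x] is at most [d]. *)
set x := Num.min l (d / (2 * l)).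
have x0 : 0 < x by rewrite lt_min lgt0 divr_gt0 // mulr_gt0.
have xl : x <= l by rewrite ge_min lexx.
have xd : x * (2 * l) <= d.
  by rewrite -ler_pdivlMr ?mulr_gt0 // ge_min lexx orbT.
have := low x x0 xl; rewrite Sr lee_fin ler_pdivrMr //.
by have := sqr_ge0 x; rewrite sqrrB; lra.
Qed.

End energy_polygon.

(** * Comparison geometry *)

Section comparison.
Context {R : realType} {X : metricType R}.
Implicit Types (K : R) (U : set X) (A B C : X) (c : R -> X).

Lemma sqr_le_sqr (x y : R) : - y <= x -> x <= y -> x ^+ 2 <= y ^+ 2.
Proof. by move=> yx xy; rewrite -subr_ge0 subr_sqr mulr_ge0; lra. Qed.

Lemma sqr_le1_itv (x : R) : x ^+ 2 <= 1 -> -1 <= x <= 1.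
Proof. by move=> x1; apply/andP; split; nra. Qed.

Lemma ler_cos (x y : R) : 0 <= x -> x <= y -> y <= pi -> cos y <= cos x.
Proof.
move=> x0; rewrite le_eqVlt => /predU1P[->//|xy] ypi.
by rewrite ltW // ltr_cos ?in_itv /=; lra.
Qed.

Lemma cos_double_half (x : R) : cos x = 2 * cos (x / 2) ^+ 2 - 1.
Proof. by rewrite {1}(_ : x = (x / 2) *+ 2) ?cos_mulr2n ?mulr2n; [ring|field]. Qed.

Lemma sin_double_half (x : R) : sin x = 2 * sin (x / 2) * cos (x / 2).
Proof. by rewrite {1}(_ : x = (x / 2) *+ 2) ?sin_mulr2n ?mulr2n; [ring|field]. Qed.

(** Coordinates on the unit sphere: [(1, 0, 0)] and [(cos b, sin b, 0)] are the ends of the side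
    [b], and [(q1, q2, q3)] is the opposite vertex. The last equation holds because the two ends add
    up to [2 * cos (b / 2)] times the midpoint of the side. *)
Lemma spherical_triangle (a b c : R) : 0 <= a -> 0 < b -> 0 <= c ->
  a <= b + c -> b <= a + c -> c <= a + b -> a + b + c < 2 * pi ->
  exists q1 q2 q3, [/\ q1 ^+ 2 + q2 ^+ 2 + q3 ^+ 2 = 1, 0 <= q3, q1 = cos c,
    q1 * cos b + q2 * sin b = cos a &
    2 * cos (b / 2) * (q1 * cos (b / 2) + q2 * sin (b / 2)) = cos c + cos a].
Proof.
move=> a0 b0 c0 abc bac cab per.
have sb : 0 < sin b by apply: sin_gt0_pi; lra.
have le1 : cos a - cos b * cos c <= sin b * sin c.
  suff : cos a <= cos (b - c) by rewrite cosB; lra.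
  by rewrite -(cos_norm (b - c)); apply: ler_cos => //;
    [rewrite ler_norml|]; lra.
have le2 : - (sin b * sin c) <= cos a - cos b * cos c.
  suff : cos (b + c) <= cos a by rewrite cosD; lra.
  (* Beyond [pi] the cosine stops decreasing, and the perimeter bound takes over from the triangle
     inequality. *)
  have [bc|bc] := leP (b + c) pi; first by apply: ler_cos; lra.
  have -> : cos (b + c) = cos (pi *+ 2 - (b + c)).
    by rewrite cosB cos2pi sin2pi; ring.
  by apply: ler_cos; rewrite ?mulr2n; lra.
set q2 := (cos a - cos b * cos c) / sin b.
have q2E : q2 * sin b = cos a - cos b * cos c by rewrite /q2 divfK ?gt_eqF.
have q12 : cos c ^+ 2 + q2 ^+ 2 <= 1.
  have : q2 ^+ 2 <= sin c ^+ 2.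
    rewrite -(ler_pM2r (exprn_gt0 2 sb)) -!exprMn q2E (mulrC (sin c)).
    by apply: sqr_le_sqr.
  by have := cos2Dsin2 c; lra.
exists (cos c), q2, (Num.sqrt (1 - cos c ^+ 2 - q2 ^+ 2)); split => //.
- by rewrite sqr_sqrtr; lra.
- by rewrite q2E; lra.
- have : q2 * (2 * sin (b / 2) * cos (b / 2)) = cos a - cos b * cos c.
    by rewrite -sin_double_half.
  by rewrite (cos_double_half b); lra.
Qed.

(** The comparison at the midpoint of a side, with cosines applied. On the model sphere it is an
    equality, the inner product of the opposite vertex with the sum of the two ends. *)
Lemma midpoint_comparison_pos K U A B C c t :
  0 < K -> RK_domain K U -> U A -> U B -> U C ->
  shortest_arc U A C c 0 1 -> t \in `[0, 1] ->
  mdist A (c t) = mdist A C / 2 ->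
  cos (Num.sqrt K * mdist A B) + cos (Num.sqrt K * mdist B C) <=
  2 * cos (Num.sqrt K * mdist A C / 2) * cos (Num.sqrt K * mdist B (c t)).
Proof.
move=> K0 [_ /(_ K0) per cmp] UA UB UC arc tI At.
set k := Num.sqrt K; have k0 : 0 < k by rewrite sqrtr_gt0.
have kn0 : k != 0 by rewrite gt_eqF.
have kK : K = k ^+ 2 by rewrite sqr_sqrtr // ltW.
have [AC0|AC0] := eqVneq A C.
  have -> : c t = A.
    by apply/esym/mdist_positivity; rewrite At AC0 mdistxx mul0r.
  by rewrite -AC0 mdistxx mulr0 mul0r cos0 (metric_sym B); lra.
have b0 : 0 < k * mdist A C by rewrite mulr_gt0 // mdist_gt0.
have {}per : k * mdist B C + k * mdist A C + k * mdist A B < 2 * pi.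
  have := per _ _ _ UA UB UC; rewrite ltr_pdivlMr // -/k (metric_sym C A).
  lra.
set a := mdist B C in per *; set b := mdist A C in b0 per At *.
set d := mdist A B in per *.
have a_ge0 : 0 <= k * a by rewrite mulr_ge0 ?mdist_ge0 // ltW.
have d_ge0 : 0 <= k * d by rewrite mulr_ge0 ?mdist_ge0 // ltW.
have tri1 : k * a <= k * b + k * d.
  by rewrite -mulrDr ler_pM2l // /a /b /d addrC (metric_sym A B) metric_triangle.
have tri2 : k * b <= k * a + k * d.
  by rewrite -mulrDr ler_pM2l // /a /b /d addrC metric_triangle.
have tri3 : k * d <= k * a + k * b.
  by rewrite -mulrDr ler_pM2l // /a /b /d addrC (metric_sym B C) metric_triangle.
have [q1 [q2 [q3 [q123 q30 q1c q12a q12m]]]] :=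
  spherical_triangle a_ge0 b0 d_ge0 tri1 tri2 tri3 per.
(* The side is laid on the equator of the sphere of radius [1 / k], which belongs to the closed
   hemisphere. *)
pose side (x : R) : R * R * R := (cos (k * x) / k, sin (k * x) / k, 0).
pose q : R * R * R := (q1 / k, q2 / k, q3 / k).
have kdist_side : forall s s', k * `|s - s'| <= pi ->
    kdist K (side s) (side s') = `|s - s'|.
  move=> s s' ss; rewrite /kdist /= K0 -/k.
  have -> : K * (cos (k * s) / k * (cos (k * s') / k) +
      sin (k * s) / k * (sin (k * s') / k) + 0 * 0) = cos (k * `|s - s'|).
    have -> : k * `|s - s'| = `|k * s - k * s'| by rewrite -mulrBr normrM gtr0_norm.
    rewrite cos_norm cosB kK.
    by field.
  rewrite cosK; first by rewrite mulrC mulKf.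
  by rewrite in_itv /= ss mulr_ge0 // ltW.
have kdist_q : forall s,
    kdist K q (side s) = acos (q1 * cos (k * s) + q2 * sin (k * s)) / k.
  move=> s; rewrite /kdist /= K0 -/k; congr (acos _ / _).
  by rewrite kK; field.
have plane_side : forall s, kplane K (side s).
  move=> s; rewrite /kplane /side K0; split => //.
  by rewrite kK !exprMn -[RHS]mul1r -(cos2Dsin2 (k * s)); field.
have bE : kdist K (side 0) (side b) = b.
  by rewrite kdist_side sub0r normrN ger0_norm ?mdist_ge0 //; lra.
have := cmp A B C UA UB UC c arc (side 0) q (side b) _ side _ t tI.
have -> : kdist K q (side (mdist A (c t))) =
   acos (q1 * cos (k * b / 2) + q2 * sin (k * b / 2)) / k.
  by rewrite kdist_q At mulrA.
set Z := (X in acos X) => H.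
have cb : 0 < cos (k * b / 2) by apply: cos_gt0_pihalf; lra.
(* Cauchy-Schwarz in the plane of the equator, so that [acos] can be inverted at [Z]. *)
have Z1 : -1 <= Z <= 1.
  have : Z ^+ 2 <= 1.
    have := cos2Dsin2 (k * b / 2); rewrite /Z.
    set x := cos _; set y := sin _ => xy.
    have : 0 <= (q1 * y - q2 * x) ^+ 2 by exact: sqr_ge0.
    have : 0 <= q3 ^+ 2 by exact: sqr_ge0.
    have : (q1 ^+ 2 + q2 ^+ 2) * (x ^+ 2 + y ^+ 2) = q1 ^+ 2 + q2 ^+ 2.
      by rewrite xy mulr1.
    lra.
  exact: sqr_le1_itv.
have {}H : k * mdist B (c t) <= acos Z.
  rewrite -ler_pdivlMl // mulrC; apply: H.
  - split; first split => //.
      by rewrite /kplane K0; split; [rewrite kK !exprMn -[RHS]mul1r -q123; field|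
        rewrite divr_ge0 // ltW].
    rewrite bE; split => //.
      rewrite /kdist /= K0 -/k mulr0 cos0 sin0.
      have -> : K * (1 / k * (q1 / k) + 0 / k * (q2 / k) + 0 * (q3 / k)) = cos (k * d).
        by rewrite -q1c kK; field.
      rewrite cosK ?in_itv /=; last lra.
      by rewrite mulrC mulKf.
    rewrite kdist_q q12a cosK ?in_itv /=; last lra.
    by rewrite mulrC mulKf.
  rewrite /kside bE; split => // s s'; rewrite !in_itv /= => /andP[? ?] /andP[? ?].
  apply: kdist_side; apply: (@le_trans _ _ (k * b)); last lra.
  by rewrite ler_pM2l // ler_norml; lra.
have /ler_cos : 0 <= k * mdist B (c t) by rewrite mulr_ge0 ?mdist_ge0 // ltW.
move=> /(_ _ H (acos_lepi Z1)); rewrite acosK ?in_itv //= => H'.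
rewrite -q12m -/Z; rewrite ler_pM2l; lra.
Qed.

(** The CN inequality of Bruhat and Tits; in the plane it is the parallelogram law. The abscissa
    [q1] of the vertex comes from the law of cosines. *)
Lemma midpoint_comparison0 U A B C c t :
  RK_domain 0 U -> U A -> U B -> U C ->
  shortest_arc U A C c 0 1 -> t \in `[0, 1] ->
  mdist A (c t) = mdist A C / 2 ->
  mdist B (c t) ^+ 2 <=
  (mdist A B ^+ 2 + mdist B C ^+ 2) / 2 - mdist A C ^+ 2 / 4.
Proof.
move=> [_ _ cmp] UA UB UC arc tI At.
have [AC0|AC0] := eqVneq A C.
  have -> : c t = A.
    by apply/esym/mdist_positivity; rewrite At AC0 mdistxx mul0r.
  by rewrite -AC0 mdistxx (metric_sym B); lra.
have b0 : 0 < mdist A C by rewrite mdist_gt0.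
have tri1 : mdist B C <= mdist A C + mdist A B.
  by rewrite addrC (metric_sym A B) metric_triangle.
have tri2 : mdist A C <= mdist B C + mdist A B.
  by rewrite addrC metric_triangle.
have tri3 : mdist A B <= mdist B C + mdist A C.
  by rewrite addrC (metric_sym B C) metric_triangle.
set a := mdist B C in tri1 tri2 tri3 *; set b := mdist A C in b0 At tri1 tri2 tri3 *.
set d := mdist A B in tri1 tri2 tri3 *.
have a0 : 0 <= a := mdist_ge0 _ _.
have d0 : 0 <= d := mdist_ge0 _ _.
pose q1 := (d ^+ 2 + b ^+ 2 - a ^+ 2) / (2 * b).
have q1E : 2 * b * q1 = d ^+ 2 + b ^+ 2 - a ^+ 2.
  by rewrite /q1 mulrC divfK // mulf_neq0 // gt_eqF.
have q12 : q1 ^+ 2 <= d ^+ 2.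
  by apply: sqr_le_sqr; rewrite -(ler_pM2l (_ : 0 < 2 * b)) ?mulr_gt0 // ?q1E; nra.
pose q2 := Num.sqrt (d ^+ 2 - q1 ^+ 2).
have q2E : q2 ^+ 2 = d ^+ 2 - q1 ^+ 2 by rewrite sqr_sqrtr // subr_ge0.
pose side (x : R) : R * R * R := (x, 0, 0).
pose q : R * R * R := (q1, q2, 0).
have kdist_side : forall s s', kdist 0 (side s) (side s') = `|s - s'|.
  by move=> s s'; rewrite /kdist /= ltxx subrr expr0n addr0 sqrtr_sqr.
have kdist_q : forall s, kdist 0 q (side s) = Num.sqrt ((q1 - s) ^+ 2 + q2 ^+ 2).
  by move=> s; rewrite /kdist /= ltxx subr0.
have bE : kdist 0 (side 0) (side b) = b.
  by rewrite kdist_side sub0r normrN ger0_norm // ltW.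
have plane_side : forall s, kplane 0 (side s).
  by move=> s; rewrite /kplane /side ltxx.
have := cmp A B C UA UB UC c arc (side 0) q (side b) _ side _ t tI.
rewrite kdist_q At => H.
have {H} : mdist B (c t) <= Num.sqrt ((q1 - b / 2) ^+ 2 + q2 ^+ 2).
  apply: H.
  - split; first by split => //; rewrite /kplane ltxx.
    rewrite bE; split => //.
      rewrite /kdist /= ltxx !sub0r !sqrrN q2E addrCA subrr addr0 sqrtr_sqr.
      by rewrite ger0_norm.
    rewrite kdist_q q2E (_ : _ + _ = a ^+ 2) ?sqrtr_sqr ?ger0_norm //.
    by move: q1E; rewrite sqrrB; lra.
  by rewrite /kside bE; split.
rewrite -(@ler_pXn2r _ 2) ?nnegrE ?mdist_ge0 ?sqrtr_ge0 // sqr_sqrtr; last first.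
  by rewrite addr_ge0 ?sqr_ge0.
by move=> /le_trans; apply; rewrite q2E; move: q1E; rewrite sqrrB; lra.
Qed.

Definition cosh (x : R) : R := (expR x + expR (- x)) / 2.
Definition sinh (x : R) : R := (expR x - expR (- x)) / 2.

Lemma coshD x y : cosh (x + y) = cosh x * cosh y + sinh x * sinh y.
Proof. by rewrite /cosh /sinh opprD !expRD; field. Qed.

Lemma sinhD x y : sinh (x + y) = sinh x * cosh y + cosh x * sinh y.
Proof. by rewrite /cosh /sinh opprD !expRD; field. Qed.

Lemma coshN x : cosh (- x) = cosh x.
Proof. by rewrite /cosh opprK addrC. Qed.

Lemma sinhN x : sinh (- x) = - sinh x.
Proof. by rewrite /sinh opprK; ring. Qed.

Lemma coshB x y : cosh (x - y) = cosh x * cosh y - sinh x * sinh y.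
Proof. by rewrite coshD coshN sinhN mulrN. Qed.

Lemma cosh_norm x : cosh `|x| = cosh x.
Proof. by case: (ler0P x); rewrite ?coshN. Qed.

Lemma cosh2Bsinh2 x : cosh x ^+ 2 - sinh x ^+ 2 = 1.
Proof.
have := expRxMexpNx_1 x; rewrite /cosh /sinh => E.
by rewrite -[RHS]E; field.
Qed.

Lemma ler_cosh x y : 0 <= x -> x <= y -> cosh x <= cosh y.
Proof.
move=> x0 xy; rewrite /cosh ler_pM2r //.
have xy' : expR x <= expR y by rewrite ler_expR.
have x1 : 1 <= expR x by rewrite -expR0 ler_expR.
have := expRxMexpNx_1 x; have := expRxMexpNx_1 y.
have := expR_gt0 (- x); have := expR_gt0 (- y).
have := expR_gt0 x; have := expR_gt0 y.
move: (expR x) (expR y) (expR (- x)) (expR (- y)) xy' x1 => ex ey ex' ey' xy' x1 *.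
(* This product is [2 * (cosh y - cosh x)]. *)
have : 0 <= (ey - ex) * (1 - ex' * ey').
  by rewrite mulr_ge0 //; nra.
nra.
Qed.

Lemma cosh_gt0 x : 0 < cosh x.
Proof. by rewrite divr_gt0 // addr_gt0 ?expR_gt0. Qed.

Lemma cosh_ge1 x : 1 <= cosh x.
Proof.
rewrite -cosh_norm; have <- : cosh 0 = 1 by rewrite /cosh oppr0 expR0; lra.
exact: ler_cosh.
Qed.

Lemma sinh_gt0 x : 0 < x -> 0 < sinh x.
Proof. by move=> x0; rewrite divr_gt0 // subr_gt0 ltr_expR; lra. Qed.

Lemma sinh_ge0 x : 0 <= x -> 0 <= sinh x.
Proof. by move=> x0; rewrite divr_ge0 // subr_ge0 ler_expR; lra. Qed.

Lemma coshK x : 0 <= x -> arcosh (cosh x) = x.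
Proof.
move=> x0; rewrite /arcosh (_ : cosh x ^+ 2 - 1 = sinh x ^+ 2); last first.
  by rewrite -(cosh2Bsinh2 x); lra.
rewrite sqrtr_sqr ger0_norm ?sinh_ge0 // (_ : _ + _ = expR x) ?expRK //.
by rewrite /cosh /sinh; lra.
Qed.

Lemma arcoshK x : 1 <= x -> cosh (arcosh x) = x.
Proof.
move=> x1; rewrite /arcosh /cosh; set s := Num.sqrt _.
have s2 : s ^+ 2 = x ^+ 2 - 1 by rewrite sqr_sqrtr // subr_ge0; nra.
have s0 : 0 <= s := sqrtr_ge0 _.
have xs : 0 < x + s by lra.
rewrite expRN lnK ?posrE // (_ : (x + s)^-1 = x - s); first by lra.
apply: (mulfI (lt0r_neq0 xs)); rewrite divff ?lt0r_neq0 //.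
by move: s2; nra.
Qed.

Lemma cosh_double_half x : cosh x = 2 * cosh (x / 2) ^+ 2 - 1.
Proof.
have := cosh2Bsinh2 (x / 2); have := coshD (x / 2) (x / 2).
by rewrite -splitr => ->; lra.
Qed.

Lemma sinh_double_half x : sinh x = 2 * sinh (x / 2) * cosh (x / 2).
Proof. by rewrite {1}(splitr x) sinhD; ring. Qed.

Lemma cosh_sum x y : cosh x + cosh y = 2 * cosh ((x + y) / 2) * cosh ((x - y) / 2).
Proof.
set u := (x + y) / 2; set w := (x - y) / 2.
have -> : cosh x = cosh (u + w) by congr cosh; rewrite /u /w; field.
have -> : cosh y = cosh (u - w) by congr cosh; rewrite /u /w; field.
by rewrite coshD coshB; ring.
Qed.

(** Coordinates on the hyperboloid [z ^+ 2 - x ^+ 2 - y ^+ 2 = 1], with [(0, 0, 1)] and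
    [(sinh b, 0, cosh b)] as ends of the side [b]; they add up to [2 * cosh (b / 2)] times its
    midpoint. *)
Lemma hyperbolic_triangle (a b c : R) : 0 <= a -> 0 < b -> 0 <= c ->
  a <= b + c -> b <= a + c -> c <= a + b ->
  exists q1 q2 q3, [/\ q3 ^+ 2 - q1 ^+ 2 - q2 ^+ 2 = 1, q3 = cosh c,
    q3 * cosh b - q1 * sinh b = cosh a &
    2 * cosh (b / 2) * (q3 * cosh (b / 2) - q1 * sinh (b / 2)) = cosh c + cosh a].
Proof.
move=> a0 b0 c0 abc bac cab.
have sb : 0 < sinh b by exact: sinh_gt0.
have le1 : cosh b * cosh c - cosh a <= sinh b * sinh c.
  suff : cosh (b - c) <= cosh a by rewrite coshB; lra.
  by rewrite -(cosh_norm (b - c)); apply: ler_cosh => //; rewrite ler_norml; lra.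
have le2 : - (sinh b * sinh c) <= cosh b * cosh c - cosh a.
  suff : cosh a <= cosh (b + c) by rewrite coshD; lra.
  by apply: ler_cosh; lra.
set q1 := (cosh b * cosh c - cosh a) / sinh b.
have q1E : q1 * sinh b = cosh b * cosh c - cosh a by rewrite /q1 divfK ?gt_eqF.
have q12 : q1 ^+ 2 <= sinh c ^+ 2.
  rewrite -(ler_pM2r (exprn_gt0 2 sb)) -!exprMn q1E (mulrC (sinh c)).
  by apply: sqr_le_sqr.
exists q1, (Num.sqrt (sinh c ^+ 2 - q1 ^+ 2)), (cosh c); split => //.
- by rewrite sqr_sqrtr; have := cosh2Bsinh2 c; lra.
- by rewrite q1E; lra.
- have : q1 * (2 * sinh (b / 2) * cosh (b / 2)) = cosh b * cosh c - cosh a.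
    by rewrite -sinh_double_half.
  by rewrite (cosh_double_half b); lra.
Qed.

Lemma midpoint_comparison_neg K U A B C c t :
  K < 0 -> RK_domain K U -> U A -> U B -> U C ->
  shortest_arc U A C c 0 1 -> t \in `[0, 1] ->
  mdist A (c t) = mdist A C / 2 ->
  2 * cosh (Num.sqrt (- K) * mdist A C / 2) * cosh (Num.sqrt (- K) * mdist B (c t))
  <= cosh (Num.sqrt (- K) * mdist A B) + cosh (Num.sqrt (- K) * mdist B C).
Proof.
move=> K0 [_ _ cmp] UA UB UC arc tI At.
have K0F : (0 < K) = false by apply/negbTE; rewrite -leNgt ltW.
set k := Num.sqrt (- K); have k0 : 0 < k by rewrite sqrtr_gt0 oppr_gt0.
have kn0 : k != 0 by rewrite gt_eqF.
have kK : - K = k ^+ 2 by rewrite sqr_sqrtr // oppr_ge0 ltW.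
have cosh0 : cosh (0 : R) = 1 by rewrite /cosh oppr0 expR0; lra.
have sinh0 : sinh (0 : R) = 0 by rewrite /sinh oppr0 subrr mul0r.
have [AC0|AC0] := eqVneq A C.
  have -> : c t = A.
    by apply/esym/mdist_positivity; rewrite At AC0 mdistxx mul0r.
  by rewrite -AC0 mdistxx mulr0 mul0r cosh0 (metric_sym B); lra.
have b0 : 0 < k * mdist A C by rewrite mulr_gt0 // mdist_gt0.
set a := mdist B C; set b := mdist A C in b0 At *; set d := mdist A B.
have a_ge0 : 0 <= k * a by rewrite mulr_ge0 ?mdist_ge0 // ltW.
have d_ge0 : 0 <= k * d by rewrite mulr_ge0 ?mdist_ge0 // ltW.
have tri1 : k * a <= k * b + k * d.
  by rewrite -mulrDr ler_pM2l // /a /b /d addrC (metric_sym A B) metric_triangle.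
have tri2 : k * b <= k * a + k * d.
  by rewrite -mulrDr ler_pM2l // /a /b /d addrC metric_triangle.
have tri3 : k * d <= k * a + k * b.
  by rewrite -mulrDr ler_pM2l // /a /b /d addrC (metric_sym B C) metric_triangle.
have [q1 [q2 [q3 [q123 q3c q12a q12m]]]] :=
  hyperbolic_triangle a_ge0 b0 d_ge0 tri1 tri2 tri3.
pose side (x : R) : R * R * R := (sinh (k * x) / k, 0, cosh (k * x) / k).
pose q : R * R * R := (q1 / k, q2 / k, q3 / k).
have kdist_side : forall s s', kdist K (side s) (side s') = `|s - s'|.
  move=> s s'; rewrite /kdist /= K0F K0 -/k.
  have -> : - K * (cosh (k * s) / k * (cosh (k * s') / k) -
      sinh (k * s) / k * (sinh (k * s') / k) - 0 * 0) = cosh (k * `|s - s'|).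
    have -> : k * `|s - s'| = `|k * s - k * s'| by rewrite -mulrBr normrM gtr0_norm.
    rewrite cosh_norm coshB kK.
    by field.
  rewrite coshK; first by rewrite mulrC mulKf.
  by rewrite mulr_ge0 // ltW.
have kdist_q : forall s,
    kdist K q (side s) = arcosh (q3 * cosh (k * s) - q1 * sinh (k * s)) / k.
  move=> s; rewrite /kdist /= K0F K0 -/k; congr (arcosh _ / _).
  by rewrite kK; field.
have plane_side : forall s, kplane K (side s).
  move=> s; rewrite /kplane /side K0F K0; split; last first.
    by rewrite divr_gt0 // cosh_gt0.
  rewrite kK -[RHS]mul1r -[1 in RHS](cosh2Bsinh2 (k * s)).
  by set u := cosh _; set w := sinh _; field.
have bE : kdist K (side 0) (side b) = b.
  by rewrite kdist_side sub0r normrN ger0_norm ?mdist_ge0.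
have := cmp A B C UA UB UC c arc (side 0) q (side b) _ side _ t tI.
have -> : kdist K q (side (mdist A (c t))) =
   arcosh (q3 * cosh (k * b / 2) - q1 * sinh (k * b / 2)) / k.
  by rewrite kdist_q At (mulrA k); exact: erefl.
set Z := (X in arcosh X) => H; rewrite -/Z in q12m.
have cb : 0 < cosh (k * b / 2) by exact: cosh_gt0.
have c2 : 0 < 2 * cosh (k * b / 2) by rewrite mulr_gt0.
(* [arcosh] can be inverted from 1 on. The bound is the triangle inequality [b <= a + d], brought in
   by writing [cosh (k * d) + cosh (k * a)] as a product. *)
have Z1 : 1 <= Z.
  rewrite -(ler_pM2l c2) q12m mulr1 cosh_sum.
  have chb : cosh (k * b / 2) <= cosh ((k * d + k * a) / 2) by apply: ler_cosh; lra.
  rewrite -(mulrA 2) ler_pM2l //; apply: (le_trans chb).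
  by rewrite ler_peMr ?cosh_ge1 // ltW // cosh_gt0.
have {}H : k * mdist B (c t) <= arcosh Z.
  rewrite -ler_pdivlMl // mulrC; apply: H.
  - split; first split => //.
      rewrite /kplane K0F K0; split; last by rewrite q3c divr_gt0 // cosh_gt0.
      by rewrite kK !exprMn -[RHS]mul1r -q123; field.
    rewrite bE; split => //.
      rewrite /kdist /= K0F K0 -/k mulr0 cosh0 sinh0.
      have -> : - K * (1 / k * (q3 / k) - 0 / k * (q1 / k) - 0 * (q2 / k)) = cosh (k * d).
        by rewrite -q3c kK; field.
      by rewrite coshK // mulrC mulKf.
    by rewrite kdist_q q12a coshK // mulrC mulKf.
  by rewrite /kside bE; split.
have /ler_cosh : 0 <= k * mdist B (c t) by rewrite mulr_ge0 ?mdist_ge0 // ltW.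
move=> /(_ _ H); rewrite arcoshK // => H'.
by rewrite -q12m (ler_pM2l c2).
Qed.

End comparison.

(** * Midpoints of shortest arcs and midlines of spherical triangles *)

Section comparison_consequences.
Context {R : realType} {X : metricType R}.
Implicit Types (K : R) (U : set X) (A B C : X) (c g : R -> X).

(** A shortest arc comes with an arbitrary parametrization, so its midpoint is found by the
    intermediate value theorem; the length of the arc then controls the distance to [C]. *)
Lemma shortest_arc_midpoint U A C c : shortest_arc U A C c 0 1 ->
  exists t, [/\ t \in `[0, 1], U (c t), mdist A (c t) = mdist A C / 2 &
    mdist (c t) C = mdist A C / 2].
Proof.
move=> [_ cc cU [c0 c1] len].
have AC0 := mdist_ge0 A C.
have [|||t tI At] := @IVT R (fun t => mdist A (c t)) 0 1 (mdist A C / 2).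
- exact: ler01.
- move/subspace_continuousP : cc => cc; apply/subspace_continuousP => x x01.
  by apply: cvg_mdist; [exact: cvg_cst|exact: cc].
- by rewrite c0 c1 mdistxx min_l // max_r //; lra.
move: (tI); rewrite in_itv /= => /andP[t0 t1].
exists t; split => //; first by apply: cU; exists t.
have := curve_length_ge c t0 t1; rewrite len lee_fin c0 c1 At.
by have := metric_triangle A (c t) C; rewrite At; lra.
Qed.

Lemma linear_shortest_arc U g a b v : a <= b -> linear_on a b g v ->
  g @` `[a, b] `<=` U ->
  shortest_arc U (g a) (g b) (fun t => g (a + t * (b - a))) 0 1.
Proof.
move=> ab lg gU.
have aff t : 0 <= t -> t <= 1 -> a <= a + t * (b - a) <= b.
  by move=> t0 t1; apply/andP; split; nra.
have dE s t : 0 <= s -> s <= t -> t <= 1 ->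
    mdist (g (a + s * (b - a))) (g (a + t * (b - a))) = v * (b - a) * (t - s).
  move=> s0 st t1; rewrite lg ?in_itv /=; [|apply: aff; lra|apply: aff; lra].
  rewrite (_ : _ - _ = (s - t) * (b - a)); last by ring.
  by rewrite normrM distrC !ger0_norm; [ring|lra|lra].
split => //.
- apply: (@lipschitz_within_continuous _ _ _ _ (v * (b - a))) => s t /=.
  rewrite !in_itv /= => /andP[s0 s1] /andP[t0 t1].
  have [st|/ltW ts] := leP s t.
    by rewrite dE // distrC ger0_norm // subr_ge0.
  by rewrite metric_sym dE // ger0_norm // subr_ge0.
- move=> _ [t + <-]; rewrite /= in_itv /= => /andP[t0 t1].
  by apply: gU; exists (a + t * (b - a)) => //=; rewrite in_itv /=; exact: aff.
- by rewrite mul0r addr0 mul1r addrC subrK.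
have gab : mdist (g a) (g b) = v * (b - a).
  have := dE 0 1 (lexx _) ler01 (lexx _).
  by rewrite mul0r addr0 mul1r (addrC a) subrK subr0 mulr1.
apply/eqP; rewrite eq_le; apply/andP; split.
  have := @curve_length_le R X (fun t => g (a + t * (b - a)))
    (fun t => v * (b - a) * t) 0 1.
  by rewrite mulr1 mulr0 subr0 -gab; apply => s t *; rewrite dE // gab; lra.
have := mdist_le_curve_length (fun t => g (a + t * (b - a))) (@ler01 R).
by rewrite mul0r addr0 mul1r (_ : a + (b - a) = b) // addrC subrK.
Qed.

Lemma sin_le_id (x : R) : 0 <= x -> sin x <= x.
Proof.
rewrite le_eqVlt => /predU1P[<-|x0]; first by rewrite sin0.
have [|c _] := @MVT R sin cos 0 x x0 (fun z _ => is_derive_sin z).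
  by apply: continuous_subspaceT; exact: continuous_sin.
rewrite sin0 !subr0 => ->; have := cos_le1 c; nra.
Qed.

Lemma cos_ge_quadratic (x : R) : 0 <= x -> x <= 2 -> 1 - x ^+ 2 / 2 <= cos x.
Proof.
move=> x0 x2; rewrite cos_double_half cos2sin2.
have x20 : 0 <= x / 2 by lra.
have s0 : 0 <= sin (x / 2).
  by move: x20; rewrite le_eqVlt => /predU1P[<-|?]; [rewrite sin0|
    apply/ltW/sin2_gt0; lra].
have := sin_le_id x20; nra.
Qed.

Lemma sin_ge_half (x : R) : 0 <= x -> x <= 1 -> x / 2 <= sin x.
Proof.
rewrite le_eqVlt => /predU1P[<-|x0]; first by rewrite sin0 mul0r.
have [|c + + x1] := @MVT R sin cos 0 x x0 (fun z _ => is_derive_sin z).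
  by apply: continuous_subspaceT; exact: continuous_sin.
rewrite in_itv /= sin0 !subr0 => /andP[c0 c1] ->.
have := @cos_ge_quadratic c (ltW c0); nra.
Qed.

(* With [c], [cp], [cx], [sp], [sx] the cosines and sines of [f / 2], [p / 2] and
   [x / 2], the two hypotheses combine to
   [(c - cp * cx) ^+ 2 - (sp * sx) ^+ 2 <= 2 * cp * cx * (cos m - c)]. *)
Lemma spherical_midline (x p f n m : R) :
  0 <= x <= 1 -> 0 <= p <= 1 -> 0 <= f <= 1 -> 0 <= m <= 1 -> p <= f + x ->
  cos x + cos f <= 2 * cos (p / 2) * cos n ->
  cos (p / 2) + cos n <= 2 * cos (x / 2) * cos m ->
  m <= f / 2 + 2 * x ^+ 2.
Proof.
move=> /andP[x0 x1] /andP[p0 p1] /andP[f0 f1] /andP[m0 m1] pfx H1 H2.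
have [mf|fm] := leP m (f / 2); first by have := sqr_ge0 x; lra.
have cp : 7 / 8 <= cos (p / 2).
  by apply: le_trans (@cos_ge_quadratic (p / 2) _ _); nra.
have cx : 7 / 8 <= cos (x / 2).
  by apply: le_trans (@cos_ge_quadratic (x / 2) _ _); nra.
have sp0 : 0 <= sin (p / 2) by have := @sin_ge_half (p / 2); lra.
have sx0 : 0 <= sin (x / 2) by have := @sin_ge_half (x / 2); lra.
have sp1 : sin (p / 2) <= p / 2 by apply: sin_le_id; lra.
have sx1 : sin (x / 2) <= x / 2 by apply: sin_le_id; lra.
have key : - (sin (p / 2) * sin (x / 2)) ^+ 2 <=
    2 * cos (p / 2) * cos (x / 2) * (cos m - cos (f / 2)).
  have : 2 * cos (p / 2) * (cos (p / 2) + cos n) <=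
         2 * cos (p / 2) * (2 * cos (x / 2) * cos m).
    by rewrite ler_pM2l //; lra.
  move: H1; rewrite (cos_double_half x) (cos_double_half f) => H1 H3.
  have := sqr_ge0 (cos (f / 2) - cos (p / 2) * cos (x / 2)).
  rewrite exprMn !sin2cos2; lra.
have sps : (sin (p / 2) * sin (x / 2)) ^+ 2 <= (p * x / 4) ^+ 2.
  have h : sin (p / 2) * sin (x / 2) <= p / 2 * (x / 2) by exact: ler_pM.
  by apply: sqr_le_sqr; have := mulr_ge0 sp0 sx0; lra.
(* The difference of cosines is a product of two sines, each at least half its argument. *)
have low : (m ^+ 2 - f ^+ 2 / 4) / 8 <= cos (f / 2) - cos m.
  have -> : cos (f / 2) - cos m = 2 * (sin ((m + f / 2) / 2) * sin ((m - f / 2) / 2)).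
    have -> : cos (f / 2) = cos ((m + f / 2) / 2 - (m - f / 2) / 2) by congr cos; field.
    have -> : cos m = cos ((m + f / 2) / 2 + (m - f / 2) / 2) by congr cos; field.
    by rewrite cosB cosD; ring.
  have h1 : (m + f / 2) / 4 <= sin ((m + f / 2) / 2).
    by have := @sin_ge_half ((m + f / 2) / 2); lra.
  have h2 : (m - f / 2) / 4 <= sin ((m - f / 2) / 2).
    by have := @sin_ge_half ((m - f / 2) / 2); lra.
  have h : (m + f / 2) / 4 * ((m - f / 2) / 4) <=
     sin ((m + f / 2) / 2) * sin ((m - f / 2) / 2) by apply: ler_pM; lra.
  lra.
have dpos : 0 <= cos (f / 2) - cos m.
  by have h : 0 <= m ^+ 2 - f ^+ 2 / 4 by [nra]; lra.
have up : cos (f / 2) - cos m <= (p * x / 4) ^+ 2.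
  have q1 : 1 <= 2 * cos (p / 2) * cos (x / 2).
    have h : 7 / 8 * (7 / 8) <= cos (p / 2) * cos (x / 2) by apply: ler_pM => //; lra.
    lra.
  by have := ler_peMl dpos q1; lra.
have px : (p * x) ^+ 2 <= ((f + x) * x) ^+ 2.
  by apply: sqr_le_sqr; nra.
(* [low], [up] and [px] give [m ^+ 2 <= f ^+ 2 / 4 + (f ^+ 2 + x ^+ 2) * x ^+ 2]; as [f <= 1], the
   term [f ^+ 2 * x ^+ 2] is absorbed by the cross term of the square. *)
have fx : m ^+ 2 <= (f / 2 + 2 * x ^+ 2) ^+ 2.
  have h1 : m ^+ 2 <= f ^+ 2 / 4 + (f ^+ 2 + x ^+ 2) * x ^+ 2.
    have : ((f + x) * x) ^+ 2 <= 2 * (f ^+ 2 + x ^+ 2) * x ^+ 2.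
      by rewrite exprMn ler_wpM2r ?sqr_ge0 //; have := sqr_ge0 (f - x); lra.
    lra.
  have h2 : f ^+ 2 * x ^+ 2 <= f * x ^+ 2.
    by rewrite ler_wpM2r ?sqr_ge0 //; nra.
  have h3 : 0 <= f * x ^+ 2 by rewrite mulr_ge0 ?sqr_ge0.
  have h4 : 0 <= x ^+ 2 * x ^+ 2 by rewrite mulr_ge0 ?sqr_ge0.
  have -> : (f / 2 + 2 * x ^+ 2) ^+ 2 =
      f ^+ 2 / 4 + 2 * (f * x ^+ 2) + 4 * (x ^+ 2 * x ^+ 2).
    by field.
  lra.
move: fx; rewrite ler_pXn2r ?nnegrE //.
by have := sqr_ge0 x; lra.
Qed.

End comparison_consequences.

(** * Midlines in any curvature and uniqueness of midpoints *)

Section local_convexity.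
Context {R : realType} {X : metricType R}.
Implicit Types (K : R) (U : set X) (A B C : X) (c g : R -> X).

Lemma ltr_cosh (x y : R) : 0 <= x -> x < y -> cosh x < cosh y.
Proof.
move=> x0 xy; have sd : 0 < sinh (y - x) by apply: sinh_gt0; lra.
have cd : 1 < cosh (y - x).
  by have := cosh2Bsinh2 (y - x); have := cosh_ge1 (y - x); nra.
have -> : cosh y = cosh x * cosh (y - x) + sinh x * sinh (y - x).
  by rewrite -coshD addrC subrK.
have := cosh_gt0 x; have := sinh_ge0 x0; nra.
Qed.

(** Here [x] and [p] are the sides at the apex, [f] is the base, [n] the median onto [p] and [m] the
    midline. The spherical computation with reversed sign bounds [2 * cosh (p / 2) * cosh (x / 2) *
    (cosh m - cosh (f / 2))] by a difference of two squares, which is nonpositive by the triangle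
    inequalities for the halved sides ([key]). Hence no correction term. *)
Lemma hyperbolic_midline (x p f n m : R) :
  0 <= x -> 0 <= p -> 0 <= f -> 0 <= m ->
  p <= f + x -> f <= p + x -> x <= p + f ->
  2 * cosh (p / 2) * cosh n <= cosh x + cosh f ->
  2 * cosh (x / 2) * cosh m <= cosh (p / 2) + cosh n ->
  m <= f / 2.
Proof.
move=> x0 p0 f0 m0 pfx fpx xpf H1 H2; rewrite leNgt; apply/negP => fm.
have {fm} : cosh (f / 2) < cosh m by apply: ltr_cosh; lra.
apply/negP; rewrite -leNgt.
have cp := cosh_gt0 (p / 2); have cx := cosh_gt0 (x / 2).
have key : (cosh (p / 2) * cosh (x / 2) - cosh (f / 2)) ^+ 2 <=
    (sinh (p / 2) * sinh (x / 2)) ^+ 2.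
  apply: sqr_le_sqr.
    suff : cosh (f / 2) <= cosh (p / 2 + x / 2) by rewrite coshD; lra.
    by apply: ler_cosh; lra.
  suff : cosh (p / 2 - x / 2) <= cosh (f / 2) by rewrite coshB; lra.
  by rewrite -(cosh_norm (p / 2 - x / 2)); apply: ler_cosh => //; rewrite ler_norml; lra.
have H3 : 2 * cosh (p / 2) * (2 * cosh (x / 2) * cosh m) <=
     2 * cosh (p / 2) * (cosh (p / 2) + cosh n).
  by rewrite ler_pM2l //; lra.
have ccm : 0 < 2 * (cosh (p / 2) * cosh (x / 2)) by rewrite mulr_gt0 // mulr_gt0.
rewrite -(ler_pM2l ccm); rewrite (cosh_double_half x) (cosh_double_half f) in H1.
have sp2 := cosh2Bsinh2 (p / 2); have sx2 := cosh2Bsinh2 (x / 2).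
have sp2' : sinh (p / 2) ^+ 2 = cosh (p / 2) ^+ 2 - 1 by lra.
have sx2' : sinh (x / 2) ^+ 2 = cosh (x / 2) ^+ 2 - 1 by lra.
rewrite exprMn sp2' sx2' in key; lra.
Qed.

(* In negative or zero curvature the midline is at most half the base; the
   quadratic correction is needed on spheres only. *)
Lemma midline K : exists r k : R, [/\ 0 < r, 0 <= k &
  forall U A A1 B1 c t c' t', RK_domain K U -> U A -> U A1 -> U B1 ->
  shortest_arc U A A1 c 0 1 -> t \in `[0, 1] -> mdist A (c t) = mdist A A1 / 2 ->
  shortest_arc U A B1 c' 0 1 -> t' \in `[0, 1] ->
  mdist A (c' t') = mdist A B1 / 2 ->
  mdist A A1 <= r -> mdist A B1 <= r -> mdist A1 B1 <= r ->
  mdist (c t) (c' t') <= mdist A1 B1 / 2 + k * mdist A A1 ^+ 2].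
Proof.
have [K0|K0|K0] := ltgtP 0 K.
- set s := Num.sqrt K; have s0 : 0 < s by rewrite sqrtr_gt0.
  (* The spherical estimate applies to sides scaled by [s] and at most 1; scaling back,
     [2 * (s * x) ^+ 2] becomes [2 * s * x ^+ 2]. *)
  exists s^-1, (2 * s); split; rewrite ?invr_gt0 //; first by rewrite mulr_ge0 // ltW.
  move=> U A A1 B1 c t c' t' UK UA UA1 UB1 arc tI At arc' tI' At'.
  have scale u : u <= s^-1 -> s * u <= 1.
    by rewrite -[s^-1]mul1r ler_pdivlMr // mulrC.
  move=> /scale x1 /scale p1 /scale f1.
  have Up : U (c' t') by case: (arc') => _ _ cU _ _; apply: cU; exists t'.
  have H1 := midpoint_comparison_pos K0 UK UA UA1 UB1 arc' tI' At'.
  have H2 := midpoint_comparison_pos K0 UK UA Up UA1 arc tI At.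
  rewrite -/s At' (metric_sym (c' t') A1) !mulrA in H1 H2.
  have sge0 u v : 0 <= s * mdist u v by rewrite mulr_ge0 ?mdist_ge0 // ltW.
  have tri : s * mdist (c t) (c' t') <= s * (mdist A A1 / 2 + mdist A B1 / 2).
    by rewrite ler_pM2l // -At -At' (metric_sym A (c t)) metric_triangle.
  have m1 : s * mdist (c t) (c' t') <= 1 by lra.
  have H2' : cos (s * mdist A B1 / 2) + cos (s * mdist A1 (c' t')) <=
      2 * cos (s * mdist A A1 / 2) * cos (s * mdist (c t) (c' t')).
    by rewrite (metric_sym (c t)).
  have := @spherical_midline R (s * mdist A A1) (s * mdist A B1) (s * mdist A1 B1)
    (s * mdist A1 (c' t')) (s * mdist (c t) (c' t')).
  rewrite !sge0 x1 p1 f1 m1 => /(_ isT isT isT isT _ H1 H2').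
  rewrite -mulrDr ler_pM2l //; last first.
  rewrite (addrC (mdist A1 B1)) metric_triangle => /(_ isT) H.
  by rewrite -(ler_pM2l s0); lra.
- set s := Num.sqrt (- K); have s0 : 0 < s by rewrite sqrtr_gt0 oppr_gt0.
  exists 1, 0; split => // U A A1 B1 c t c' t' UK UA UA1 UB1 arc tI At arc' tI' At' _ _ _.
  have Up : U (c' t') by case: (arc') => _ _ cU _ _; apply: cU; exists t'.
  have H1 := midpoint_comparison_neg K0 UK UA UA1 UB1 arc' tI' At'.
  have H2 := midpoint_comparison_neg K0 UK UA Up UA1 arc tI At.
  rewrite -/s At' (metric_sym (c' t') A1) (metric_sym (c' t') (c t)) in H1 H2.
  have sge0 u v : 0 <= s * mdist u v by rewrite mulr_ge0 ?mdist_ge0 // ltW.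
  have : s * mdist (c t) (c' t') <= s * mdist A1 B1 / 2.
    apply: (@hyperbolic_midline (s * mdist A A1) (s * mdist A B1) _
      (s * mdist A1 (c' t'))) => //.
    - rewrite -mulrDr ler_pM2l // addrC metric_triangle //.
    - by rewrite -mulrDr ler_pM2l // addrC (metric_sym A A1) metric_triangle.
    - by rewrite -mulrDr ler_pM2l // (metric_sym A1) metric_triangle.
    - by move: H2; rewrite (mulrA s).
  by rewrite mul0r addr0 -mulrA ler_pM2l.
- exists 1, 0; split => // U A A1 B1 c t c' t' + UA UA1 UB1 arc tI At arc' tI' At' _ _ _.
  rewrite -K0 => UK.
  have Up : U (c' t') by case: (arc') => _ _ cU _ _; apply: cU; exists t'.
  have H1 := midpoint_comparison0 UK UA UA1 UB1 arc' tI' At'.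
  have H2 := midpoint_comparison0 UK UA Up UA1 arc tI At.
  rewrite At' (metric_sym (c' t') A1) (metric_sym (c' t') (c t)) in H1 H2.
  have B0 := mdist_ge0 A1 B1.
  rewrite mul0r addr0 -(@ler_pXn2r _ 2) ?nnegrE ?mdist_ge0 //; last by lra.
  rewrite expr_div_n in H2 *; lra.
Qed.

(** The median comparison is applied to the degenerate triangle with third vertex [Q]: the
    comparison median has length 0, which forces [Q] onto [c t]. *)
Lemma midpoint_unique K U A C Q c t : RK_domain K U -> U A -> U C -> U Q ->
  shortest_arc U A C c 0 1 -> t \in `[0, 1] -> mdist A (c t) = mdist A C / 2 ->
  mdist A Q = mdist A C / 2 -> mdist Q C = mdist A C / 2 -> c t = Q.
Proof.
move=> UK UA UC UQ arc tI At AQ QC.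
apply/esym/mdist_positivity/eqP; rewrite eq_le mdist_ge0 andbT.
have [K0|K0|K0] := ltgtP 0 K.
- set s := Num.sqrt K; have s0 : 0 < s by rewrite sqrtr_gt0.
  (* The perimeter of the triangle [A C C] gives [s * mdist A C < pi], which keeps the arguments in
     the range where cosines determine them. *)
  have [_ /(_ K0 A C C UA UC UC) + _] := UK.
  rewrite mdistxx addr0 (metric_sym C A) ltr_pdivlMr // -/s => per.
  have := midpoint_comparison_pos K0 UK UA UQ UC arc tI At.
  rewrite -/s AQ QC !(mulrA s) => H.
  have b0 : 0 <= s * mdist A C by rewrite mulr_ge0 ?mdist_ge0 // ltW.
  have d0 : 0 <= s * mdist Q (c t) by rewrite mulr_ge0 ?mdist_ge0 // ltW.
  have db : s * mdist Q (c t) <= s * mdist A C.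
    rewrite ler_pM2l //; have := metric_triangle Q A (c t).
    by rewrite (metric_sym Q A) AQ At; lra.
  have cb : 0 < cos (s * mdist A C / 2) by apply: cos_gt0_pihalf; lra.
  rewrite -(ler_pM2l s0) mulr0 leNgt; apply/negP => dgt0.
  have : cos (s * mdist Q (c t)) < cos 0 by rewrite ltr_cos ?in_itv /=; lra.
  by rewrite cos0; nra.
- set s := Num.sqrt (- K); have s0 : 0 < s by rewrite sqrtr_gt0 oppr_gt0.
  have := midpoint_comparison_neg K0 UK UA UQ UC arc tI At.
  rewrite -/s AQ QC !(mulrA s) => H.
  rewrite -(ler_pM2l s0) mulr0 leNgt; apply/negP => /(ltr_cosh (lexx 0)).
  apply/negP; rewrite -leNgt; apply: le_trans (cosh_ge1 0).
  rewrite -(ler_pM2l (cosh_gt0 (s * mdist A C / 2))). lra.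
- move: UK; rewrite -K0 => UK.
  have := midpoint_comparison0 UK UA UQ UC arc tI At.
  rewrite AQ QC => H; rewrite leNgt; apply/negP => d0.
  by have := exprn_gt0 2 d0; lra.
Qed.

End local_convexity.

(** * Uniqueness of short segments and semiconvexity of their distance *)

Section semiconvexity.
Context {R : realType} {X : metricType R}.
Context (K rho : R).
Context (rho_gt0 : 0 < rho).
Context (rho_ball : forall x : X, exists2 U, RK_domain K U & ball x rho `<=` U).
Implicit Types (g : R -> X).

Lemma linear_on_mdist g a b v s t : linear_on a b g v ->
  a <= s -> s <= t -> t <= b -> mdist (g s) (g t) = v * (t - s).
Proof.
move=> lg as_ st tb; rewrite lg ?in_itv /=; try lra.
by rewrite ler0_norm ?opprB; lra.
Qed.

(* The ball is centred at a quarter point: the midpoint of the second segment could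
   be at distance exactly [rho] from the midpoint of the first one. *)
Lemma linear_on_unique_mid g g' a b v : 0 <= v -> a <= b ->
  linear_on a b g v -> linear_on a b g' v -> v * (b - a) <= rho ->
  g a = g' a -> g b = g' b -> g ((a + b) / 2) = g' ((a + b) / 2).
Proof.
move=> v0 ab lg lg' vr ga gb.
have vab : 0 <= v * (b - a) by rewrite mulr_ge0 // subr_ge0.
set z := a + (b - a) / 4; have [U UK bU] := rho_ball (g z).
have inU s : a <= s -> s <= b -> U (g s).
  move=> as_ sb; apply: bU; rewrite ballEmdist /=.
  rewrite lg ?in_itv /=; [|rewrite /z; lra..].
  apply: (@le_lt_trans _ _ (3 / 4 * (v * (b - a))));
    last by move: rho_gt0 vr vab; clear - K rho X; lra.
  rewrite mulrCA; apply: ler_wpM2l => //; rewrite ler_norml /z; lra.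
have arc := linear_shortest_arc ab lg (_ : _ `<=` U).
have {}arc : shortest_arc U (g a) (g b) (fun t => g (a + t * (b - a))) 0 1.
  by apply: arc => _ [s + <-]; rewrite /= in_itv /= => /andP[? ?]; exact: inU.
have hm : a + 2^-1 * (b - a) = (a + b) / 2 by field.
have I2 : (2^-1 : R) \in `[0, 1] by rewrite in_itv /=; lra.
rewrite -[in LHS]hm.
apply: (@midpoint_unique _ _ K U _ _ _ _ 2^-1 UK _ _ _ arc) => //.
- exact: inU.
- exact: inU.
- apply: bU; rewrite ballEmdist /=.
  have h1 : mdist (g z) (g a) = v * (b - a) / 4.
    by rewrite metric_sym (linear_on_mdist lg) /z; [field|lra..].
  have h2 : mdist (g a) (g' ((a + b) / 2)) = v * (b - a) / 2.
    by rewrite ga (linear_on_mdist lg'); [field|lra..].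
  have := metric_triangle (g z) (g a) (g' ((a + b) / 2)).
  by rewrite h1 h2; move: rho_gt0 vr vab; clear - K rho X; lra.
- by rewrite hm !(linear_on_mdist lg); [field|lra..].
- by rewrite ga gb !(linear_on_mdist lg'); [field|lra..].
- by rewrite ga gb !(linear_on_mdist lg'); [field|lra..].
Qed.

(** Bisection: the segments agree at midpoints, hence at all dyadic points, and between two
    neighbouring dyadic points they differ by at most twice the length travelled. *)
Lemma linear_on_unique g g' a b v : 0 <= v -> 
  linear_on a b g v -> linear_on a b g' v -> v * (b - a) <= rho ->
  g a = g' a -> g b = g' b -> forall t, t \in `[a, b] -> g t = g' t.
Proof.
move=> v0 lg lg' vr ga gb t tI.
have bisect n : forall a' b', a <= a' -> b' <= b -> g a' = g' a' -> g b' = g' b' ->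
    forall t, a' <= t <= b' -> mdist (g t) (g' t) <= 2 * v * (b' - a') / 2 ^+ n.
  elim: n => [|n IHn] a' b' aa bb ga' gb' {tI}t /andP[at_ tb].
    rewrite expr0 divr1.
    have h1 : mdist (g t) (g a') = v * (t - a').
      by rewrite metric_sym (linear_on_mdist lg) //; lra.
    have h2 : mdist (g a') (g' t) = v * (t - a').
      by rewrite ga' (linear_on_mdist lg') //; lra.
    have h3 : v * (t - a') <= v * (b' - a') by rewrite ler_wpM2l //; lra.
    by have := metric_triangle (g t) (g a') (g' t); rewrite h1 h2; lra.
  have vr' : v * (b' - a') <= rho.
    by apply: le_trans vr; rewrite ler_wpM2l //; lra.
  have gm : g ((a' + b') / 2) = g' ((a' + b') / 2).
    apply: (@linear_on_unique_mid _ _ _ _ v) => //; first by lra.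
      exact: linear_on_sub lg.
    exact: linear_on_sub lg'.
  have half : 2 * v * ((b' - a') / 2) / 2 ^+ n = 2 * v * (b' - a') / 2 ^+ n.+1.
    by rewrite exprS; field; rewrite expf_neq0.
  rewrite -half; have [tm|mt] := leP t ((a' + b') / 2).
    have := IHn a' ((a' + b') / 2) aa _ ga' gm t.
    rewrite at_ tm (_ : (a' + b') / 2 - a' = (b' - a') / 2); last by field.
    by apply => //; lra.
  have := IHn ((a' + b') / 2) b' _ bb gm gb' t.
  rewrite (ltW mt) tb (_ : b' - (a' + b') / 2 = (b' - a') / 2); last by field.
  by apply => //; lra.
apply: mdist_positivity; apply/eqP; rewrite eq_le mdist_ge0 andbT.
apply/ler_addgt0Pr => e e0; rewrite add0r.
move: (tI); rewrite in_itv /= => abt.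
set C := 2 * v * (b - a).
have C0 : 0 <= C by rewrite !mulr_ge0 //; lra.
have [n Cn] : exists n, C / e < 2 ^+ n.
  exists (Num.bound (C / e)); apply: lt_le_trans (archi_boundP _) _.
    by rewrite divr_ge0 // ltW.
  by rewrite -natrX ler_nat ltnW // ltn_expl.
apply: le_trans (bisect n a b (lexx _) (lexx _) ga gb t abt) _.
by rewrite ler_pdivrMr ?exprn_gt0 // -/C (mulrC e) -ler_pdivrMr // ltW.
Qed.

(** The quadrilateral is cut by the diagonal from [g (t - e)] to [g' (t + e)]. Its midpoint is
    joined to [g t] and to [g' t] by midlines of the two triangles, each about half of one of the
    sides [mdist (g (t + e)) (g' (t + e))] and [mdist (g (t - e)) (g' (t - e))]. *)
Lemma mdist_linear_semiconvex : exists r k : R, [/\ 0 < r, 0 <= k &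
  forall g g' t e v v', 0 <= e ->
  linear_on (t - e) (t + e) g v -> linear_on (t - e) (t + e) g' v' ->
  v * e <= r -> v' * e <= r -> mdist (g t) (g' t) <= r ->
  mdist (g t) (g' t) <=
  (mdist (g (t - e)) (g' (t - e)) + mdist (g (t + e)) (g' (t + e))) / 2 +
  k * ((v * e) ^+ 2 + (v' * e) ^+ 2)].
Proof.
have [r0 [k [r0_gt0 k0 mid]]] := @midline R X K.
(* All points used lie within [2 * r] of [g' t], and all sides of the triangles are at most
   [3 * r]. *)
pose r := Num.min r0 rho / 4.
have min_gt0 : 0 < Num.min r0 rho by rewrite lt_min r0_gt0.
have r_gt0 : 0 < r by rewrite divr_gt0.
have r4 : 4 * r <= r0 by rewrite mulrC divfK // ge_min lexx.
have r4' : 4 * r <= rho by rewrite mulrC divfK // ge_min lexx orbT.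
(* The sides [A A1] and [B B1] have lengths [2 * (v * e)] and [2 * (v' * e)]; squaring gives the
   factor 4. *)
exists r, (4 * k); split => //; first by rewrite mulr_ge0.
move=> g g' t e v v' e0 lg lg' ve ve' gg'.
set A := g (t - e); set A1 := g (t + e); set B := g' (t - e); set B1 := g' (t + e).
have [U UK bU] := rho_ball (g' t).
have AM : mdist A (g t) = v * e.
  by rewrite (linear_on_mdist lg); [ring|move: e0; clear - K rho X; lra..].
have MA1 : mdist (g t) A1 = v * e.
  by rewrite (linear_on_mdist lg); [ring|move: e0; clear - K rho X; lra..].
have BN : mdist B (g' t) = v' * e.
  by rewrite (linear_on_mdist lg'); [ring|move: e0; clear - K rho X; lra..].
have NB1 : mdist (g' t) B1 = v' * e.
  by rewrite (linear_on_mdist lg'); [ring|move: e0; clear - K rho X; lra..].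
have AA1 : mdist A A1 = 2 * (v * e).
  by rewrite (linear_on_mdist lg); [ring|move: e0; clear - K rho X; lra..].
have BB1 : mdist B B1 = 2 * (v' * e).
  by rewrite (linear_on_mdist lg'); [ring|move: e0; clear - K rho X; lra..].
have ve0 : 0 <= v * e by rewrite -AM mdist_ge0.
have ve0' : 0 <= v' * e by rewrite -BN mdist_ge0.
have NM : mdist (g' t) (g t) <= r by rewrite metric_sym.
have inU (h : R -> X) w s : linear_on (t - e) (t + e) h w -> w * e <= r ->
    mdist (g' t) (h t) <= r -> s \in `[t - e, t + e] -> U (h s).
  move=> lh we hN sI; apply: bU; rewrite ballEmdist /=.
  (* On an interval reduced to a point, linearity does not determine the sign of the speed. *)
  have [e_eq0|e_neq0] := eqVneq e 0.
    have -> : s = t by move: sI; rewrite in_itv /= e_eq0; lra.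
    lra.
  have w0 : 0 <= w by apply: (linear_on_speed_ge0 _ lh); lra.
  have : mdist (h t) (h s) <= w * e.
    rewrite lh // ?in_itv /=; last lra.
    by move: sI; rewrite in_itv /= => sI; rewrite ler_wpM2l // ler_norml; lra.
  by have := metric_triangle (g' t) (h t) (h s); lra.
have UgI s : s \in `[t - e, t + e] -> U (g s) by exact: inU lg ve NM.
have UgI' s : s \in `[t - e, t + e] -> U (g' s).
  by apply: inU lg' ve' _; rewrite mdistxx ltW.
have lI : t - e \in `[t - e, t + e] by rewrite in_itv /=; lra.
have rI : t + e \in `[t - e, t + e] by rewrite in_itv /=; lra.
have UA : U A := UgI _ lI. have UA1 : U A1 := UgI _ rI.
have UB : U B := UgI' _ lI. have UB1 : U B1 := UgI' _ rI.
have tee : t - e <= t + e by lra.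
have I2 : (2^-1 : R) \in `[0, 1] by rewrite in_itv /=; lra.
have hm : t - e + 2^-1 * (t + e - (t - e)) = t by field.
have arc1 := linear_shortest_arc tee lg (U := U).
have {}arc1 : shortest_arc U A A1 (fun s => g (t - e + s * (t + e - (t - e)))) 0 1.
  by apply: arc1 => _ [s + <-]; exact: UgI.
have lrev := linear_on_rev lg'.
have arc2 := linear_shortest_arc tee lrev (U := U).
have {}arc2 : shortest_arc U B1 B
    (fun s => g' (t - e + (t + e) - (t - e + s * (t + e - (t - e))))) 0 1.
  have E1 : g' (t - e + (t + e) - (t - e)) = B1 by congr g'; ring.
  have E2 : g' (t - e + (t + e) - (t + e)) = B by congr g'; ring.
  move: arc2; rewrite /= E1 E2; apply => _ [s + <-].
  rewrite /= in_itv /= => sI; apply: UgI'.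
  by rewrite in_itv /=; move: sI; clear - K rho X; lra.
have hm2 : t - e + (t + e) - (t - e + 2^-1 * (t + e - (t - e))) = t by field.
have [geo _ _] := UK.
(* [midline] wants both arcs to start at the apex, so the diagonal is taken in both directions;
   uniqueness identifies the two midpoints. *)
have [c arc3] := geo _ _ UA UB1; have [c' arc4] := geo _ _ UB1 UA.
have [s [sI Us As sB1]] := shortest_arc_midpoint arc3.
have [s' [sI' Us' B1s sA]] := shortest_arc_midpoint arc4.
have cc : c s = c' s'.
  apply: (midpoint_unique UK UA UB1 Us' arc3 sI As).
    by rewrite metric_sym sA metric_sym.
  by rewrite metric_sym B1s metric_sym.
have AB1 : mdist A B1 <= 3 * r.
  have h1 := metric_triangle A (g t) B1; have h2 := metric_triangle (g t) (g' t) B1.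
  by move: h1 h2 AM NB1 ve ve' gg'; clear - K rho X; lra.
have A1B1 : mdist A1 B1 <= 3 * r.
  have h1 := metric_triangle A1 (g t) B1; have h2 := metric_triangle (g t) (g' t) B1.
  by rewrite (metric_sym A1 (g t)) in h1;
    move: h1 h2 MA1 NB1 ve ve' gg'; clear - K rho X; lra.
have AB : mdist A B <= 3 * r.
  have h1 := metric_triangle A (g t) B; have h2 := metric_triangle (g t) (g' t) B.
  by rewrite (metric_sym (g' t) B) in h2;
    move: h1 h2 AM BN ve ve' gg'; clear - K rho X; lra.
have r2 (z : R) : z <= r -> 2 * z <= r0 by move: r4 r_gt0; clear - K rho X; lra.
have r3 (z : R) : z <= 3 * r -> z <= r0 by move: r4 r_gt0; clear - K rho X; lra.
have M1 : mdist (g t) (c s) <= mdist A1 B1 / 2 + k * mdist A A1 ^+ 2.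
  have := mid U A A1 B1 _ 2^-1 _ s UK UA UA1 UB1 arc1 I2 _ arc3 sI As.
  by rewrite hm AM AA1; apply; [field|exact: r2|exact: r3|exact: r3].
have M2 : mdist (g' t) (c' s') <= mdist B A / 2 + k * mdist B1 B ^+ 2.
  have := mid U B1 B A _ 2^-1 _ s' UK UB1 UB UA arc2 I2 _ arc4 sI' B1s.
  rewrite hm2 (metric_sym B1 (g' t)) NB1 (metric_sym B1 B) BB1 (metric_sym B A).
  by rewrite (metric_sym B1 A); apply; [field|exact: r2|exact: r3|exact: r3].
have := metric_triangle (g t) (c s) (g' t).
rewrite {2}cc (metric_sym (c' s')).
rewrite AA1 (metric_sym B A) (metric_sym B1 B) BB1 in M1 M2.
by move: M1 M2; clear - K rho X; lra.
Qed.

End semiconvexity.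

(** * Energy of a semiconvex function *)

Section energy_upper_bound.
Context {R : realType}.
Notation mu := (@lebesgue_measure R).

Lemma energy_le {X : metricType R} (u : R -> X) (e0 B : R) :
  continuous u -> 0 < e0 ->
  (forall e, 0 < e -> e < e0 ->
     \int[mu]_(t in `[0, 2 * pi]) energy_integrand u e t <= B) ->
  (energy u <= B%:E)%E.
Proof.
move=> cu e0_gt0 uB; apply: ge_ereal_sup => _ [phi [lphi cphi phi01] <-].
apply: le_trans (ereal_inf_lbound _) _.
  exists [set e | 0 < e < e0]; last reflexivity.
  exists e0 => //= e /=; rewrite sub0r normrN => ee0 e_gt0.
  by rewrite e_gt0 /=; move: ee0; rewrite gtr0_norm.
apply: ge_ereal_sup => _ [e /= /andP[e_gt0 ee0] <-].
have ci := @continuous_energy_integrand R X u e cu.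
have cpi : continuous (fun t => phi t * energy_integrand u e t).
  by move=> t; apply: cvgM; [exact: cphi|exact: ci].
rewrite (continuous_integralE _ _ cpi) lee_fin.
apply: le_trans (uB e e_gt0 ee0); apply: ler_Rintegral_itv => // t _.
by rewrite ler_piMl ?energy_integrand_ge0 //; case/andP: (phi01 t).
Qed.

(** The weaker bound [Q] is used only within [e] of the endpoints, on measure at most [2 * e]; a
    piece shorter than that falls under it entirely. *)
Lemma Rintegral_piece_le (g : R -> R) (a b e P Q : R) : continuous g -> a <= b ->
  0 < e -> 0 <= P -> 0 <= Q ->
  (forall t, a <= t <= b -> g t <= Q) ->
  (forall t, a + e <= t <= b - e -> g t <= P) ->
  \int[mu]_(t in `[a, b]) g t <= (b - a) * P + 2 * e * Q.
Proof.
move=> cg ab e0 P0 Q0 gQ gP.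
have bnd c d B : c <= d -> (forall t, c <= t <= d -> g t <= B) ->
    \int[mu]_(t in `[c, d]) g t <= (d - c) * B.
  move=> cd gB; have cc : continuous (fun _ : R => B) by move=> ?; exact: cvg_cst.
  apply: le_trans (ler_Rintegral_itv cg cc gB) _.
  rewrite Rintegral_cst //= lebesgue_measure_itv /= lte_fin.
  case: ltP => [_|dc]; first by rewrite -EFinD /= mulrC.
  by rewrite (_ : d = c) ?subrr ?mul0r ?mulr0 //; lra.
have [short|long] := leP (b - a) (2 * e).
  apply: le_trans (bnd _ _ _ ab gQ) _.
  have h1 : 0 <= (b - a) * P by rewrite mulr_ge0 // subr_ge0.
  have h2 : (b - a) * Q <= 2 * e * Q by rewrite ler_wpM2r.
  lra.
rewrite (@Rintegral_itv_split R g a (a + e) b cg); [|lra|lra].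
rewrite (@Rintegral_itv_split R g (a + e) (b - e) b cg); [|lra|lra].
have := bnd a (a + e) Q; have := bnd (a + e) (b - e) P; have := bnd (b - e) b Q.
move=> h1 h2 h3.
have {}h1 : \int[mu]_(t in `[b - e, b]) g t <= (b - (b - e)) * Q.
  by apply: h1; [lra|move=> t ?; apply: gQ; lra].
have {}h2 : \int[mu]_(t in `[a + e, b - e]) g t <= (b - e - (a + e)) * P.
  by apply: h2; [lra|].
have {}h3 : \int[mu]_(t in `[a, a + e]) g t <= (a + e - a) * Q.
  by apply: h3; [lra|move=> t ?; apply: gQ; lra].
have eP : 0 <= e * P by rewrite mulr_ge0 // ltW.
by lra.
Qed.

Lemma Rintegral_pieces_le (g : R -> R) (b : nat -> R) n (e P Q : R) :
  continuous g -> (forall k, (k < n)%N -> b k <= b k.+1) ->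
  0 < e -> 0 <= P -> 0 <= Q ->
  (forall t, g t <= Q) ->
  (forall k t, (k < n)%N -> b k + e <= t <= b k.+1 - e -> g t <= P) ->
  \int[mu]_(t in `[b 0%N, b n]) g t <= (b n - b 0%N) * P + n%:R * (2 * e * Q).
Proof.
move=> cg bS e0 P0 Q0 gQ gP.
suff [] : b 0%N <= b n /\
  \int[mu]_(t in `[b 0%N, b n]) g t <= (b n - b 0%N) * P + n%:R * (2 * e * Q) by [].
elim: n bS gP => [|n IHn] bS gP.
  by rewrite set_itv1 Rintegral_set1 subrr !mul0r addr0.
have [b0n IH] := IHn (fun k hk => bS k (leqW hk)) (fun k t hk => gP k t (leqW hk)).
have bn := bS n (leqnn _); split; first exact: le_trans bn.
rewrite (@Rintegral_itv_split R g _ (b n)) //.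
have := Rintegral_piece_le cg bn e0 P0 Q0 (fun t _ => gQ t) (gP n ^~ (leqnn _)).
rewrite -natr1; lra.
Qed.

Lemma mdist_regular (x y : R) : mdist (x : R^o) (y : R^o) = `|x - y|.
Proof. exact: distrC. Qed.

(* Summation by parts: the integral of [(f (t + e) - f t) ^+ 2] over a period is that of
   [f t * (2 * f t - f (t - e) - f (t + e))]. Semiconvexity bounds the second factor
   by [2 * C * e ^+ 2], except on a set of measure [O(e)] near the points [b k],
   where it is at most [2 * M * e]. *)
Lemma energy_semiconvex_le (f : R -> R) (b : nat -> R) n (M C eta e0 : R) :
  loop f -> (forall s t, `|f s - f t| <= M * `|s - t|) ->
  (forall t, 0 <= f t <= eta) -> 0 <= C -> 0 < e0 ->
  (forall k, (k < n)%N -> b k <= b k.+1) -> b n = b 0%N + 2 * pi ->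
  (forall k e t, (k < n)%N -> 0 < e -> e < e0 -> b k + e <= t <= b k.+1 - e ->
     f t <= (f (t - e) + f (t + e)) / 2 + C * e ^+ 2) ->
  (energy (f : R -> R^o) <= (eta * (4 * pi * C + 4 * n%:R * M))%:E)%E.
Proof.
move=> lf fM f01 C0 e0_gt0 bS bn fC.
have cf : continuous f.
  apply: (@lipschitz_continuous R R^o f M) => s t.
  by rewrite mdist_regular; exact: fM.
have eta0 : 0 <= eta by have := f01 0; lra.
have M0 : 0 <= M.
  by have := fM 1 0; rewrite subr0 normr1 mulr1; apply: le_trans; exact: normr_ge0.
apply: (@energy_le R^o f e0 _ cf e0_gt0) => e e_gt0 ee0.
have en0 : e != 0 by rewrite gt_eqF.
have cfs c : continuous (fun t : R => f (t + c) : R).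
  exact: (@continuous_shift R f c cf).
(* The energy integrand is [A + B]. As a second difference of [f ^+ 2], [A] integrates to 0 over a
   period. *)
pose A t : R := (f (t - e) ^+ 2 + f (t + e) ^+ 2 - 2 * f t ^+ 2) / (2 * e ^+ 2).
pose B t : R := f t * (2 * f t - f (t - e) - f (t + e)) / e ^+ 2.
have c2 c : continuous (fun t : R => f (t + c) ^+ 2 : R).
  exact: (continuous_sqr (cfs c)).
have c20 : continuous (fun t : R => f t ^+ 2 : R) by exact: (continuous_sqr cf).
have cA : continuous A.
  move=> t; apply: cvgM; last exact: cvg_cst.
  apply: cvgB; first by apply: cvgD; [exact: c2|exact: c2].
  by apply: cvgM; [exact: cvg_cst|exact: c20].
have cB : continuous B.
  move=> t; apply: cvgM; last exact: cvg_cst.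
  apply: cvgM; first exact: cf.
  apply: cvgB; last exact: cfs.
  by apply: cvgB; [apply: cvgM; [exact: cvg_cst|exact: cf]|exact: cfs].
have iC (h : R -> R) : continuous h -> mu.-integrable `[0, 2 * pi] (EFin \o h).
  exact: continuous_itv_integrable.
have lB : loop B.
  by move=> t; rewrite /B lf (addrAC t (2 * pi) (- e)) (addrAC t (2 * pi) e) !lf.
have -> : \int[mu]_(t in `[0, 2 * pi]) energy_integrand (f : R -> R^o) e t =
    \int[mu]_(t in `[0, 2 * pi]) (A t + B t).
  apply: eq_Rintegral => t _; rewrite /energy_integrand /A /B.
  by rewrite !mdist_regular !real_normK ?num_real //; field.
rewrite RintegralD //; [|exact: iC..].
have -> : \int[mu]_(t in `[0, 2 * pi]) A t = 0.
  have ls : loop (fun t => f t ^+ 2 : R) by move=> t; rewrite lf.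
  rewrite RintegralZr; [|by []|apply: iC]; first last.
    move=> t; apply: cvgB; first by apply: cvgD; [exact: c2|exact: c2].
    by apply: cvgM; [exact: cvg_cst|exact: c20].
  rewrite RintegralB //; first last.
  - by apply: iC => t; apply: cvgM; [exact: cvg_cst|exact: c20].
  - by apply: iC => t; apply: cvgD; [exact: c2|exact: c2].
  rewrite RintegralD //; [|exact: iC..].
  rewrite RintegralZl //; last exact: iC.
  by rewrite !(loop_Rintegral_shift _ c20 ls); ring.
rewrite add0r -(loop_Rintegral (b 0%N) cB lB) -bn.
have f_lip t : f t - f (t - e) <= M * e /\ f t - f (t + e) <= M * e.
  have h1 := fM t (t - e); have h2 := fM t (t + e).
  rewrite opprB addrCA subrr addr0 (gtr0_norm e_gt0) in h1.
  rewrite opprD addrA subrr add0r normrN (gtr0_norm e_gt0) in h2.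
  by split; [exact: le_trans (ler_norm _) h1|exact: le_trans (ler_norm _) h2].
have Be t z : 2 * f t - f (t - e) - f (t + e) <= z -> 0 <= z -> B t <= eta * (z / e ^+ 2).
  move=> hz z0; rewrite /B -mulrA.
  have /andP[ft0 ft1] := f01 t.
  apply: (@le_trans _ _ (f t * (z / e ^+ 2))).
    by rewrite ler_wpM2l // ler_wpM2r // invr_ge0 sqr_ge0.
  by rewrite ler_wpM2r // divr_ge0 // sqr_ge0.
have H := @Rintegral_pieces_le B b n e (eta * (2 * C * e ^+ 2 / e ^+ 2))
  (eta * (2 * M * e / e ^+ 2)) cB bS e_gt0.
have C2 : 0 <= 2 * C * e ^+ 2 by apply: mulr_ge0; [exact: mulr_ge0|exact: sqr_ge0].
have M2 : 0 <= 2 * M * e by apply: mulr_ge0; [exact: mulr_ge0|exact: ltW].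
apply: le_trans (H _ _ _ _) _.
- by apply: mulr_ge0 => //; apply: divr_ge0 => //; exact: sqr_ge0.
- by apply: mulr_ge0 => //; apply: divr_ge0 => //; exact: sqr_ge0.
- by move=> t; apply: Be => //; have [] := f_lip t; lra.
- move=> k t kn tk; apply: Be => //.
  by have := fC k e t kn e_gt0 ee0 tk; lra.
rewrite bn le_eqVlt; apply/orP; left; apply/eqP; field.
exact: en0.
Qed.

Lemma W12_norm_lt (f : R -> R) (a b eps : R) : 0 < eps ->
  (\int[mu]_(t in `[0%R, (2 * pi)%R]) (f t ^+ 2)%:E <= a%:E)%E ->
  (energy (f : R -> R^o) <= b%:E)%E -> continuous f -> a + b < eps ^+ 2 ->
  (W12_norm (f : R -> R^o) < eps%:E)%E.
Proof.
move=> e0 fa fb cf ab; rewrite /W12_norm.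
have i0 : (0 <= \int[mu]_(t in `[0%R, (2 * pi)%R]) (f t ^+ 2)%:E)%E.
  by apply: integral_ge0 => t _; rewrite lee_fin sqr_ge0.
have en0 := @energy_ge0 R R^o f cf.
have : (\int[mu]_(t in `[0%R, (2 * pi)%R]) (f t ^+ 2)%:E + energy (f : R -> R^o)
    <= (a + b)%:E)%E.
  by rewrite EFinD; exact: leeD.
have := adde_ge0 i0 en0.
case: (_ + _)%E => [r|//|//]; rewrite !lee_fin => r0 rab.
rewrite poweR_EFin lte_fin powR12_sqrt //.
by rewrite -(ltr_pXn2r (n := 2)) ?nnegrE ?sqrtr_ge0 ?ltW // sqr_sqrtr //; lra.
Qed.

End energy_upper_bound.

(** * Curve shortening and its limits *)

Section shortening_step.
Context {R : realType} {X : metricType R}.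
Implicit Types (g h : R -> X).

Lemma loopn g n t : loop g -> g (t + n%:R * (2 * pi)) = g t.
Proof.
move=> lg; elim: n => [|n IHn]; first by rewrite mul0r addr0.
by rewrite -natr1 mulrDl mul1r addrA lg.
Qed.

Lemma loop_linear_on_shift g n a b v : loop g -> linear_on a b g v ->
  linear_on (a + n%:R * (2 * pi)) (b + n%:R * (2 * pi)) g v.
Proof.
move=> lg l s t; rewrite !in_itv /= => sI tI.
rewrite -{1}(subrK (n%:R * (2 * pi)) s) -{1}(subrK (n%:R * (2 * pi)) t) !loopn //.
rewrite l ?in_itv /=; [|lra|lra].
by congr (_ * `|_|); ring.
Qed.

Lemma loop_linear_on_unshift g n a b v : loop g ->
  linear_on (a + n%:R * (2 * pi)) (b + n%:R * (2 * pi)) g v -> linear_on a b g v.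
Proof.
move=> lg l s t; rewrite !in_itv /= => sI tI.
rewrite -(@loopn g n s lg) -(@loopn g n t lg) l ?in_itv /=; [|lra|lra].
by congr (_ * `|_|); ring.
Qed.

(** Indices are reduced modulo [N], so that later arguments can use any [j] without treating the
    closing of the loop apart. *)
Lemma linear_replacement_periodic N (y : nat -> R) D g h :
  loop g -> (0 < N)%N -> 0 < D -> (forall j, y j.+1 = y j + D) ->
  y N = y 0%N + 2 * pi -> linear_replacement N y g h ->
  forall j, h (y j) = g (y j) /\
    linear_on (y j) (y j.+1) h (mdist (g (y j)) (g (y j.+1)) / D).
Proof.
move=> lg N0 D0 yS yN [lh rep].
have yE j : y j = y 0%N + j%:R * D.
  elim: j => [|j IHj]; first by rewrite mul0r addr0.
  by rewrite yS IHj -natr1 mulrDl mul1r addrA.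
have ND : N%:R * D = 2 * pi by move: yN; rewrite yE; lra.
have ymod j : y j = y (j %% N)%N + (j %/ N)%:R * (2 * pi).
  rewrite (yE j) (yE (j %% N)%N) {1}(divn_eq j N) natrD natrM -ND; ring.
have ymodS j : y j.+1 = y (j %% N).+1 + (j %/ N)%:R * (2 * pi).
  by rewrite yS ymod yS; ring.
move=> j; have [h1 h2 [v lv]] := rep (j %% N)%N (ltn_pmod j N0).
have vE : v = mdist (g (y j)) (g (y j.+1)) / D.
  rewrite ymod ymodS !loopn // -h1 -h2 (linear_on_mdist lv) ?yS; [|lra..].
  by rewrite addrAC subrr add0r mulfK // gt_eqF.
split; first by rewrite ymod !loopn.
by rewrite -vE ymod ymodS; exact: loop_linear_on_shift.
Qed.

(** The equality case of the triangle inequality: a chord from [s] to [t] shorter than [v * (t - s)]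
    would make the path through [s] and [t] shorter than the chord from [a] to [c]. *)
Lemma linear_on_glue g a b c v : 0 <= v -> linear_on a b g v -> linear_on b c g v ->
  v * (c - a) <= mdist (g a) (g c) -> a <= b -> b <= c -> linear_on a c g v.
Proof.
move=> v0 l1 l2 ac ab bc.
have le s t : a <= s -> s <= t -> t <= c -> mdist (g s) (g t) <= v * t - v * s.
  move=> as_ st tc.
  have [tb|bt] := leP t b; first by rewrite (linear_on_mdist l1) //; lra.
  have [bs|sb] := leP b s; first by rewrite (linear_on_mdist l2) //; lra.
  have := metric_triangle (g s) (g b) (g t).
  rewrite (linear_on_mdist l1 as_ (ltW sb) (lexx b)).
  by rewrite (linear_on_mdist l2 (lexx b) (ltW bt) tc); lra.
have eq s t : a <= s -> s <= t -> t <= c -> mdist (g s) (g t) = v * (t - s).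
  move=> as_ st tc; apply/eqP; rewrite eq_le; apply/andP; split.
    by have := le s t as_ st tc; lra.
  have := le a s (lexx _) as_ (le_trans st tc).
  have := le t c (le_trans as_ st) tc (lexx _).
  have := metric_triangle (g a) (g s) (g c); have := metric_triangle (g s) (g t) (g c).
  by lra.
move=> s t; rewrite !in_itv /= => /andP[s1 s2] /andP[t1 t2].
have [st|/ltW ts] := leP s t; first by rewrite eq // distrC ger0_norm // subr_ge0.
by rewrite metric_sym eq // ger0_norm // subr_ge0.
Qed.

(* The chords replacing [g] and then [ge] have speeds [U j] and [W j] at most [vg];
   as the length lost is [2 * pi * (vg - v)], none of them is much smaller. *)
Lemma shortening_structure L x g gam vg v : (0 < L)%N -> loop g ->
  (forall s t, s <= t -> curve_length g s t = (vg * (t - s))%:E) ->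
  (forall s t, s <= t -> curve_length gam s t = (v * (t - s))%:E) ->
  curve_shortening L x g gam ->
  v <= vg /\ exists ge go phi b (U W : nat -> R),
  let E := 4 * (L ^ 2)%:R * (vg - v) in let x_ := xpoint L x in
  [/\ [/\ loop ge, loop go & loop gam],
      forall j, linear_on (x_ j.*2) (x_ j.*2.+2) ge (U j) /\ vg - E <= U j <= vg,
      forall j, [/\ linear_on (x_ j.*2.+1) (x_ j.*2.+3) go (W j),
        vg - E <= W j <= vg & go (x_ j.*2.+1) = ge (x_ j.*2.+1)],
      forall t, x <= t <= x + 2 * pi ->
        go t = gam (phi t) /\ `|v * (phi t - t)| <= 2 * pi * (vg - v)
    & [/\ b 0%N = x, b (L ^ 2).*2 = x + 2 * pi,
        forall k, (k < (L ^ 2).*2)%N -> b k <= b k.+1 &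
        forall k, (k < (L ^ 2).*2)%N -> linear_on (b k) (b k.+1) gam v]].
Proof.
move=> L0 lg gv gamv [ge [go [rep1 rep2 [lgam [phi [cphi mphi [phi0 phi1] goE]] _]]]].
have L20 : (0 < L ^ 2)%N by rewrite expn_gt0 L0.
have p0 : 0 < 2 * pi :> R by rewrite mulr_gt0 // pi_gt0.
have L20' : 0 < (L ^ 2)%:R :> R by rewrite ltr0n.
set n := (L ^ 2)%N in L20 L20' rep1 rep2 *.
pose d : R := pi / n%:R; have d0 : 0 < d by rewrite divr_gt0 // pi_gt0.
pose x_ := xpoint L x.
have nd : n%:R * d = pi by rewrite /d mulrC divfK // gt_eqF.
have xS k : x_ k.+1 = x_ k + d.
  by rewrite /x_ /xpoint -/n -/d -natr1; ring.
have xn k : x_ (k + n.*2)%N = x_ k + 2 * pi.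
  by rewrite /x_ /xpoint -/n -/d natrD -muln2 natrM -nd; ring.
have x0E : x_ 0%N = x by rewrite /x_ /xpoint mul0r addr0.
have [lge lgo] : loop ge /\ loop go by case: rep1; case: rep2.
have D0 : 0 < 2 * d by rewrite mulr_gt0.
have e1 := @linear_replacement_periodic n (fun j => x_ j.*2) (2 * d) g ge lg L20 D0.
have {}e1 : forall j, ge (x_ j.*2) = g (x_ j.*2) /\ linear_on (x_ j.*2) (x_ j.*2.+2) ge
    (mdist (g (x_ j.*2)) (g (x_ j.*2.+2)) / (2 * d)).
  apply: e1 => //; last by rewrite -[n.*2]add0n xn.
  by move=> j; rewrite doubleS !xS; ring.
have e2 := @linear_replacement_periodic n (fun j => x_ j.*2.+1) (2 * d) ge go lge L20 D0.
have {}e2 : forall j, go (x_ j.*2.+1) = ge (x_ j.*2.+1) /\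
    linear_on (x_ j.*2.+1) (x_ j.*2.+3) go
    (mdist (ge (x_ j.*2.+1)) (ge (x_ j.*2.+3)) / (2 * d)).
  apply: e2 => //; last by rewrite -add1n addnC -[1%N]/(0.*2.+1)%N addnC xn.
  by move=> j; rewrite doubleS !xS; ring.
pose U j := mdist (g (x_ j.*2)) (g (x_ j.*2.+2)) / (2 * d).
pose W j := mdist (ge (x_ j.*2.+1)) (ge (x_ j.*2.+3)) / (2 * d).
have gd s t : s <= t -> mdist (g s) (g t) <= vg * (t - s).
  by move=> st; rewrite -lee_fin -gv //; exact: mdist_le_curve_length.
have Ug j : U j <= vg.
  rewrite ler_pdivrMr //; apply: le_trans (gd _ _ _) _; rewrite !xS; first by lra.
  by rewrite le_eqVlt; apply/orP; left; apply/eqP; ring.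
(* Odd points are the midpoints of even intervals, so an odd chord spans half of each of two
   neighbouring even chords. *)
have WU j : W j <= (U j + U j.+1) / 2.
  rewrite ler_pdivrMr //.
  have [_ l1] := e1 j; have [_ l2] := e1 j.+1.
  have h1 : mdist (ge (x_ j.*2.+1)) (ge (x_ j.*2.+2)) = U j * d.
    rewrite (linear_on_mdist l1); [|rewrite !xS; lra..].
    by congr (_ * _); rewrite !xS; ring.
  have h2 : mdist (ge (x_ j.*2.+2)) (ge (x_ j.*2.+3)) = U j.+1 * d.
    rewrite doubleS in l2; rewrite (linear_on_mdist l2); [|rewrite !xS; lra..].
    by rewrite /U doubleS; congr (_ * _); rewrite !xS; ring.
  have := metric_triangle (ge (x_ j.*2.+1)) (ge (x_ j.*2.+2)) (ge (x_ j.*2.+3)).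
  by rewrite h1 h2; lra.
have Wg j : W j <= vg by have := WU j; have := Ug j; have := Ug j.+1; lra.
have piece k : exists2 w, w <= vg & linear_on (x_ k) (x_ k.+1) go w /\
    (forall j, k = j.*2.+1 -> w = W j).
  have [k_odd|k_odd] := boolP (odd k).
    have kE : k = (k./2).*2.+1 by rewrite -[LHS](odd_double_half k) k_odd.
    have [_] := e2 k./2; rewrite -/(W k./2) -kE => l.
    exists (W k./2); first exact: Wg.
    split; first by apply: linear_on_sub l; rewrite ?xS; lra.
    by move=> j kj; congr W; apply: double_inj; move: kj; rewrite {1}kE => -[].
  have kE : k = (k./2).*2 by rewrite -[LHS](odd_double_half k) (negbTE k_odd).
  (* A piece starting at an even point is the second half of the preceding odd interval. Moving
     ahead by one period avoids the predecessor of index 0. *)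
  have [_ l] := e2 (k./2 + n.-1)%N; exists (W (k./2 + n.-1)%N); first exact: Wg.
  have kn : (k./2 + n.-1).*2.+2 = (k + n.*2)%N.
    by rewrite {2}kE -doubleD -doubleS -addnS prednK.
  split; last by move=> j kj; move: k_odd; rewrite kj /= odd_double.
  have l' : linear_on (x_ (k + n.*2)%N) (x_ (k + n.*2).+1%N) go (W (k./2 + n.-1)%N).
    by apply: linear_on_sub l; rewrite -kn ?xS; lra.
  apply: (@loop_linear_on_unshift _ 1); first exact: lgo.
  by rewrite mul1r -(xn k) -(xn k.+1) addSn.
have x2n : x_ n.*2 = x + 2 * pi by rewrite -[n.*2]add0n xn x0E.
have xle i j : (i <= j)%N -> x_ i <= x_ j.
  move=> /subnK <-; elim: (j - i)%N => // m; rewrite addSn xS; lra.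
have xI k : (k <= n.*2)%N -> x <= x_ k <= x + 2 * pi.
  by move=> kn; rewrite -{1}x0E -x2n !xle.
have subI a b : x <= a -> b <= x + 2 * pi -> {subset `[a, b] <= `[x, x + 2 * pi]}.
  move=> xa bx z; rewrite !in_itv /= => /andP[az zb].
  by rewrite (le_trans xa az) (le_trans zb bx).
have cphiS a b : x <= a -> b <= x + 2 * pi -> {within `[a, b], continuous phi}.
  by move=> xa bx; apply: continuous_subspaceW cphi => z; exact: (subI a b).
have mphiS a b : x <= a -> b <= x + 2 * pi ->
    {in `[a, b] &, {homo phi : s t / s <= t}}.
  by move=> xa bx p q pI qI; apply: mphi; exact: (subI a b).
have goS a b w : x <= a -> b <= x + 2 * pi ->
    linear_on a b go w -> linear_on a b (gam \o phi) w.
  move=> xa bx lw s t sI tI /=.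
  by rewrite -!goE; [exact: lw|exact: (subI a b xa bx t tI)|exact: (subI a b xa bx s sI)].
have phi_le s t : x <= s -> s <= t -> t <= x + 2 * pi ->
    v * (phi t - phi s) <= vg * (t - s).
  move=> xs st tx; rewrite -lee_fin -gamv ?mulrBr; last first.
    by apply: (mphiS s t) => //; rewrite in_itv /= lexx st.
  apply: (@curve_length_reparam_le _ _ gam phi (fun t => vg * t)) => //.
  - exact: cphiS.
  - exact: mphiS.
  move=> s' t' ss st' tt; have xs' := le_trans xs ss; have tx' := le_trans tt tx.
  rewrite -!goE ?in_itv /= ?xs' ?tx' ?andbT ?(le_trans st' tx') ?(le_trans xs' st') //.
  apply: (@additive_bound_glue R X go (fun t => vg * t) x_ n.*2) => //.
  - by move=> i _; apply: xle.
  - move=> i p q _ ip pq qi; have [w wvg [l _]] := piece i.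
    by rewrite (linear_on_mdist l) // -mulrBr ler_wpM2r // subr_ge0.
  - by rewrite x0E.
  - by rewrite x2n.
have xx : x <= x + 2 * pi by rewrite lerDl ltW.
have vvg : v <= vg.
  have := phi_le x (x + 2 * pi) (lexx _) xx (lexx _); rewrite phi0 phi1.
  by rewrite addrAC subrr add0r ler_pM2r.
have v0 : 0 <= v.
  have := gamv 0 1 ler01; rewrite subr0 mulr1 => gam01.
  rewrite -lee_fin -gam01; apply: le_trans (mdist_le_curve_length gam ler01).
  by rewrite lee_fin mdist_ge0.
split => //.
have phiS k : (k < n.*2)%N -> phi (x_ k) <= phi (x_ k.+1).
  move=> kn; have := xI k (ltnW kn); have := xI k.+1 kn; have := xle k k.+1 (leqnSn k).
  by move=> *; apply: mphi; rewrite ?in_itv.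
(* Outside this piece the speed of [go] is at most [vg], so the whole deficit [2 * pi * (vg - v)]
   bounds the deficit of the piece; dividing by its duration [pi / n] gives [2 * n * (vg - v)]. *)
have lower k w : (k < n.*2)%N -> linear_on (x_ k) (x_ k.+1) go w ->
    vg - 2 * n%:R * (vg - v) <= w.
  move=> kn lw; have /andP[a1 a2] := xI k (ltnW kn); have /andP[b1 b2] := xI k.+1 kn.
  have h1 := phi_le x (x_ k) (lexx _) a1 a2.
  have h2 := phi_le (x_ k.+1) (x + 2 * pi) b1 b2 (lexx _).
  have h3 := reparam_linear_piece (xle _ _ (leqnSn k)) (cphiS _ _ a1 b2)
    (mphiS _ _ a1 b2) gamv (goS _ _ _ a1 b2 lw) (lexx _) (xle _ _ (leqnSn k)) (lexx _).
  rewrite phi0 in h1; rewrite phi1 in h2; rewrite -(ler_pM2r d0).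
  have -> : (vg - 2 * n%:R * (vg - v)) * d = vg * d - 2 * pi * (vg - v).
    by rewrite -nd; ring.
  rewrite xS in h2 h3.
  by move: h1 h2 h3; clear; lra.
have W_periodic j : W j = W (j %% n)%N.
  rewrite /W; have jE : j.*2 = ((j %% n).*2 + (j %/ n) * n.*2)%N.
    by rewrite {1}(divn_eq j n) doubleD addnC -doubleMr.
  have xm i : x_ (i + (j %/ n) * n.*2)%N = x_ i + (j %/ n)%:R * (2 * pi).
    elim: (j %/ n)%N => [|m IHm]; first by rewrite mul0n addn0 mul0r addr0.
    by rewrite mulSn addnCA addnC xn IHm -natr1; ring.
  by rewrite jE -!addSn !xm !loopn.
have Wlow j : vg - 2 * n%:R * (vg - v) <= W j.
  rewrite W_periodic; have jn := ltn_pmod j L20; move: (j %% n)%N jn => i ni.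
  have [w _ [lw wW]] := piece i.*2.+1; rewrite -(wW i erefl).
  by apply: lower lw; rewrite -doubleS leq_double.
have E0 : 0 <= 2 * n%:R * (vg - v) by apply: mulr_ge0; [exact: mulr_ge0|rewrite subr_ge0].
(* The pieces of [go] are carried to [gam] by [phi]: the breaks of [gam] are the points
   [phi (x_ k)]. *)
exists ge, go, phi, (phi \o x_), U, W => /=.
split.
- by [].
(* [U j >= 2 * W j - U j.+1] with [U j.+1 <= vg] doubles the deficit of [W j]: hence the 4 in
   [E]. *)
- move=> j; split; first by have [] := e1 j.
  rewrite Ug andbT; move: (WU j) (Ug j.+1) (Wlow j) E0; clear; lra.
- move=> j; have [h1 h2] := e2 j; split => //; rewrite Wg andbT.
  by move: (Wlow j) E0; clear; lra.
- move=> t tI; move: (tI) => /andP[t1 t2]; split; first by apply: goE; rewrite in_itv.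
  have h1 := phi_le x t (lexx _) t1 t2; have h2 := phi_le t (x + 2 * pi) t1 t2 (lexx _).
  rewrite phi0 in h1; rewrite phi1 in h2; rewrite -subr_ge0 in vvg.
  have h3 : (vg - v) * (t - x) <= (vg - v) * (2 * pi).
    by rewrite ler_wpM2l // lerBlDl.
  have h4 : (vg - v) * (x + 2 * pi - t) <= (vg - v) * (2 * pi).
    by rewrite ler_wpM2l // lerBlDr addrC lerD2l.
  rewrite ler_norml; move: h1 h2 h3 h4; clear; lra.
- split.
  + by rewrite x0E.
  + by rewrite x2n.
  + exact: phiS.
  + move=> k kn; have [w _ [lw _]] := piece k.
    have /andP[a1 a2] := xI k (ltnW kn); have /andP[b1 b2] := xI k.+1 kn.
    exact: reparam_linear_on (xle _ _ (leqnSn k)) v0 (cphiS _ _ a1 b2)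
      (mphiS _ _ a1 b2) gamv (goS _ _ _ a1 b2 lw).
Qed.

End shortening_step.

(** * Limits along an ultrafilter *)

Section ultralimits.

Lemma ultra_fmap {T U : Type} (f : T -> U) (F : set_system T) :
  UltraFilter F -> UltraFilter (f @ F).
Proof.
move=> FU; constructor; first exact: fmap_proper_filter.
move=> G GP sFG; apply/seteqP; split => [A GA|]; last exact: sFG.
have [//|FnA] := in_ultra_setVsetC (f @^-1` A) FU.
by have := filter_not_empty G; case; rewrite -(setICr A);
  apply: filterI => //; apply: sFG.
Qed.

Lemma ultra_compact_cvg {T : Type} {X : topologicalType} (F : set_system T) (f : T -> X)
    (A : set X) : UltraFilter F -> compact A -> (forall t, A (f t)) ->
  exists x : X, f @ F --> x.
Proof.
move=> FU; rewrite compact_ultra => cA Af.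
have [|x [_ fx]] := cA (f @ F) (ultra_fmap f FU); last by exists x.
exact: (@filterE _ F _ (f @^-1` A) Af).
Qed.

Lemma ultra_infty : exists F : set_system nat, UltraFilter F /\ \oo `<=` F.
Proof.
have [F [FU sF]] := @ultraFilterLemma nat \oo _; by exists F.
Qed.

End ultralimits.

Section limit_geodesic.
Context {R : realType} {X : metricType R}.
Context (F : set_system nat).
Context (FU : UltraFilter F).

Lemma cvg_mdist_eq (f g : nat -> X) (a b : X) (l : R) (u : nat -> R) :
  f @ F --> a -> g @ F --> b -> (forall k, mdist (f k) (g k) = u k) ->
  u @ F --> l -> mdist a b = l.
Proof.
move=> fa gb fg ul.
have h : (fun k => mdist (f k) (g k)) @ F --> (mdist a b : R) by exact: cvg_mdist.
have E : (fun k => mdist (f k) (g k)) = u by apply/funext.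
rewrite E in h; apply/eqP; rewrite eq_le; apply/andP; split.
  by apply: (ler_cvg_to h ul); exact: nearW.
by apply: (ler_cvg_to ul h); exact: nearW.
Qed.

Lemma cvg_mdist_le (f g : nat -> X) (a b : X) (l : R) (u : nat -> R) :
  f @ F --> a -> g @ F --> b -> (forall k, mdist (f k) (g k) <= u k) ->
  u @ F --> l -> mdist a b <= l.
Proof.
move=> fa gb fg ul.
have h : (fun k => mdist (f k) (g k)) @ F --> (mdist a b : R) by exact: cvg_mdist.
apply: (ler_cvg_to h ul); exact: nearW.
Qed.

Lemma cvg_linear_on (g : nat -> R -> X) (c : R -> X) (w : nat -> R) (l a b : R) :
  (forall t, g^~ t @ F --> c t) -> (forall k, linear_on a b (g k) (w k)) ->
  w @ F --> l -> linear_on a b c l.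
Proof.
move=> gc gw wl s t sI tI; apply: (cvg_mdist_eq (gc s) (gc t)).
  by move=> k; exact: gw.
by apply: cvgM => //; exact: cvg_cst.
Qed.

Lemma cvg_loop (g : nat -> R -> X) (c : R -> X) :
  (forall t, g^~ t @ F --> c t) -> (forall k, loop (g k)) -> loop c.
Proof.
move=> gc lg t; apply: mdist_positivity.
apply: (cvg_mdist_eq (gc (t + 2 * pi)) (gc t) (u := cst 0)); last exact: cvg_cst.
by move=> k; rewrite lg mdistxx.
Qed.

Lemma ultra_cvg_between (u w e : nat -> R) (l : R) :
  w @ F --> l -> e @ F --> (0 : R) ->
  (forall k, w k - e k <= u k <= w k) -> u @ F --> l.
Proof.
move=> wl e0 uw.
have we : (fun k => w k - e k) @ F --> l by rewrite -[l]subr0; exact: cvgB.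
by apply: (squeeze_cvgr _ we wl); apply: nearW => k; exact: uw.
Qed.

(** Periods are counted in [nat]: [m] of them bring [t] beyond [x], and [n] lead back into the
    fundamental interval. *)
Lemma mod_period (x t : R) : exists s m n,
  x <= s <= x + 2 * pi /\ t + m%:R * (2 * pi) = s + n%:R * (2 * pi).
Proof.
have p0 : 0 < 2 * pi :> R by rewrite mulr_gt0 // pi_gt0.
pose m := Num.bound (`|x - t| / (2 * pi)).
have mt : x <= t + m%:R * (2 * pi).
  have : `|x - t| < m%:R * (2 * pi).
    by rewrite -ltr_pdivrMr //; apply: archi_boundP; rewrite divr_ge0 // ltW.
  by have := ler_norm (x - t); lra.
have [|n /andP[n1 n2]] := @natr_floor R ((t + m%:R * (2 * pi) - x) / (2 * pi)).
  by apply: divr_ge0; [rewrite subr_ge0|exact: ltW].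
exists (t + m%:R * (2 * pi) - n%:R * (2 * pi)), m, n; split; last by rewrite subrK.
by move: n1 n2; rewrite ler_pdivlMr // ltr_pdivrMr // mulrDl mul1r; lra.
Qed.

Lemma loop_eq_on_period (f g : R -> X) x : loop f -> loop g ->
  (forall t, x <= t <= x + 2 * pi -> f t = g t) -> forall t, f t = g t.
Proof.
move=> lf lg fg t; have [s [m [n [sI E]]]] := mod_period x t.
by rewrite -(loopn m t lf) -(loopn m t lg) E !loopn // fg.
Qed.

(** Convergence on a finite grid of step [d] over one period suffices: the two Lipschitz bounds and
    the error at the grid point contribute [eta / 3] each. *)
Lemma near_uniform_lipschitz (g : nat -> R -> X) (c : R -> X) (M x eta : R) :
  0 < eta -> 0 <= M -> (forall k s t, mdist (g k s) (g k t) <= M * `|s - t|) ->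
  (forall s t, mdist (c s) (c t) <= M * `|s - t|) ->
  (forall k, loop (g k)) -> loop c ->
  (forall t, g^~ t @ F --> c t) ->
  \forall k \near F, forall t, mdist (g k t) (c t) <= eta.
Proof.
move=> eta0 M0 gM cM lg lc gc.
have p0 : 0 < 2 * pi :> R by rewrite mulr_gt0 // pi_gt0.
have e3 : 0 < eta / 3 by rewrite divr_gt0.
pose d := eta / (3 * (M + 1)); have d0 : 0 < d by rewrite divr_gt0 // mulr_gt0 //; lra.
have Md : M * d <= eta / 3.
  have -> : M * d = eta / 3 * (M / (M + 1)) by rewrite /d; field; rewrite gt_eqF //; lra.
  by rewrite ler_piMr ?(ltW e3) // ler_pdivrMr; lra.
pose n := (Num.bound (2 * pi / d)).+1.
have nd : 2 * pi <= n%:R * d.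
  rewrite -ler_pdivrMr //; apply/ltW; apply: lt_trans (archi_boundP _) _.
    by apply: divr_ge0; exact: ltW.
  by rewrite ltr_nat.
have grid : \forall k \near F, forall i, (i <= n)%N ->
    mdist (g k (x + i%:R * d)) (c (x + i%:R * d)) <= eta / 3.
  have one i : \forall k \near F,
      mdist (g k (x + i%:R * d)) (c (x + i%:R * d)) <= eta / 3.
    have := gc (x + i%:R * d); move/metricType_numDomainType.cvgrPdist_le/(_ _ e3).
    by apply: filterS => k; rewrite metric_sym.
  elim: n {nd} => [|n IHn].
    by apply: filterS (one 0%N) => k h i; rewrite leqn0 => /eqP ->.
  apply: filterS2 IHn (one n.+1) => k h1 h2 i.
  by rewrite leq_eqVlt => /predU1P[->//|]; exact: h1.
apply: filterS grid => k gk t.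
suff key s : x <= s <= x + 2 * pi -> mdist (g k s) (c s) <= eta.
  have [s [m [m' [sI E]]]] := mod_period x t.
  by rewrite -(loopn m t (lg k)) -(loopn m t lc) E !loopn // key.
move=> /andP[xs sx].
have [|i /andP[i1 i2]] := @natr_floor R ((s - x) / d).
  by apply: divr_ge0; [rewrite subr_ge0|exact: ltW].
rewrite ler_pdivlMr // ltr_pdivrMr // in i1 i2.
have iN : (i <= n)%N.
  by rewrite -(ler_nat R) -(ler_pM2r d0); lra.
have sd : `|s - (x + i%:R * d)| <= d by rewrite ler_norml; lra.
have h1 : mdist (g k s) (g k (x + i%:R * d)) <= eta / 3.
  by apply: le_trans (gM _ _ _) _; apply: le_trans Md; rewrite ler_wpM2l.
have h2 : mdist (c s) (c (x + i%:R * d)) <= eta / 3.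
  by apply: le_trans (cM _ _) _; apply: le_trans Md; rewrite ler_wpM2l.
have := gk i iN; have := metric_triangle (g k s) (g k (x + i%:R * d)) (c s).
have := metric_triangle (g k (x + i%:R * d)) (c (x + i%:R * d)) (c s).
by rewrite (metric_sym (c (x + i%:R * d))); lra.
Qed.

End limit_geodesic.

(** * From uniform closeness to closeness in [W^{1,2}] *)

Section closeness.
Context {R : realType} {X : metricType R}.
Context (K rho : R).
Context (rho_gt0 : 0 < rho).
Context (rho_ball : forall x : X, exists2 U, RK_domain K U & ball x rho `<=` U).

(** [eta] depends on the number [n] of pieces of [g] but not on their position [b], which varies
    along the sequence. As [c] is linear on all intervals of length at most [d], it contributes no
    breaks. *)
Lemma W12_dist_small (L d eps : R) (n : nat) : 0 < L -> 0 < d -> 0 < eps ->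
  exists2 eta : R, 0 < eta & forall (g c : R -> X) (b : nat -> R) (v w : R),
  loop g -> loop c ->
  (forall s t, mdist (g s) (g t) <= L * `|s - t|) ->
  (forall s t, mdist (c s) (c t) <= L * `|s - t|) ->
  v <= L -> w <= L ->
  (forall k, (k < n)%N -> b k <= b k.+1) -> b n = b 0%N + 2 * pi ->
  (forall k, (k < n)%N -> linear_on (b k) (b k.+1) g v) ->
  (forall s t, s <= t -> t - s <= d -> linear_on s t c w) ->
  (forall t, mdist (g t) (c t) <= eta) ->
  (W12_dist g c < eps%:E)%E.
Proof.
move=> L0 d0 eps0.
have [r [k [r0 k0 conv]]] := @mdist_linear_semiconvex R X K rho rho_gt0 rho_ball.
have p0 : 0 < pi :> R := pi_gt0 R.
(* Both speeds are at most [L], so the semiconvexity error is at most [C * e ^+ 2]. In [Z], the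
   summand [2 * pi] accounts for the integral of [f ^+ 2], which is at most [eta] since [eta <= 1];
   the other one is the energy bound. *)
pose C := k * (2 * L ^+ 2); have C0 : 0 <= C by rewrite mulr_ge0 // mulr_ge0 // sqr_ge0.
pose Z : R := 2 * pi + (4 * pi * C + 4 * n%:R * (2 * L)).
have Z0 : 0 < Z.
  have h1 : 0 <= pi * C by apply: mulr_ge0 => //; exact: ltW.
  have h2 : 0 <= n%:R * L by apply: mulr_ge0 => //; exact: ltW.
  by rewrite /Z; lra.
have Z2 : 0 < eps ^+ 2 / (2 * Z) by rewrite divr_gt0 ?exprn_gt0 // mulr_gt0.
pose eta := Num.min (Num.min 1 r) (eps ^+ 2 / (2 * Z)).
have eta0 : 0 < eta by rewrite !lt_min ltr01 r0.
have eta1 : eta <= 1 by rewrite !ge_min lexx.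
have etar : eta <= r by rewrite !ge_min lexx orbT.
have etaZ : eta * Z < eps ^+ 2.
  have : eta <= eps ^+ 2 / (2 * Z) by rewrite ge_min lexx orbT.
  rewrite ler_pdivlMr ?mulr_gt0 // => h.
  have : 0 < eta * Z by rewrite mulr_gt0.
  by lra.
exists eta => // g c b v w lg lc gL cL vL wL bS bn gb cd gc.
pose f t : R := mdist (g t) (c t).
have f01 t : 0 <= f t <= eta by rewrite mdist_ge0 gc.
have fL s t : `|f s - f t| <= 2 * L * `|s - t|.
  by apply: le_trans (ler_dist_mdist _ _ _ _) _; have := gL s t; have := cL s t; lra.
have lf : loop f by move=> t; rewrite /f lg lc.
(* [r / L] keeps [v * e] and [w * e] below [r]; [d / 2] makes [c] linear on [[t - e, t + e]]. *)
pose e0 := Num.min (r / L) (d / 2).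
have e0_gt0 : 0 < e0 by rewrite lt_min !divr_gt0.
have cf : continuous f.
  by apply: (@lipschitz_continuous R R^o f (2 * L)) => s t;
    rewrite mdist_regular; exact: fL.
apply: (@W12_norm_lt R f (2 * pi * eta) (eta * (4 * pi * C + 4 * n%:R * (2 * L)))) => //.
- rewrite (continuous_integralE _ _ (continuous_sqr cf)) lee_fin.
  have cc : continuous (fun _ : R => eta) by move=> ?; exact: cvg_cst.
  apply: le_trans (ler_Rintegral_itv (continuous_sqr cf) cc _) _.
    by move=> t _; have /andP[f0 f1] := f01 t; nra.
  rewrite Rintegral_cst //= lebesgue_measure_itv /= lte_fin mulr_gt0 // -EFinD /=.
  by rewrite subr0 mulrC.
- apply: (@energy_semiconvex_le R f b n (2 * L) C eta e0) => //.
  move=> j e t jn e_gt0; rewrite lt_min => /andP[er ed] tj.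
  have Le : L * e <= r by move: er; rewrite ltr_pdivlMr //; lra.
  have ve : v * e <= L * e by rewrite ler_pM2r.
  have we : w * e <= L * e by rewrite ler_pM2r.
  have lg' : linear_on (t - e) (t + e) g v 
    by apply: linear_on_sub (gb j jn); move: tj; clear - K rho X; lra.
  have lc' : linear_on (t - e) (t + e) c w.
    by apply: cd; move: e_gt0 ed; clear - K rho X; lra.
  have gt : mdist (g t) (c t) <= r by exact: le_trans (gc t) etar.
  have := conv g c t e v w (ltW e_gt0) lg' lc' (le_trans ve Le) (le_trans we Le) gt.
  rewrite -/(f t) -/(f (t - e)) -/(f (t + e)) => h; apply: le_trans h _; rewrite lerD2l.
  have te : t - e < t + e by move: e_gt0; clear - K rho X; lra.
  have v0 : 0 <= v := linear_on_speed_ge0 te lg'.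
  have w0 : 0 <= w := linear_on_speed_ge0 te lc'.
  rewrite /C -mulrA ler_wpM2l // -[X in _ <= X]mulrA -exprMn.
  have h1 : (v * e) ^+ 2 <= (L * e) ^+ 2.
    apply: sqr_le_sqr => //; apply: le_trans (mulr_ge0 v0 (ltW e_gt0)).
    by rewrite oppr_le0 mulr_ge0 // ltW.
  have h2 : (w * e) ^+ 2 <= (L * e) ^+ 2.
    apply: sqr_le_sqr => //; apply: le_trans (mulr_ge0 w0 (ltW e_gt0)).
    by rewrite oppr_le0 mulr_ge0 // ltW.
  by move: h1 h2; clear - K rho X; lra.
- have -> : 2 * pi * eta + eta * (4 * pi * C + 4 * n%:R * (2 * L)) = eta * Z.
    by rewrite /Z; ring.
  exact: etaZ.
Qed.

End closeness.

(** * Limits of shortened curves are closed geodesics *)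

Section limit.
Context {R : realType} {X : metricType R}.
Context (K rho : R) (L : nat).
Context (X_compact : compact [set: X]).
Context (rho_gt0 : 0 < rho).
Context (rho_ball : forall x : X, exists2 U, RK_domain K U & ball x rho `<=` U).
Context (L_gt0 : (0 < L)%N).
Context (L_large : pi / (L ^ 2)%:R <= rho / (2 * L%:R)).

(* The limit [e] of the [ge k] has speed exactly [w] on all even intervals, and its
   chords over the odd intervals have maximal length, so it is shortest there too.
   Uniqueness of short segments identifies it with the limit [o] of the [go k]. *)
Lemma shortening_limit (F : set_system nat) (x : R) (g gam : nat -> R -> X)
    (vg v : nat -> R) : UltraFilter F ->
  (forall k, loop (g k)) -> (forall k, loop (gam k)) ->
  (forall k s t, s <= t -> curve_length (g k) s t = (vg k * (t - s))%:E) ->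
  (forall k s t, s <= t -> curve_length (gam k) s t = (v k * (t - s))%:E) ->
  (forall k, vg k <= L%:R) ->
  (forall k, curve_shortening L x (g k) (gam k)) ->
  (fun k => vg k - v k) @ F --> (0 : R) ->
  exists c w, [/\ closed_geodesics rho L c, forall t, gam^~ t @ F --> c t,
    forall s t, mdist (c s) (c t) <= L%:R * `|s - t|, w <= L%:R &
    forall a b, a <= b -> b - a <= pi / (L ^ 2)%:R -> linear_on a b c w].
Proof.
move=> FU lg lgam gv gamv vgL short vgv.
pose n := (L ^ 2)%N; pose d : R := pi / n%:R; pose x_ := xpoint L x.
have n_gt0 : (0 < n)%N by rewrite expn_gt0 L_gt0.
have n0' : 0 < n%:R :> R by rewrite ltr0n.
have L0' : 0 < L%:R :> R by rewrite ltr0n.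
have d0 : 0 < d by rewrite divr_gt0 // pi_gt0.
have nd : n%:R * d = pi by rewrite /d mulrC divfK // gt_eqF.
have xS k : x_ k.+1 = x_ k + d by rewrite /x_ /xpoint -/n -/d -natr1; ring.
have xE k : x_ k = x + k%:R * d by [].
have dL : 2 * d * L%:R <= rho.
  by move: L_large; rewrite -/n -/d ler_pdivlMr ?mulr_gt0 //; lra.
have struct k := (shortening_structure L_gt0 (lg k) (gv k) (gamv k) (short k)).2.
have /choice[ge {}struct] := struct; have /choice[go {}struct] := struct.
have /choice[phi {}struct] := struct; have /choice[b {}struct] := struct.
have /choice[U {}struct] := struct; have /choice[W {}struct] := struct.
have lge k : loop (ge k) by case: (struct k) => -[].
have lgo k : loop (go k) by case: (struct k) => -[].
have lin_ge k j : linear_on (x_ j.*2) (x_ j.*2.+2) (ge k) (U k j).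
  by case: (struct k) => _ /(_ j)[].
have UE k j : vg k - 4 * (L ^ 2)%:R * (vg k - v k) <= U k j <= vg k.
  by case: (struct k) => _ /(_ j)[].
have lin_go k j : linear_on (x_ j.*2.+1) (x_ j.*2.+3) (go k) (W k j).
  by case: (struct k) => _ _ /(_ j)[].
have WE k j : vg k - 4 * (L ^ 2)%:R * (vg k - v k) <= W k j <= vg k.
  by case: (struct k) => _ _ /(_ j)[].
have goge k j : go k (x_ j.*2.+1) = ge k (x_ j.*2.+1).
  by case: (struct k) => _ _ /(_ j)[].
have phiP k t : x <= t <= x + 2 * pi ->
    go k t = gam k (phi k t) /\ `|v k * (phi k t - t)| <= 2 * pi * (vg k - v k).
  by case: (struct k) => _ _ _ + _; exact.
have cvgX (f : nat -> X) : exists l : X, f @ F --> l.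
  exact: (ultra_compact_cvg FU X_compact).
have /choice[e eP] t : exists l : X, ge^~ t @ F --> l by exact: cvgX.
have /choice[ o oP] t : exists l : X, go^~ t @ F --> l by exact: cvgX.
have /choice[c cP] t : exists l : X, gam^~ t @ F --> l by exact: cvgX.
have v0 k : 0 <= v k.
  have h := gamv k 0 1 ler01; rewrite subr0 mulr1 in h.
  rewrite -lee_fin -h; apply: le_trans (mdist_le_curve_length (gam k) ler01).
  by rewrite lee_fin mdist_ge0.
have vvg k : v k <= vg k.
  exact: (shortening_structure L_gt0 (lg k) (gv k) (gamv k) (short k)).1.
have [w vgw] : exists w : R, vg @ F --> w.
  apply: (ultra_compact_cvg FU (@segment_compact R 0 L%:R)).
  by move=> k; rewrite /= in_itv /= vgL (le_trans (v0 k) (vvg k)).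
have w0 : 0 <= w.
  have h : (fun _ : nat => 0 : R) @ F --> (0 : R) by exact: cvg_cst.
  by apply: (ler_cvg_to h vgw); apply: nearW => k; exact: le_trans (vvg k).
have wL : w <= L%:R.
  have h : (fun _ : nat => L%:R : R) @ F --> (L%:R : R) by exact: cvg_cst.
  by apply: (ler_cvg_to vgw h); exact: nearW.
have E0 : (fun k => 4 * (L ^ 2)%:R * (vg k - v k)) @ F --> (0 : R).
  by rewrite -(mulr0 (4 * (L ^ 2)%:R)); apply: cvgM => //; exact: cvg_cst.
have vw : v @ F --> w.
  apply: (ultra_cvg_between FU vgw vgv) => k.
  by rewrite opprB addrCA subrr addr0 lexx vvg.
have Uw j : (fun k => U k j) @ F --> w.
  by apply: (ultra_cvg_between FU vgw E0) => k; exact: UE.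
have Ww j : (fun k => W k j) @ F --> w.
  by apply: (ultra_cvg_between FU vgw E0) => k; exact: WE.
have lin_e j : linear_on (x_ j.*2) (x_ j.*2.+2) e w.
  by apply: (cvg_linear_on FU eP _ (Uw j)) => k; exact: lin_ge.
have lin_o j : linear_on (x_ j.*2.+1) (x_ j.*2.+3) o w.
  by apply: (cvg_linear_on FU oP _ (Ww j)) => k; exact: lin_go.
have oe j : o (x_ j.*2.+1) = e (x_ j.*2.+1).
  apply: mdist_positivity.
  apply: (cvg_mdist_eq FU (oP _) (eP _) (u := cst 0)); last exact: cvg_cst.
  by move=> k; rewrite goge mdistxx.
have lin_e' j : linear_on (x_ j.*2.+1) (x_ j.*2.+3) e w.
  have l1 := lin_e j; have l2 := lin_e j.+1; rewrite doubleS in l2.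
  apply: (@linear_on_glue R X e _ (x_ j.*2.+2)) => //; rewrite ?xS; try lra.
  - by apply: linear_on_sub l1; rewrite ?xS; lra.
  - by apply: linear_on_sub l2; rewrite ?xS; lra.
  - rewrite -!xS; have oj1 := oe j.+1; rewrite doubleS in oj1.
    by rewrite -oe -oj1 (linear_on_mdist (lin_o j)) ?xS; lra.
have eo j t : t \in `[x_ j.*2.+1, x_ j.*2.+3] -> o t = e t.
  apply: (linear_on_unique rho_gt0 rho_ball w0 (lin_o j) (lin_e' j)).
  - apply: le_trans dL; rewrite !xS.
    have : w * d <= L%:R * d by rewrite ler_pM2r.
    lra.
  - exact: oe.
  - by have := oe j.+1; rewrite doubleS.
(* For odd [m] this is an even interval, on which [e] is linear; it is covered by two odd intervals,
   where [o] and [e] coincide. *)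
have lin2 m : linear_on (x_ m.+1) (x_ m.+3) o w.
  have [m_odd|m_even] := boolP (odd m); last first.
    have mE : m = (m./2).*2 by rewrite -[LHS](odd_double_half m) (negbTE m_even).
    by rewrite mE; exact: lin_o.
  have mE : m = (m./2).*2.+1 by rewrite -[LHS](odd_double_half m) m_odd.
  rewrite mE; move: (m./2) => j {mE m_odd}.
  have eoj t : t \in `[x_ j.*2.+2, x_ j.*2.+4] -> o t = e t.
    rewrite in_itv /= => /andP[t1 t2].
    have [t3|t3] := leP t (x_ j.*2.+3).
      by apply: (eo j); rewrite in_itv /= t3 andbT; apply: le_trans t1; rewrite !xS; lra.
    apply: (eo j.+1); rewrite in_itv /= doubleS (ltW t3) /=.
    by apply: (le_trans t2); rewrite !xS; lra.
  have := lin_e j.+1; rewrite doubleS => l s t sI tI.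
  by rewrite !eoj // l.
have gamL k s t : mdist (gam k s) (gam k t) <= v k * `|s - t|.
  have le s' t' : s' <= t' -> mdist (gam k s') (gam k t') <= v k * (t' - s').
    by move=> st; rewrite -lee_fin -gamv //; exact: mdist_le_curve_length.
  have [st|/ltW ts] := leP s t; first by rewrite distrC ger0_norm ?subr_ge0 // le.
  by rewrite metric_sym ger0_norm ?subr_ge0 // le.
have lc : loop c by exact: cvg_loop cP lgam.
have lo : loop o by exact: cvg_loop oP lgo.
(* [phi k t] need not tend to [t] if the speeds tend to 0, but [v k * (phi k t - t)] tends to 0, and
   it bounds the distance. *)
have co t : c t = o t.
  move: t; apply: (loop_eq_on_period (x := x) lc lo) => t tI.
  apply: mdist_positivity; apply/eqP; rewrite eq_le mdist_ge0 andbT.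
  have h : (fun k => 2 * pi * (vg k - v k)) @ F --> (0 : R).
    by rewrite -(mulr0 (2 * pi)); apply: cvgM => //; exact: cvg_cst.
  apply: (cvg_mdist_le FU (cP t) (oP t) _ h) => k.
  have [-> vphi] := phiP k t tI.
  apply: le_trans (gamL k _ _) _; apply: le_trans vphi.
  by rewrite normrM (ger0_norm (v0 k)) distrC.
(* An interval of length at most [d] that starts in [[x_ j, x_ j.+1]] lies in the window
   [[x_ j, x_ j.+2]] of [lin2]. The base point [x_ 1] ensures [j >= 1]. *)
have lin_c a a' : a <= a' -> a' - a <= d -> linear_on a a' c w.
  move=> aa ad; have [s [m [i [/andP[s1 s2] E]]]] := mod_period (x_ 1%N) a.
  have E' : a' + m%:R * (2 * pi) = s + (a' - a) + i%:R * (2 * pi).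
    by rewrite addrAC -E; ring.
  apply: (loop_linear_on_unshift (n := m) lc); rewrite E E'.
  apply: (loop_linear_on_shift (n := i) lc).
  have xs : d <= s - x by move: s1; rewrite xS /x_ /xpoint mul0r addr0; lra.
  have [|j /andP[j1 j2]] := @natr_floor R ((s - x) / d).
    by apply: divr_ge0; [exact: le_trans (ltW d0) xs|exact: ltW].
  rewrite ler_pdivlMr // ltr_pdivrMr // in j1 j2.
  have [m' jE] : exists m', j = m'.+1.
    case: j j1 j2 => [_|m' _ _]; last by exists m'.
    by rewrite add0r mul1r ltNge xs.
  have l := lin2 m'; rewrite -jE in l.
  have xj : x_ j = x + j%:R * d by [].
  move=> p q pI qI; rewrite !co.
  have sub z : z \in `[s, s + (a' - a)] -> z \in `[x_ j, x_ j.+2].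
    by rewrite !in_itv /= !xS xj; move: j1 j2 ad; lra.
  by apply: l; exact: sub.
have cL s t : mdist (c s) (c t) <= L%:R * `|s - t|.
  have h : (fun _ : nat => L%:R * `|s - t|) @ F --> (L%:R * `|s - t| : R).
    exact: cvg_cst.
  apply: (cvg_mdist_le FU (cP s) (cP t) _ h) => k.
  by apply: le_trans (gamL k s t) _; rewrite ler_wpM2r // (le_trans (vvg k)).
have c_len s t : s <= t -> (curve_length c s t <= (L%:R * (t - s))%:E)%E.
  move=> st; rewrite mulrBr.
  apply: (@curve_length_le R X c (fun t => L%:R * t)) => p q ? pq ?.
  by have := cL p q; rewrite distrC ger0_norm ?subr_ge0 // mulrBr.
have c_geo (D : set R) : geodesic_on D c w.
  move=> t _; exists (d / 2) => [|s s' _ _ st st']; first by rewrite divr_gt0.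
  have lt := lin_c (t - d / 2) (t + d / 2).
  have d2 : 0 <= d / 2 by rewrite divr_ge0 // ltW.
  move: st st'; rewrite !ltr_distl => /andP[/ltW s1 /ltW s2] /andP[/ltW s1' /ltW s2'].
  apply: lt; rewrite ?in_itv /= ?s1 ?s2 ?s1' ?s2' //.
    by rewrite lerBlDr -addrA lerDl addr_ge0.
  by rewrite (_ : t + d / 2 - (t - d / 2) = d) //; field.
exists c, w; split => //; split.
(* The even points serve as unnecessary breaks; the segments between them have length at most
   [2 * d * L], hence at most [rho] by [L_large]. *)
- split => //; exists w, (fun i => x_ i.*2); split.
    split => //; first by move=> i _; rewrite doubleS !xS; lra.
    by rewrite /x_ /xpoint -/n -/d -muln2 natrM /= mul0r addr0 -nd; ring.
  move=> i _; split; first exact: c_geo.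
  rewrite doubleS; apply: le_trans (c_len _ _ _) _; rewrite ?lee_fin !xS; first by lra.
  by apply: le_trans dL; rewrite le_eqVlt; apply/orP; left; apply/eqP; ring.
- by exists w; exact: c_geo.
- apply: le_trans (c_len _ _ _) _; first by rewrite mulr_ge0 // pi_ge0.
  rewrite lee_fin subr0 -nd -/n.
  have : 2 * d * L%:R * n%:R <= rho * n%:R by rewrite ler_pM2r.
  lra.
Qed.

(** A single index is enough to refute a sequence of counterexamples; it is taken from a set of an
    ultrafilter refining [\oo]. *)
Lemma shortening_near_geodesic (x : R) (g gam : nat -> R -> X) (vg v : nat -> R)
    (eps : R) :
  0 < eps ->
  (forall k, loop (g k)) -> (forall k, loop (gam k)) ->
  (forall k s t, s <= t -> curve_length (g k) s t = (vg k * (t - s))%:E) ->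
  (forall k s t, s <= t -> curve_length (gam k) s t = (v k * (t - s))%:E) ->
  (forall k, vg k <= L%:R) ->
  (forall k, curve_shortening L x (g k) (gam k)) ->
  (fun k => vg k - v k) @ \oo --> (0 : R) ->
  exists k, (W12_dist_set (gam k) (closed_geodesics rho L) < eps%:E)%E.
Proof.
move=> eps0 lg lgam gv gamv vgL short vgv.
have [F [FU sF]] := ultra_infty.
have vgF : (fun k => vg k - v k) @ F --> (0 : R).
  by apply: cvg_trans vgv => A; exact: sF.
have [c [w [cG cP cL wL lin_c]]] :=
  shortening_limit FU lg lgam gv gamv vgL short vgF.
have n_gt0 : (0 < L ^ 2)%N by rewrite expn_gt0 L_gt0.
have d0 : 0 < pi / (L ^ 2)%:R :> R by rewrite divr_gt0 ?pi_gt0 // ltr0n.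
have L0' : 0 < L%:R :> R by rewrite ltr0n.
have [eta eta0 small] := @W12_dist_small R X K rho rho_gt0 rho_ball L%:R _ eps
  (L ^ 2).*2 L0' d0 eps0.
have struct k := shortening_structure L_gt0 (lg k) (gv k) (gamv k) (short k).
have vL k : v k <= L%:R by apply: le_trans (vgL k); exact: (struct k).1.
have gamL k s t : mdist (gam k s) (gam k t) <= L%:R * `|s - t|.
  have le s' t' : s' <= t' -> mdist (gam k s') (gam k t') <= L%:R * (t' - s').
    move=> st; apply: (@le_trans _ _ (v k * (t' - s'))); last first.
      by rewrite ler_wpM2r // subr_ge0.
    by rewrite -lee_fin -gamv //; exact: mdist_le_curve_length.
  have [st|/ltW ts] := leP s t; first by rewrite distrC ger0_norm ?subr_ge0 // le.
  by rewrite metric_sym ger0_norm ?subr_ge0 // le.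
have lc : loop c by case: cG => -[].
have /filter_ex[k gc] := near_uniform_lipschitz FU x eta0 (ltW L0') gamL cL lgam lc cP.
exists k; apply: (@le_lt_trans _ _ (W12_dist (gam k) c)).
  by apply: ereal_inf_lbound; exists c.
have [_ [ge [go [phi [b [U [W [_ _ _ _ [b0 bn bS lb]]]]]]]]] := struct k.
apply: (small (gam k) c b (v k) w) => //; first by rewrite bn b0.
Qed.

End limit.

(** * Energy and length of the slices, and the contradiction argument *)

Section replacement_energy.
Context {R : realType} {X : metricType R}.

Lemma slice_continuous (sigma : R -> R -> X) s : sweepout sigma ->
  s \in `[-1, 1] -> continuous (sigma s).
Proof.
move=> [/subspace_continuousP cs _ _ _ _] sI t.
have h := cs (s, t) (conj sI I : (`[-1, 1] `*` [set: R]) (s, t)).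
have cp : (fun t' : R => (s, t')) @ t --> (s, t).
  exact: (cvg_pair (cvg_cst s) (@cvg_id _ (nbhs t))).
apply: cvg_trans h => B /= HB.
change (nbhs t (sigma s @^-1` B)).
have cpB : nbhs t [set t1 | (`[-1, 1] `*` [set: R]) (s, t1) -> B (sigma s t1)].
  exact: (cp _ HB).
by apply: filterS cpB => t1 /=; apply; split.
Qed.

(** [2 * pi * v] is the perimeter of the polygon inscribed in [u] at the points [y i]: each chord
    equals [v * (phi (y i.+1) - phi (y i))], and these telescope. *)
Lemma reparam_linear_replacement_energy N (y : nat -> R) (u tau sigma : R -> X) (v : R) :
  continuous u -> loop u -> circle_partition N y ->
  linear_replacement N y u tau ->
  constant_speed_reparam (y 0%N) tau sigma ->
  (forall s t, s <= t -> curve_length sigma s t = (v * (t - s))%:E) ->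
  (((2 * pi * v) ^+ 2 / (2 * pi))%:E <= energy u)%E.
Proof.
move=> cu lu yP [_ rep] [lsig [phi [cphi mphi [phi0 phi1] tauE]] _] sigv.
apply: le_trans (energy_ge_polygon cu lu yP).
case: yP => N0 ylt yN; rewrite lee_fin.
suff -> : 2 * pi * v = \sum_(i < N) mdist (u (y i)) (u (y i.+1)) by [].
have yle i j : (i <= j <= N)%N -> y i <= y j.
  move=> /andP[]; move=> /subnK <-; elim: (j - i)%N => [//|m IHm] mN.
  by apply: le_trans (IHm (ltnW mN)) _; exact/ltW/ylt.
have yI i : (i <= N)%N -> y 0%N <= y i <= y 0%N + 2 * pi.
  by move=> iN; rewrite -yN !yle // ?leqnn ?andbT.
transitivity (\sum_(0 <= i < N) (v * phi (y i.+1) - v * phi (y i))).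
  by rewrite (telescope_sumr (fun i => v * phi (y i)) (leq0n N)) phi0 yN phi1; ring.
rewrite big_mkord; apply: eq_bigr => i _.
have iN := ltn_ord i; have [h1 h2 [w lw]] := rep i iN.
have /andP[a1 a2] := yI i (ltnW iN); have /andP[b1 b2] := yI i.+1 iN.
have yy := ylt i iN.
rewrite -mulrBr -h1 -h2 (linear_on_mdist lw) ?lexx ?ltW //.
apply: (reparam_linear_piece (h := sigma) (a := y i) (b := y i.+1)) => //;
  rewrite ?ltW //.
- by apply: continuous_subspaceW cphi => z; rewrite /= !in_itv /=; lra.
- by move=> p q pI qI; apply: mphi; move: pI qI; rewrite !in_itv /=; lra.
- move=> s t sI tI /=; rewrite -!tauE; [exact: lw|move: tI|move: sI];
    by rewrite !in_itv /=; lra.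
Qed.

End replacement_energy.

Lemma convexity_radius_ball (R : realType) (X : metricType R) (K rho : R)
  (rho_ : X -> R) : (forall x, convexity_radius K x (rho_ x)) ->
  rho = inf (range rho_) ->
  forall x : X, exists2 U, RK_domain K U & ball x rho `<=` U.
Proof.
move=> rhoP -> x; have [r0 [U [_ UK bU _]]] := rhoP x.
exists U => //; apply: subset_trans bU; apply: le_ball.
apply: ge_inf; last by exists x.
by exists 0 => _ [z _ <-]; have [/ltW] := rhoP z.
Qed.

Theorem theorem4p14 (R : realType) (X : metricType R) (K : R)
  (X_closed : closed_space X) (X_alexandrov : alexandrov X K)
  (rho_ : X -> R) (rho_P : forall x, convexity_radius K x (rho_ x))
  (rho : R) (rhoE : rho = inf (range rho_)) (rho_gt0 : 0 < rho)
  (sigma_hat : R -> R -> X) (sigma_hat_sweepout : sweepout sigma_hat)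
  (hsigma : nat -> R -> R -> X)
  (hsigma_Omega : forall j, (0 < j)%N -> Omega sigma_hat (hsigma j))
  (hsigma_energy : forall j, (0 < j)%N ->
    (max_energy (hsigma j) < width sigma_hat + (j%:R^-1)%:E)%E)
  (N : nat) (y : nat -> R) (y_partition : circle_partition N y)
  (hsigma_ball : forall j s i, (0 < j)%N -> s \in `[-1, 1] -> (i < N)%N ->
    exists p r, r <= rho /\ hsigma j s @` `[y i, y i.+1] `<=` ball p r)
  (tau sigma : nat -> R -> R -> X)
  (tauP : forall j s, (0 < j)%N -> s \in `[-1, 1] ->
    linear_replacement N y (hsigma j s) (tau j s))
  (sigmaP : forall j s, (0 < j)%N -> s \in `[-1, 1] ->
    constant_speed_reparam (y 0%N) (tau j s) (sigma j s))
  (L : nat) (L_gt0 : (0 < L)%N) (N_le_L2 : (N <= L ^ 2)%N)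
  (L_large : pi / (L ^ 2)%:R <= rho / (2 * L%:R))
  (sigma_Lambda : forall j s, (0 < j)%N -> s \in `[-1, 1] ->
    Lambda rho L (sigma j s))
  (x0 : R) (gamma : nat -> R -> R -> X)
  (gammaP : forall j s, (0 < j)%N -> s \in `[-1, 1] ->
    curve_shortening L x0 (sigma j s) (gamma j s))
  (eps : R) (eps_gt0 : 0 < eps) :
  exists2 delta : R, 0 < delta &
    forall j : nat, 1 / delta < j%:R ->
    forall s0 : R, s0 \in `[-1, 1] ->
      ((2 * pi)%:E * energy (gamma j s0) = loop_length (gamma j s0) ^+ 2)%E ->
      ((2 * pi)%:E * (width sigma_hat - delta%:E)
         < loop_length (gamma j s0) ^+ 2)%E ->
      (W12_dist_set (gamma j s0) (closed_geodesics rho L) < eps%:E)%E.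
Proof.
have p0 : 0 < 2 * pi :> R by rewrite mulr_gt0 // pi_gt0.
have rho_ball := convexity_radius_ball rho_P rhoE.
have width_le j : (0 < j)%N -> (width sigma_hat <= max_energy (hsigma j))%E.
  by move=> j0; apply: ereal_inf_lbound; exists (hsigma j) => //; exact: hsigma_Omega.
(* The strict inequality for [hsigma 1] excludes both infinite values. *)
have [w wE] : exists w, width sigma_hat = w%:E.
  have := hsigma_energy 1%N isT; have := width_le 1%N isT.
  case: (width sigma_hat) => [w _ _|h1 h2|_ h2]; first by exists w.
  - by have := lt_le_trans h2 (leey _); rewrite ltNge h1.
  - by move: h2; rewrite ltNge leNye.
have speed j s : (0 < j)%N -> s \in `[-1, 1] -> exists vg v : R,
    [/\ forall a b, a <= b -> curve_length (sigma j s) a b = (vg * (b - a))%:E,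
        forall a b, a <= b -> curve_length (gamma j s) a b = (v * (b - a))%:E
      & (2 * pi * vg) ^+ 2 < 2 * pi * (w + j%:R^-1)].
  move=> j0 sI; have [_ _ [vg vgP]] := sigmaP j s j0 sI.
  have [ge [go [_ _ [_ _ [v vP]]]]] := gammaP j s j0 sI.
  exists vg, v; split => //.
  have [sw _] := hsigma_Omega j j0; have [_ /(_ s sI)[lu _ _] _ _ _] := sw.
  have := reparam_linear_replacement_energy (slice_continuous sw sI) lu y_partition
    (tauP j s j0 sI) (sigmaP j s j0 sI) vgP.
  move=> h; rewrite -ltr_pdivrMl // mulrC -lte_fin; apply: (le_lt_trans h).
  rewrite EFinD -wE; apply: le_lt_trans (hsigma_energy j j0).
  by apply: ereal_sup_ubound; exists s.
apply: contrapT => /forall2NP no_delta.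
(* Counterexamples to [delta = k.+1%:R^-1]. *)
have /choice[j jP] (k : nat) : exists j, exists s : R,
    [/\ k.+1%:R < j%:R :> R, s \in `[-1, 1],
        ((2 * pi)%:E * (width sigma_hat - (k.+1%:R^-1)%:E)
          < loop_length (gamma j s) ^+ 2)%E
      & ~ (W12_dist_set (gamma j s) (closed_geodesics rho L) < eps%:E)%E].
  have [|bad] := no_delta k.+1%:R^-1; first by case; rewrite invr_gt0 ltr0n.
  apply: contrapT => none; apply: bad => j jk s sI _ len.
  apply: contrapT => far; apply: none; exists j, s; split => //.
  by move: jk; rewrite div1r invrK.
have /choice[s {}jP] := jP.
have j0 k : (0 < j k)%N by have [+ _ _ _] := jP k; rewrite ltr_nat; case: (j k).
have sI k : s k \in `[-1, 1] by have [] := jP k.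
have /choice[vg /choice[v vP]] k := speed (j k) (s k) (j0 k) (sI k).
have gv k : forall a b, a <= b ->
    curve_length (sigma (j k) (s k)) a b = (vg k * (b - a))%:E by have [] := vP k.
have gamv k : forall a b, a <= b ->
    curve_length (gamma (j k) (s k)) a b = (v k * (b - a))%:E by have [] := vP k.
have lg k : loop (sigma (j k) (s k)) by have [] := sigma_Lambda (j k) (s k) (j0 k) (sI k).
have lgam k : loop (gamma (j k) (s k)).
  by have [ge [go [_ _ []]]] := gammaP (j k) (s k) (j0 k) (sI k).
have vgL k : vg k <= L%:R.
  rewrite -lee_fin; have := gv k 0 1 ler01; rewrite subr0 mulr1 => <-.
  have [_ gL _] := sigma_Lambda (j k) (s k) (j0 k) (sI k).
  apply: le_trans (@curve_length_le R X _ (fun t => L%:R * t) 0 1 _) _.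
    by move=> a b _ ab _; have := gL a b; rewrite distrC ger0_norm ?subr_ge0 // mulrBr.
  by rewrite mulr1 mulr0 subr0.
have vvg k : v k <= vg k.
  exact: (shortening_structure L_gt0 (lg k) (gv k) (gamv k)
    (gammaP (j k) (s k) (j0 k) (sI k))).1.
have v0 k : 0 <= v k.
  have h := gamv k 0 1 ler01; rewrite subr0 mulr1 in h.
  rewrite -lee_fin -h; apply: le_trans (mdist_le_curve_length _ ler01).
  by rewrite lee_fin mdist_ge0.
(* The energy bound on [hsigma] and the lower bound on the length of [gamma] enclose
   [vg k ^+ 2 - v k ^+ 2]. Since [0 <= v k <= vg k], this difference dominates [(vg k - v k) ^+ 2],
   without any positive lower bound on the speeds. *)
have gap k : (vg k - v k) ^+ 2 <= k.+1%:R^-1.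
  have [_ _ hi] := vP k; have [jk _ lo _] := jP k.
  move: lo; rewrite /loop_length (gamv k 0 (2 * pi) (ltW p0)) subr0 wE.
  rewrite -EFinB -EFinM -EFin_expe lte_fin => lo.
  have jk' : (j k)%:R^-1 <= k.+1%:R^-1 :> R by rewrite lef_pV2 ?posrE ?ltr0n // ltW.
  have h1 : (2 * pi) * ((2 * pi) * (vg k ^+ 2 - v k ^+ 2)) <= (2 * pi) * (2 * k.+1%:R^-1).
    have : 2 * pi * (j k)%:R^-1 <= 2 * pi * k.+1%:R^-1 :> R.
      by apply: ler_wpM2l => //; exact: ltW.
    move: hi lo; rewrite !exprMn.
    move: (j k)%:R^-1 k.+1%:R^-1 (vg k) (v k) => p q a b; lra.
  rewrite ler_pM2l // in h1.
  have h2 : (vg k - v k) ^+ 2 <= vg k ^+ 2 - v k ^+ 2.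
    have := v0 k; have := vvg k; nra.
  have pi2 : 2 <= 2 * pi :> R by have := @pi_ge2 R; lra.
  have h3 : 0 <= vg k ^+ 2 - v k ^+ 2 by apply: le_trans h2; exact: sqr_ge0.
  have h4 : 2 * (vg k ^+ 2 - v k ^+ 2) <= 2 * pi * (vg k ^+ 2 - v k ^+ 2).
    by rewrite ler_wpM2r.
  by move: h1 h2 h4; move: k.+1%:R^-1 => q; lra.
have gap0 : (fun k => vg k - v k) @ \oo --> (0 : R).
  apply/cvgrPdist_lt => e e0; have e20 : 0 < e ^+ 2 by rewrite exprn_gt0.
  have := @cvg_harmonic R; move/cvgrPdist_lt/(_ _ e20); apply: filterS => k.
  rewrite !sub0r !normrN ger0_norm ?invr_ge0 // => ke.
  rewrite ger0_norm ?subr_ge0 // ltNge; apply/negP => ed.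
  have : e ^+ 2 <= (vg k - v k) ^+ 2 by apply: sqr_le_sqr => //; lra.
  by rewrite leNgt (le_lt_trans (gap k) ke).
have [k near_k] := shortening_near_geodesic X_closed.1 rho_gt0 rho_ball L_gt0 L_large
  eps_gt0 lg lgam gv gamv vgL (fun k => gammaP (j k) (s k) (j0 k) (sI k)) gap0.
by have [_ _ _ []] := jP k.
Qed.
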